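(* Let $\Omega\subset\mathbb{R}^2$ be an equilateral triangle, let $c\in(0,\mu_2]$, and let $u_c$ be a solution of $$-\Delta u=cu \ \text{ in } \Omega,\qquad \frac{\partial u}{\partial\nu}=-1\ \text{ on }\partial\Omega .$$ Then $$\lim_{c\to\mu_2^-}c\int_{\partial\Omega}u_c\,d\sigma=\mu_2\int_{\partial\Omega}u_{\mu_2}\,d\sigma>\frac12\,\frac{P^2(\Omega)}{|\Omega|}.$$
   Context: $\mu_2$ is the second Neumann Laplacian eigenvalue of $\Omega$ (the first being $0$). Solutions are weak solutions in $H^1(\Omega)$: $\int_\Omega\nabla u_c\cdot\nabla\varphi\,dx+\int_{\partial\Omega}\varphi\,d\sigma=c\int_\Omega u_c\varphi\,dx$ for all $\varphi\in H^1(\Omega)$; for $c\in(0,\mu_2)$ the solution is unique. $u_{\mu_2}$ is any solution with $c=\mu_2$ (such solutions exist on equilateral triangles, and they differ by Neumann eigenfunctions of $\mu_2$, which have zero integral over $\partial\Omega$). $\nu$ is the outer unit normal, $d\sigma$ the boundary measure, $P(\Omega)$ the perimeter and $|\Omega|$ the area of $\Omega$. *)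

(* Defs.v *)
From HB Require Import structures.
From mathcomp Require Import all_boot all_order all_algebra.
From mathcomp Require Import all_classical all_reals all_analysis.

Set Implicit Arguments.
Unset Strict Implicit.
Unset Printing Implicit Defensive.

Import Order.TTheory GRing.Theory Num.Theory.
Import numFieldNormedType.Exports.

Local Open Scope classical_set_scope.
Local Open Scope ring_scope.

Notation leb1 R := (@lebesgue_measure R).
Notation leb2 R := (@lebesgue_measure R \x @lebesgue_measure R)%E.

Section Calculus.
Variable R : realType.
Implicit Types (p q : R * R) (f : R * R -> R).

Definition dot p q : R := p.1 * q.1 + p.2 * q.2.

(* The library norm on R * R is the sup norm, hence this explicit one. *)
Definition edist p q : R := Num.sqrt ((p.1 - q.1) ^+ 2 + (p.2 - q.2) ^+ 2).

Definition grad f p : R * R := ('D_(1, 0) f p, 'D_(0, 1) f p).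

Definition C1 f : Prop :=
  (forall p, derivable f p (1, 0) /\ derivable f p (0, 1)) /\
  continuous (grad f).

Definition L2 d (T : measurableType d) (m : {measure set T -> \bar R})
    (D : set T) (h : T -> R) : Prop :=
  measurable_fun D h /\ m.-integrable D (fun x => (h x ^+ 2)%:E).

End Calculus.

Section Sobolev.
Variables (R : realType) (Om : set (R * R)).
Implicit Types (u f : R * R -> R) (G : R * R -> R * R) (mu : R).

(* Testing with C^1_c(Om) instead of C^oo_c(Om) yields the same weak
   derivatives, by mollification. *)
Definition test_fun f : Prop :=
  C1 f /\ exists K : set (R * R),
    [/\ compact K, K `<=` Om & forall p, ~ K p -> f p = 0].

(* u belongs to H^1(Om) and G is its weak gradient, which is determined by u
   almost everywhere in Om. *)
Definition H1 u G : Prop :=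
  [/\ L2 (leb2 R) Om u,
      L2 (leb2 R) Om (fun p => (G p).1),
      L2 (leb2 R) Om (fun p => (G p).2)
    & forall f, test_fun f ->
        (\int[leb2 R]_(p in Om) (u p * (grad f p).1)) =
          - (\int[leb2 R]_(p in Om) ((G p).1 * f p)) /\
        (\int[leb2 R]_(p in Om) (u p * (grad f p).2)) =
          - (\int[leb2 R]_(p in Om) ((G p).2 * f p))].

(* Weak form of - Laplacian w = mu w with zero normal derivative.  The
   requirement w <> 0 is left to [eigen_indep]. *)
Definition neumann_eigen mu u : Prop :=
  exists2 G, H1 u G & forall phi Phi, H1 phi Phi ->
    (\int[leb2 R]_(p in Om) dot (G p) (Phi p)) =
      mu * (\int[leb2 R]_(p in Om) (u p * phi p)).

Definition ae_lin_indep k (w : 'I_k -> R * R -> R) : Prop :=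
  forall a : 'I_k -> R,
    {ae leb2 R, forall p, Om p -> \sum_(i < k) a i * w i p = 0} ->
    forall i, a i = 0.

(* [k] linearly independent Neumann eigenfunctions whose eigenvalues all
   satisfy P. *)
Definition indep_eigen k (P : R -> Prop) : Prop :=
  exists (w : 'I_k -> R * R -> R) (lam : 'I_k -> R),
    ae_lin_indep w /\ forall i, neumann_eigen (lam i) (w i) /\ P (lam i).

(* mu is the k-th eigenvalue, k = 1, 2, ..., of the Neumann Laplacian when the
   eigenvalues are listed in nondecreasing order with multiplicity. *)
Definition neumann_eigenvalue k mu : Prop :=
  indep_eigen k (fun l => l <= mu) /\ ~ indep_eigen k (fun l => l < mu).

End Sobolev.

Section Triangle.
Variables (R : realType) (A B C : R * R).
Implicit Types (u g : R * R -> R) (G : R * R -> R * R) (c : R).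

(* The open triangle with vertices A, B, C. *)
Definition triangle : set (R * R) :=
  [set p | exists a b c : R, [/\ 0 < a, 0 < b, 0 < c, a + b + c = 1
                              & p = a *: A + b *: B + c *: C]].

Definition equilateral : Prop :=
  [/\ 0 < edist A B, edist B C = edist A B & edist C A = edist A B].

Definition perimeter : R := edist A B + edist B C + edist C A.

Definition area : R := fine (leb2 R triangle).

Definition on_side (P Q : R * R) g (t : R) : R := g ((1 - t) *: P + t *: Q).

(* Arc length integral along the segment from P to Q. *)
Definition side_int (P Q : R * R) g : R :=
  edist P Q * (\int[leb1 R]_(t in `[0, 1]) on_side P Q g t).

Definition bd_int g : R := side_int A B g + side_int B C g + side_int C A g.

Definition bd_L2 g : Prop :=
  [/\ L2 (leb1 R) `[0, 1] (on_side A B g),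
      L2 (leb1 R) `[0, 1] (on_side B C g)
    & L2 (leb1 R) `[0, 1] (on_side C A g)].

(* g, of which only the values on the boundary matter, is the trace of the H^1
   function u with weak gradient G: the trace operator is the continuous
   extension H^1 -> L^2(boundary) of the restriction of C^1 functions. *)
Definition is_trace u G g : Prop :=
  bd_L2 g /\ exists f : nat -> R * R -> R,
    [/\ forall n, C1 (f n),
        (fun n => \int[leb2 R]_(p in triangle) (f n p - u p) ^+ 2)
          @ \oo --> (0 : R),
        (fun n => \int[leb2 R]_(p in triangle)
           dot (grad (f n) p - G p) (grad (f n) p - G p)) @ \oo --> (0 : R)
      & (fun n => bd_int (fun p => (f n p - g p) ^+ 2)) @ \oo --> (0 : R)].

(* u, with trace g on the boundary, is a weak solution of - Laplacian u = c u
   with outer normal derivative - 1. *)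
Definition neumann_solution c u g : Prop :=
  exists G, [/\ H1 triangle u G, is_trace u G g
    & forall phi Phi tau, H1 triangle phi Phi -> is_trace phi Phi tau ->
        (\int[leb2 R]_(p in triangle) dot (G p) (Phi p)) + bd_int tau =
          c * (\int[leb2 R]_(p in triangle) (u p * phi p))].

End Triangle.

(* Main.v *)
(** Write [lA], [lB], [lC] for the barycentric coordinates. For c below the
    Lame eigenvalue M = 16 pi^2 / (9 a^2), a sum of three plane waves
    K * cos (theta * (2 * l - 1)), one for each coordinate l, is an explicit
    solution v of the problem. Testing the equation of an arbitrary solution u
    with v and the equation of v with u gives the same boundary integral for
    both, so c * bd_int (g c) is the explicit continuous function
    6 a^2 / |det| * (theta * cot theta + 2) of c, where theta^2 <= pi^2 / 3
    as soon as c <= M, and then theta * cot theta > - 1/2.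

    It remains to see that 0 < mu2 <= M. The upper bound comes from the Lame
    eigenfunction, which is an eigenfunction against all of H^1 because smooth
    fields F whose normal component vanishes linearly at the sides satisfy
    int w div F = - int grad w . F for every w in H^1: cut F off near the
    boundary. The lower bound says that a function w with zero gradient and
    zero mean vanishes; the same fields, applied to monomials in the barycentric
    coordinates times edge directions, relate the moments of w to one another
    and make all of them zero. *)

Require Import Defs.
From mathcomp Require Import all_boot all_order all_algebra.
From mathcomp Require Import all_classical all_reals all_analysis.
From mathcomp Require Import measurable_realfun.
From mathcomp Require Import ring lra zify.
Import Order.TTheory GRing.Theory Num.Theory.
Import numFieldNormedType.Exports.
Local Open Scope classical_set_scope.
Local Open Scope ring_scope.
Set Implicit Arguments.
Unset Strict Implicit.
Unset Printing Implicit Defensive.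

(** No spectral theory enters: [neumann_eigenvalue] only counts independent eigenfunctions, and mu2
    is never computed. This is enough because theta * cot theta > - 1/2 holds on the whole range 0 <
    theta^2 <= pi^2 / 3, so the two bounds on mu2 are the only facts about it that are used.
    Solutions at c = mu2 need not be unique, but the symmetric testing argument does not see this:
    the explicit solution persists there, since sin theta stays positive.

    A general H^1 function is only ever paired with explicit C^1 objects. Its boundary values appear
    through the C^1 approximations that define a trace, and in the two eigenvalue bounds not at all,
    because the fields used there are tangential.

    The final inequality is numerically tight. Since P^2 / (2 |Omega|) = 9 a^2 / |det|, it asks for
    theta * cot theta + 2 > 3/2, while the left side is about 1.55 at the end of the range. An
    explicit upper bound of pi is therefore needed. *)

Notation RR R := (measurableTypeR R * measurableTypeR R)%type.

(** * Integrals on the plane *)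

Section BorelPlane.
Variable R : realType.

(** An open set is the union of the boxes with rational centre and radius 1 / (n + 1) that it
    contains. [F] replaces the other boxes by the empty set, so that the union runs over a fixed
    countable index set. *)
Lemma open_measurable_plane (U : set (R * R)) : open U -> measurable (U : set (RR R)).
Proof.
move=> oU.
pose box (q1 q2 : rat) (n : nat) : set (R * R) :=
  ball (ratr q1 : R) (n.+1%:R^-1 : R) `*` ball (ratr q2 : R) (n.+1%:R^-1 : R).
pose F q1 q2 n : set (R * R) :=
  if pselect (box q1 q2 n `<=` U) then box q1 q2 n else set0.
have -> : U = \bigcup_q1 \bigcup_q2 \bigcup_n F q1 q2 n.
  apply/seteqP; split => [[x y] Uxy|p [q1 _] [q2 _] [n _]]; last first.
    by rewrite /F; case: pselect => // sub /sub.
  have [[A B] /= [Ax By] ABU] : nbhs (x, y) U by exact: open_nbhs_nbhs.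
  have [e1 /= e10 eA] := (nbhs_ballP _ _).1 Ax.
  have [e2 /= e20 eB] := (nbhs_ballP _ _).1 By.
  pose e := Num.min e1 e2.
  have e0 : 0 < e by rewrite lt_min e10.
  (* Radius [d] with 2 d < e: a box whose centre is within [d] of the point stays within [e] of
     it. *)
  pose n := Num.truncn (2 / e).
  pose d : R := n.+1%:R^-1.
  have d0 : 0 < d by rewrite invr_gt0.
  have dee : d * 2 < e.
    have : 2 / e < n.+1%:R.
      by rewrite truncnS_gt// ltW// divr_gt0.
    by rewrite ltr_pdivrMr// mulrC -ltr_pdivrMr// mulrC.
  have xd : x - d < x + d by lra.
  have [q1] := rat_in_itvoo xd.
  rewrite in_itv/= => /andP[q1l q1r].
  have yd : y - d < y + d by lra.
  have [q2] := rat_in_itvoo yd.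
  rewrite in_itv/= => /andP[q2l q2r].
  exists q1 => //; exists q2 => //; exists n => //.
  rewrite /F; case: pselect => [sub|nsub].
    split; rewrite /= /ball/= -/d; rewrite ltr_norml; apply/andP; split; lra.
  exfalso; apply: nsub => -[a b] Hab; case: Hab => /= Ha Hb; move: Ha Hb; rewrite /ball/= -/d.
  rewrite !ltr_norml => /andP[a1 a2] /andP[b1 b2].
  have ee1 : e <= e1 by rewrite ge_min lexx.
  have ee2 : e <= e2 by rewrite ge_min lexx orbT.
  apply: ABU; split => /=.
    by apply: eA; rewrite /ball/= ltr_norml; apply/andP; split; lra.
  by apply: eB; rewrite /ball/= ltr_norml; apply/andP; split; lra.
apply: bigcupT_measurable_rat => q1; apply: bigcupT_measurable_rat => q2.
apply: bigcupT_measurable => n; rewrite /F; case: pselect => [sub|nsub]; last exact: measurable0.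
by apply: measurableX; apply: open_measurable; apply: ball_open; rewrite invr_gt0.
Qed.

Lemma continuous_measurable_plane (f : R * R -> R) :
  continuous f -> measurable_fun [set: RR R] f.
Proof.
move=> cf; apply: (measurability (@RGenOInfty.G R)).
  exact: RGenOInfty.measurableE.
move=> _ [_ [a ->] <-]; rewrite setTI; apply: open_measurable_plane.
by apply: open_comp; [move=> x _; exact: cf|exact: interval_open].
Qed.

End BorelPlane.

(** * Integrability and dominated convergence for real-valued functions *)

Section RealIntegral.
Context d (T : measurableType d) (R : realType) (mu : {measure set T -> \bar R}).
Variables (D : set T) (mD : measurable D).
Implicit Types f g h : T -> R.

Lemma integrable_measurable f : mu.-integrable D (EFin \o f) -> measurable_fun D f.
Proof. by move=> /integrableP[/measurable_EFinP]. Qed.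

Lemma integrable_dominated f g : measurable_fun D f ->
  mu.-integrable D (EFin \o g) -> (forall x, D x -> `|f x| <= g x) ->
  mu.-integrable D (EFin \o f).
Proof.
move=> mf ig fg; apply: (le_integrable mD _ _ ig); first exact/measurable_EFinP.
by move=> x Dx /=; rewrite lee_fin (le_trans (fg _ Dx))// ler_norm.
Qed.

Lemma integrable_add f g : mu.-integrable D (EFin \o f) ->
  mu.-integrable D (EFin \o g) -> mu.-integrable D (EFin \o (fun x => f x + g x)).
Proof.
move=> fi gi; have := integrableD mD fi gi.
by apply: eq_integrable => // x _.
Qed.

Lemma integrable_scale (k : R) f : mu.-integrable D (EFin \o f) ->
  mu.-integrable D (EFin \o (fun x => k * f x)).
Proof.
move=> fi; have := integrableZl mD k fi.
by apply: eq_integrable => // x _.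
Qed.

Lemma integrable_bounded_mul f h (M : R) : measurable_fun D h ->
  (forall x, D x -> `|h x| <= M) -> mu.-integrable D (EFin \o f) ->
  mu.-integrable D (EFin \o (fun x => f x * h x)).
Proof.
move=> mh hM fi; apply: (@integrable_dominated _ (fun x => M * `|f x|)).
- by apply: measurable_funM => //; exact: integrable_measurable.
- by apply: integrable_scale; exact: integrable_norm.
- move=> x Dx; rewrite normrM mulrC ler_wpM2r//; exact: hM.
Qed.

Lemma cvg_Rintegral_dominated (f_ : nat -> T -> R) f g :
  (forall n, measurable_fun D (f_ n)) -> measurable_fun D f ->
  (forall x, D x -> f_ ^~ x @ \oo --> f x) ->
  mu.-integrable D (EFin \o g) ->
  (forall n x, D x -> `|f_ n x| <= g x) ->
  (\int[mu]_(x in D) f_ n x) @[n --> \oo] --> \int[mu]_(x in D) f x.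
Proof.
move=> mf_ mf ff ig fg.
have ffE x : D x -> (f_ n x)%:E @[n --> \oo] --> (f x)%:E.
  by move=> Dx; apply: cvg_EFin; [exact: nearW|exact: ff].
have [If _ H] := @dominated_convergence _ T R mu D mD
  (fun n x => (f_ n x)%:E) (EFin \o f) (EFin \o g)
  (fun n => (measurable_EFinP _ _).2 (mf_ n)) ((measurable_EFinP _ _).2 mf)
  (aeW _ (fun x Dx => ffE x Dx)) ig
  (aeW _ (fun x n Dx => fg n x Dx)).
rewrite /Rintegral; apply: fine_cvg; rewrite fineK//.
exact: integrable_fin_num.
Qed.
End RealIntegral.

(** * Square-integrable functions *)

Section SquareIntegrable.
Context d (T : measurableType d) (R : realType) (mu : {measure set T -> \bar R}).
Variables (D : set T) (mD : measurable D).
Implicit Types f g h : T -> R.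

Lemma L2_mul f g : L2 mu D f -> L2 mu D g ->
  mu.-integrable D (EFin \o (fun x => f x * g x)).
Proof.
move=> [mf If] [mg Ig].
apply: (@integrable_dominated _ _ _ mu D mD _ (fun x => f x ^+ 2 + g x ^+ 2)).
- exact: measurable_funM.
- exact: integrable_add.
- move=> x Dx; rewrite normrM -(real_normK (num_real (f x))) -(real_normK (num_real (g x))).
  have := sqr_ge0 (`|f x| - `|g x|); have := sqr_ge0 (`|f x| + `|g x|); nra.
Qed.

Lemma L2_add f g : L2 mu D f -> L2 mu D g -> L2 mu D (fun x => f x + g x).
Proof.
move=> lf lg; have fg := L2_mul lf lg; case: lf lg => [mf If] [mg Ig].
split; first exact: measurable_funD.
have := integrable_add mD (integrable_add mD If Ig) (integrable_scale mD 2 fg).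
by apply: eq_integrable => // x _ /=; congr (_%:E); ring.
Qed.

Lemma L2_scale (k : R) f : L2 mu D f -> L2 mu D (fun x => k * f x).
Proof.
move=> [mf If]; split; first exact: measurable_funM.
have := integrable_scale mD (k ^+ 2) If.
by apply: eq_integrable => // x _ /=; rewrite exprMn.
Qed.

Lemma L2_sub f g : L2 mu D f -> L2 mu D g -> L2 mu D (fun x => f x - g x).
Proof.
move=> lf lg; have := L2_add lf (L2_scale (-1) lg).
by under eq_fun do rewrite mulN1r.
Qed.

(** The weighted inequality |f e| <= t f^2 + e^2 / t takes the place of Cauchy-Schwarz: first [t] is
    fixed so that the first term contributes at most eps / 2, then [n] is taken large. The [V + 1]
    in [t] keeps the denominator positive when f vanishes. *)
Lemma cvg_Rintegral_mul0 f (e : nat -> T -> R) : L2 mu D f ->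
  (forall n, L2 mu D (e n)) ->
  (\int[mu]_(x in D) (e n x ^+ 2)) @[n --> \oo] --> (0 : R) ->
  (\int[mu]_(x in D) (f x * e n x)) @[n --> \oo] --> (0 : R).
Proof.
move=> lf le e0; set V := \int[mu]_(x in D) (f x ^+ 2).
have V0 : 0 <= V by apply: Rintegral_ge0 => x _; exact: sqr_ge0.
have bnd t n : 0 < t -> `|\int[mu]_(x in D) (f x * e n x)| <=
    t * V + t^-1 * \int[mu]_(x in D) (e n x ^+ 2).
  move=> t0; have lfe := L2_mul lf (le n).
  apply: (le_trans (le_normr_Rintegral mD lfe)).
  have I1 := integrable_scale mD t lf.2.
  have I2 := integrable_scale mD t^-1 (le n).2.
  rewrite -!RintegralZl//; [|exact: (le n).2|exact: lf.2].
  rewrite -RintegralD//; apply: le_Rintegral => //.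
  - exact: integrable_norm.
  - exact: integrable_add.
  - move=> x Dx; rewrite normrM -(real_normK (num_real (f x))) -(real_normK (num_real (e n x))).
    rewrite -subr_ge0 -(pmulr_rge0 _ t0).
    have -> : t * (t * `|f x| ^+ 2 + t^-1 * `|e n x| ^+ 2 - `|f x| * `|e n x|) =
      (t * `|f x| - `|e n x| / 2) ^+ 2 + 3 / 4 * `|e n x| ^+ 2.
      by field; lra.
    by rewrite addr_ge0 ?sqr_ge0// mulr_ge0 ?sqr_ge0//; lra.
apply/cvgr0Pnorm_le => eps eps0.
pose t := eps / (2 * (V + 1)).
have t0 : 0 < t by rewrite divr_gt0//; lra.
have tV : t * V <= eps / 2.
  have -> : t * V = eps / 2 * (V / (V + 1)) by rewrite /t; field; lra.
  by rewrite ler_piMr ?divr_ge0 ?ler_pdivrMr; lra.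
move/cvgr0Pnorm_le: e0 => /(_ (t * (eps / 2))) e0.
have : \forall n \near \oo, `|\int[mu]_(x in D) (e n x ^+ 2)| <= t * (eps / 2).
  by apply: e0; rewrite mulr_gt0//; lra.
apply: filterS => n; rewrite ger0_norm; last first.
  by apply: Rintegral_ge0 => x _; exact: sqr_ge0.
move=> en; apply: (le_trans (bnd t n t0)).
have : t^-1 * \int[mu]_(x in D) (e n x ^+ 2) <= eps / 2 by rewrite ler_pdivrMl.
lra.
Qed.

Hypothesis finD : (mu D < +oo)%E.

Lemma integrable_bounded h (M : R) : measurable_fun D h ->
  (forall x, D x -> `|h x| <= M) -> mu.-integrable D (EFin \o h).
Proof.
move=> mh hM; apply: (integrable_dominated mD mh _ hM).
apply/integrableP; split; first exact: measurable_cst.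
rewrite (eq_integral (fun=> `|M|%:E)) => [|x _]; last by [].
by rewrite integral_cst// lte_mul_pinfty ?lee_fin.
Qed.

Lemma L2_integrable h : L2 mu D h -> mu.-integrable D (EFin \o h).
Proof.
move=> [mh Ih]; apply: (@integrable_dominated _ _ _ mu D mD _ (fun x => 1 + h x ^+ 2)) => //.
  apply: integrable_add => //; apply: (@integrable_bounded _ 1) => // x _.
  by rewrite normr1.
move=> x Dx; rewrite -(real_normK (num_real (h x))); have := sqr_ge0 (`|h x| - 1); nra.
Qed.

Lemma L2_bounded h (M : R) : measurable_fun D h ->
  (forall x, D x -> `|h x| <= M) -> L2 mu D h.
Proof.
move=> mh hM; split => //; apply: (@integrable_bounded _ (M ^+ 2)).
  exact: measurable_funX.
by move=> x Dx; rewrite normrX lerXn2r ?nnegrE// ?(le_trans _ (hM _ Dx))// hM.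
Qed.

End SquareIntegrable.

(** * Moments on the unit interval *)

Section Moments.
Variable R : realType.
Implicit Types (f : R -> R) (x y t z w a : R).

Lemma bernoulli_ge a m : -1 <= a -> 1 + m%:R * a <= (1 + a) ^+ m.
Proof.
move=> a1; elim: m => [|m IH]; first by rewrite mul0r addr0 expr0.
rewrite exprS -natr1; have : 0 <= (1 + a) by lra.
move=> /ler_wpM2l /(_ _ _ IH) H; apply: le_trans H.
have : 0 <= m%:R :> R by []. have := sqr_ge0 a; nra.
Qed.

(** With z = w^2, the factor n w^n is at most 1 + w + ... + w^(n-1) <= 1 / (1 - w), and the
    remaining factor w^n tends to 0. *)
Lemma cvg_mulrn_expr0 z : 0 <= z < 1 -> (n%:R * z ^+ n) @[n --> \oo] --> (0 : R).
Proof.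
move=> /andP[z0 z1]; pose w := Num.sqrt z.
have w0 : 0 <= w by exact: sqrtr_ge0.
have zw : z = w ^+ 2 by rewrite sqr_sqrtr.
have w1 : w < 1 by rewrite ltNge; apply/negP => w1; move: z1; rewrite zw; nra.
have H n : n%:R * w ^+ n * (1 - w) <= 1 - w ^+ n.
  elim: n => [|n IH]; first by rewrite !mul0r expr0 subrr.
  have wn0 : 0 <= w ^+ n by exact: exprn_ge0.
  have wn1 : w ^+ n <= 1 by rewrite exprn_ile1// ltW.
  have := ler_wpM2l w0 IH; rewrite exprS -natr1; set W := w ^+ n in wn0 wn1 *.
  have : 0 <= (1 - w) * (1 - w * W) by apply: mulr_ge0; nra.
  by move=> h1 h2; lra.
have cw : (1 - w)^-1 * w ^+ n @[n --> \oo] --> (0 : R).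
  by apply: cvg_geometric; rewrite ger0_norm.
apply: (squeeze_cvgr _ (cvg_cst 0) cw); apply: nearW => n.
rewrite mulr_ge0 ?exprn_ge0//= zw exprAC expr2 mulrA.
apply: ler_wpM2r; first exact: exprn_ge0.
rewrite -[leRHS]mul1r ler_pdivlMr; last by lra.
by apply: (le_trans (H n)); rewrite gerBl exprn_ge0.
Qed.

(* The exponent n * 2 ^ n, rather than 2 ^ n, makes the limit 0 at y = 1/2 as well. *)
Definition step_poly (y : R) (n : nat) : R := (1 - y ^+ n) ^+ (n * 2 ^ n).

Lemma step_poly_ge0_le1 y n : 0 <= y <= 1 -> 0 <= step_poly y n <= 1.
Proof.
move=> /andP[y0 y1]; have yn0 : 0 <= y ^+ n by exact: exprn_ge0.
have yn1 : y ^+ n <= 1 by exact: exprn_ile1.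
by rewrite /step_poly exprn_ge0 ?exprn_ile1//; lra.
Qed.

(** Bernoulli's inequality bounds the power below by 1 - n (2 y)^n. *)
Lemma cvg_step_poly_lt y : 0 <= y < 2^-1 -> step_poly y @ \oo --> (1 : R).
Proof.
move=> /andP[y0 y1].
have H := @cvg_mulrn_expr0 (2 * y) _; have {}H := H ltac:(lra).
have : (1 - n%:R * (2 * y) ^+ n) @[n --> \oo] --> (1 - 0 : R).
  by apply: cvgB => //; exact: cvg_cst.
rewrite subr0 => cl.
apply: (@squeeze_cvgr _ _ _ _ _ (fun=> 1) (step_poly y) _ _ cl (cvg_cst _)); apply: nearW => n.
have /andP[_ ->] : 0 <= step_poly y n <= 1 by apply: step_poly_ge0_le1; lra.
rewrite andbT /step_poly exprMn; set m := (n * 2 ^ n)%N.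
have -> : n%:R * (2 ^+ n * y ^+ n) = m%:R * y ^+ n :> R.
  by rewrite mulrA /m natrM natrX.
have := @bernoulli_ge (- y ^+ n) m; rewrite mulrN; apply.
by rewrite lerN2 exprn_ile1//; lra.
Qed.

(** From (1 - x)^m (1 + x)^m <= 1 the power is at most 1 / (1 + x)^m, and Bernoulli's inequality
    gives (1 + y^n)^m >= 1 + n (2 y)^n >= n + 1. *)
Lemma cvg_step_poly_ge y : 2^-1 <= y <= 1 -> step_poly y @ \oo --> (0 : R).
Proof.
move=> /andP[y0 y1].
apply: (@squeeze_cvgr _ _ _ _ (fun=> 0) _ (step_poly y) _ _ (cvg_cst _) (@cvg_harmonic R)); apply: nearW => n.
have /andP[-> _] : 0 <= step_poly y n <= 1 by apply: step_poly_ge0_le1; lra.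
rewrite /= /step_poly; set m := (n * 2 ^ n)%N.
have yn0 : 0 <= y ^+ n by apply: exprn_ge0; lra.
have yn1 : y ^+ n <= 1 by rewrite exprn_ile1//; lra.
have H : (1 - y ^+ n) ^+ m * (1 + y ^+ n) ^+ m <= 1.
  by rewrite -exprMn exprn_ile1//; nra.
have B : n.+1%:R <= (1 + y ^+ n) ^+ m.
  apply: le_trans (@bernoulli_ge (y ^+ n) m _); last by lra.
  rewrite -natr1 addrC lerD2l /m natrM natrX -mulrA ler_peMr//.
  by rewrite -exprMn exprn_ege1//; lra.
rewrite -[leRHS]mul1r ler_pdivlMr//; apply: le_trans H.
by apply: ler_wpM2l => //; rewrite exprn_ge0//; lra.
Qed.

Let D : set (measurableTypeR R) := `[0, 1]%classic.
Let mD : measurable D. Proof. exact: measurable_itv. Qed.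

Lemma moments_horner f (p : {poly R}) :
  (leb1 R).-integrable D (EFin \o f) ->
  (forall n, \int[leb1 R]_(x in D) (f x * x ^+ n) = 0) ->
  \int[leb1 R]_(x in D) (f x * p.[x]) = 0.
Proof.
move=> fi f0.
have bp (q : {poly R}) : exists M, forall x, D x -> `|q.[x]| <= M.
  have cq : {within D, continuous (fun x => `|q.[x]|)}.
    apply: continuous_subspaceT => x; apply: continuous_comp; last exact: norm_continuous.
    exact: continuous_horner.
  have [c _ Hc] := EVT_max ler01 cq.
  by exists (`|q.[c]|) => x Dx; apply: Hc; exact: Dx.
have ip (q : {poly R}) : (leb1 R).-integrable D (EFin \o (fun x => f x * q.[x])).
  have [M HM] := bp q; apply: (integrable_bounded_mul mD _ HM fi).
  apply: measurable_funTS; apply: continuous_measurable_fun; exact: continuous_horner.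
(* The induction step turns p into p * 'X + c, so the statement must carry an arbitrary power of
   'X. *)
suff H k : \int[leb1 R]_(x in D) (f x * (p * 'X^k).[x]) = 0.
  by rewrite -(H 0%N); apply: eq_Rintegral => x _; rewrite expr0 mulr1.
elim/poly_ind: p k => [|p c IH] k.
  under eq_Rintegral do rewrite mul0r horner0 mulr0.
  by rewrite Rintegral_cst// mul0r.
have -> : \int[leb1 R]_(x in D) (f x * ((p * 'X + c%:P) * 'X^k).[x]) =
  \int[leb1 R]_(x in D) (f x * (p * 'X^(k.+1)).[x] + c * (f x * ('X^k : {poly R}).[x])).
  by apply: eq_Rintegral => x _; rewrite !(hornerM, hornerD, hornerC, hornerX, hornerXn) exprS; ring.
rewrite RintegralD//; last exact: (integrable_scale mD c (ip _)).
rewrite IH RintegralZl//.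
by under eq_Rintegral do rewrite hornerXn; rewrite f0 mulr0 addr0.
Qed.

(** The affine map [l] sends [0, 1] into [0, 1] and t to 1/2, so the polynomials [q n] converge
    pointwise to the indicator of [0, t[ and stay between 0 and 1. Dominated convergence then
    applies directly, without uniform approximation by polynomials. *)
Lemma moments_prefix f t : 0 <= t <= 1 ->
  (leb1 R).-integrable D (EFin \o f) ->
  (forall n, \int[leb1 R]_(x in D) (f x * x ^+ n) = 0) ->
  \int[leb1 R]_(x in `[0, t[) f x = 0.
Proof.
move=> /andP[t0 t1] fi f0.
pose l : {poly R} := (2^-1)%:P * 'X + (2^-1 - t / 2)%:P.
have lE x : l.[x] = 2^-1 + (x - t) / 2 by rewrite /l !(hornerM, hornerD, hornerC, hornerX); field.
pose q n : {poly R} := (1 - l ^+ n) ^+ (n * 2 ^ n).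
have qE n x : (q n).[x] = step_poly l.[x] n by rewrite /q /step_poly !(horner_exp, hornerD, hornerN, hornerC).
have l01 x : D x -> 0 <= l.[x] <= 1.
  by rewrite /D/= in_itv/= lE => /andP[x0 x1]; lra.
pose s x : R := if x < t then 1 else 0.
have ms : measurable_fun D s.
  apply: measurable_fun_if => //; try exact: measurable_cst.
  apply: measurable_fun_ltr => //; exact: measurable_cst.
have H : \int[leb1 R]_(x in D) (f x * (q n).[x]) @[n --> \oo] -->
    \int[leb1 R]_(x in D) (f x * s x).
  apply: (cvg_Rintegral_dominated mD (g := fun x => `|f x|)).
  - move=> n; apply: measurable_funM; first exact: integrable_measurable fi.
    by apply: measurable_funTS; apply: continuous_measurable_fun; exact: continuous_horner.
  - by apply: measurable_funM => //; exact: integrable_measurable fi.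
  - move=> x Dx; apply: cvgM; first exact: cvg_cst.
    have := l01 x Dx; move=> /andP[l0 l1].
    under eq_fun do rewrite qE.
    rewrite /s; case: ltP => xt.
      by apply: cvg_step_poly_lt; rewrite lE in l0 *; lra.
    by apply: cvg_step_poly_ge; rewrite l1 andbT lE; lra.
  - exact: integrable_norm.
  - move=> n x Dx; rewrite normrM ler_piMr// qE.
    by have /andP[h0 h1] := step_poly_ge0_le1 n (l01 x Dx); rewrite ger0_norm.
have H0 : \int[leb1 R]_(x in D) (f x * (q n).[x]) @[n --> \oo] --> (0 : R).
  by under eq_fun do rewrite moments_horner//; exact: cvg_cst.
have E := cvg_unique (@Rhausdorff R) H H0; rewrite -[RHS]E.
transitivity (\int[leb1 R]_(x in D `&` [set x | x < t]) f x).
  congr Rintegral; apply/seteqP; split => x /=; rewrite /D/= !in_itv/=.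
    by move=> /andP[-> xt]; rewrite xt; split => //=; lra.
  by move=> [/andP[-> _] ->].
rewrite Rintegral_mkcondr; apply: eq_Rintegral => x _.
rewrite patchE /s; case: ltP => xt; first by rewrite mem_set// mulr1.
by rewrite memNset ?mulr0//=; apply/negP; rewrite -leNgt.
Qed.

(** The primitive of f extended by 0 vanishes identically, and almost everywhere its derivative is f
    by Lebesgue differentiation. *)
Lemma moments0_ae0 f :
  (leb1 R).-integrable D (EFin \o f) ->
  (forall n, \int[leb1 R]_(x in D) (f x * x ^+ n) = 0) ->
  {ae leb1 R, forall x, D x -> f x = 0}.
Proof.
move=> fi f0; pose g := f \_ D.
have gi : (leb1 R).-integrable setT (EFin \o g).
  by rewrite -restrict_EFin; apply/(integrable_mkcond _ mD).
have gloc : locally_integrable setT g.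
  by apply: open_integrable_locally => //; exact: openT.
have giy y : (leb1 R).-integrable `]-oo, y] (EFin \o g).
  by apply: integrableS gi => //; exact: measurable_itv.
have := FTC1Ny giy gloc.
apply: filterS; first exact: (ae_filter_ringOfSetsType (leb1 R)).
move=> x [_ gx] Dx; suff F0 : (fun y => \int[leb1 R]_(t in `]-oo, y]) g t) = cst 0.
  have : g x = 0 by rewrite -gx F0 derive1_cst.
  by rewrite /g patchE mem_set.
apply/funext => y /=; rewrite /g -Rintegral_mkcondr.
have [y0|y0] := ltP y 0.
  rewrite (_ : _ `&` _ = set0) ?Rintegral_set0//.
  apply/seteqP; split => z //=; rewrite /D/= !in_itv/= => -[zy /andP[z0 _]]; lra.
have [y1|y1] := leP y 1.
  rewrite -(@moments_prefix f y)// ?y0// Rintegral_itv_bndo_bndc; last first.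
    apply: integrableS fi => //.
    by move=> z /=; rewrite /D/= !in_itv/=; lra.
  congr Rintegral; apply/seteqP; split => z /=; rewrite /D/= !in_itv/=.
    by move=> [-> /andP[-> _]].
  by move=> /andP[-> zy]; rewrite zy; split => //=; lra.
rewrite -[RHS](f0 0%N); transitivity (\int[leb1 R]_(x in D) f x).
  congr Rintegral; apply/seteqP; split => z /=; rewrite /D/= !in_itv/=.
    by case.
  by move=> zD; split => //; lra.
by apply: eq_Rintegral => z _; rewrite expr0 mulr1.
Qed.

End Moments.

(** * Affine change of variables *)

Section AffineChange.
Variable R : realType.
Implicit Types k l p q r w : R.

(** The scaled push-forward agrees with Lebesgue measure on half-open intervals, which determine it.
    For k < 0 the preimage of such an interval is closed at the other end, hence the two cases. *)
Lemma lebesgue_measure_affine k l (A : set (measurableTypeR R)) : k != 0 -> measurable A ->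
  (`|k|%:E * leb1 R ((fun x : R => (k * x + l)%R) @^-1` A))%E = leb1 R A.
Proof.
move=> k0 mA.
have mphi : measurable_fun [set: measurableTypeR R]
    ((fun x : R => k * x + l) : measurableTypeR R -> measurableTypeR R).
  by apply: measurable_funD => //; apply: measurable_funM.
have kn : 0 <= `|k| by [].
pose phi : measurableTypeR R -> measurableTypeR R := fun x => (k * x + l)%R.
have [nu nuE] : exists nu : {measure set (measurableTypeR R) -> \bar R},
    forall B, nu B = (`|k|%:E * leb1 R (phi @^-1` B))%E.
  unshelve eexists (mscale (NngNum kn) (pushforward (leb1 R) phi)); first exact: mphi.
  by [].
rewrite -[LHS]nuE; apply/esym/lebesgue_measure_unique => // _ [[a b]] _ <-.
rewrite nuE lebesgue_measure_itv/=.
case: (ltgtP k 0) k0 => // k0 _.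
  rewrite (_ : _ @^-1` _ = `[(b - l) / k, (a - l) / k[%classic); last first.
    apply/seteqP; split => x /=; rewrite /phi !in_itv/= ler_ndivrMr// ltr_ndivlMr// => /andP[h1 h2];
      apply/andP; split; lra.
  rewrite lebesgue_measure_itv/= !lte_fin ltr_ndivrMr// mulfVK ?lt_eqF//.
  rewrite ltrD2r; case: ltP => ab; last by rewrite mule0.
  by rewrite -!EFinD -EFinM; congr _%:E; rewrite ltr0_norm//; field; rewrite lt_eqF.
rewrite (_ : _ @^-1` _ = `](a - l) / k, (b - l) / k]%classic); last first.
  apply/seteqP; split => x /=; rewrite /phi !in_itv/= ler_pdivlMr// ltr_pdivrMr// => /andP[h1 h2];
    apply/andP; split; lra.
rewrite lebesgue_measure_itv/= !lte_fin ltr_pdivrMr// mulfVK ?gt_eqF//.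
rewrite ltrD2r; case: ltP => ab; last by rewrite mule0.
by rewrite -!EFinD -EFinM; congr _%:E; rewrite gtr0_norm//; field; rewrite gt_eqF.
Qed.

Local Open Scope ereal_scope.

Lemma ge0_integral_affine k l (f : measurableTypeR R -> \bar R) : (k != 0)%R ->
  measurable_fun setT f -> (forall x, 0 <= f x) ->
  \int[leb1 R]_x f x = `|k|%:E * \int[leb1 R]_x f (k * x + l)%R.
Proof.
move=> k0 mf f0.
have mphi : measurable_fun [set: measurableTypeR R]
    ((fun x : R => k * x + l)%R : measurableTypeR R -> measurableTypeR R).
  by apply: measurable_funD => //; apply: measurable_funM.
have kn : (0 <= `|k|)%R by [].
have H := @ge0_integral_pushforward _ _ _ _ _ _ mphi (leb1 R) setT f measurableT mf (fun x _ => f0 x).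
rewrite -[X in _ * X]H.
rewrite -[`|k|%R]/((NngNum kn)%:num) -ge0_integral_mscale//.
apply: eq_measure_integral => /= A mA _.
exact/esym/lebesgue_measure_affine.
Qed.

Lemma ge0_integral_shear1 k m l (f : RR R -> \bar R) : (k != 0)%R ->
  measurable_fun setT f -> (forall z, 0 <= f z) ->
  \int[leb2 R]_z f z = `|k|%:E * \int[leb2 R]_z f ((k * z.1 + m * z.2 + l)%R, z.2).
Proof.
move=> k0 mf f0.
have mf' : measurable_fun [set: RR R] (fun z : RR R => f ((k * z.1 + m * z.2 + l)%R, z.2)).
  apply: measurableT_comp => //; apply: measurable_fun_pair => //=.
  apply: measurable_funD => //; apply: measurable_funD; apply: measurable_funM => //.
rewrite fubini_tonelli2// fubini_tonelli2// -ge0_integralZl//; last 2 first.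
- exact: measurable_fun_fubini_tonelli_G.
- by move=> y _; apply: integral_ge0.
apply: eq_integral => y _; rewrite /fubini_G /=.
rewrite (@ge0_integral_affine k (m * y + l) (fun x => f (x, y)))//.
  by congr (_ * _); apply: eq_integral => x _; rewrite addrA.
exact: measurableT_comp.
Qed.

Lemma ge0_integral_shear2 k m l (f : RR R -> \bar R) : (k != 0)%R ->
  measurable_fun setT f -> (forall z, 0 <= f z) ->
  \int[leb2 R]_z f z = `|k|%:E * \int[leb2 R]_z f (z.1, (m * z.1 + k * z.2 + l)%R).
Proof.
move=> k0 mf f0.
have mf' : measurable_fun [set: RR R] (fun z : RR R => f (z.1, (m * z.1 + k * z.2 + l)%R)).
  apply: measurableT_comp => //; apply: measurable_fun_pair => //=.
  apply: measurable_funD => //; apply: measurable_funD; apply: measurable_funM => //.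
rewrite fubini_tonelli1// fubini_tonelli1// -ge0_integralZl//; last 2 first.
- exact: measurable_fun_fubini_tonelli_F.
- by move=> y _; apply: integral_ge0.
apply: eq_integral => x _; rewrite /fubini_F /=.
rewrite (@ge0_integral_affine k (m * x + l) (fun y => f (x, y)))//.
  by congr (_ * _); apply: eq_integral => y _; congr (f (_, _)); ring.
exact: measurableT_comp.
Qed.

Lemma ge0_integral_swap (f : RR R -> \bar R) :
  measurable_fun setT f -> (forall z, 0 <= f z) ->
  \int[leb2 R]_z f z = \int[leb2 R]_z f (z.2, z.1).
Proof.
move=> mf f0; rewrite fubini_tonelli1// fubini_tonelli2//.
by apply: measurableT_comp => //; apply: measurable_fun_pair.
Qed.

Definition affine2 (x0 y0 p q r w : R) (z : R * R) : R * R :=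
  ((x0 + p * z.1 + r * z.2)%R, (y0 + q * z.1 + w * z.2)%R).

Lemma measurable_affine2 x0 y0 p q r w :
  measurable_fun [set: RR R] (affine2 x0 y0 p q r w : RR R -> RR R).
Proof.
apply: measurable_fun_pair => //=; apply: measurable_funD => //;
  by [apply: measurable_funD => //; apply: measurable_funM|apply: measurable_funM].
Qed.

(** When p is nonzero, the map is a composition of two shears, each a one-dimensional change of
    variable under Tonelli. When p = 0, exchanging the two variables puts r, which is then nonzero,
    in its place. *)
Lemma ge0_integral_affine2 x0 y0 p q r w (f : RR R -> \bar R) :
  (p * w - q * r != 0)%R -> measurable_fun setT f -> (forall z, 0 <= f z) ->
  \int[leb2 R]_z f z =
    `|p * w - q * r|%:E * \int[leb2 R]_z f (affine2 x0 y0 p q r w z).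
Proof.
have main p' q' r' w' (g : RR R -> \bar R) : (p' != 0)%R -> (p' * w' - q' * r' != 0)%R ->
    measurable_fun setT g -> (forall z, 0 <= g z) ->
    \int[leb2 R]_z g z =
    `|p' * w' - q' * r'|%:E * \int[leb2 R]_z g (affine2 x0 y0 p' q' r' w' z).
  move=> p0 d0 mg g0; set d := (p' * w' - q' * r')%R.
  (* If x = x0 + p' z1 + r' z2, then the second coordinate of the image is y0 + (q' / p') (x - x0) +
     (d / p') z2. *)
  rewrite (@ge0_integral_shear2 (d / p') (q' / p') (y0 - q' / p' * x0))//; last first.
    by rewrite mulf_neq0// invr_eq0.
  rewrite (@ge0_integral_shear1 p' r' x0)//=; last first.
    apply: measurableT_comp => //; apply: measurable_fun_pair => //=.
    apply: measurable_funD => //; apply: measurable_funD; apply: measurable_funM => //.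
  rewrite muleA -EFinM -normrM mulfVK//; congr (_ * _).
  apply: eq_integral => z _; congr (g (_, _)); first ring.
  by rewrite /d; field.
move=> d0 mf f0; have [p0|p0] := eqVneq p 0%R; last exact: main.
rewrite (main r w p q)//; last first.
- have -> : (r * q - w * p = - (p * w - q * r))%R by ring.
  by rewrite oppr_eq0.
- by apply: contra_neq d0 => ->; rewrite p0; ring.
have -> : (r * q - w * p = - (p * w - q * r))%R by ring.
rewrite normrN; congr (_ * _).
rewrite ge0_integral_swap//; last first.
  by apply: (measurableT_comp mf); exact: measurable_affine2.
by apply: eq_integral => z _; congr (f (_, _)) => /=; ring.
Qed.

Lemma integrable_affine2 x0 y0 p q r w (D : set (RR R)) (f : RR R -> R) :
  (p * w - q * r != 0)%R -> measurable D -> (leb2 R).-integrable D (EFin \o f) ->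
  (leb2 R).-integrable (affine2 x0 y0 p q r w @^-1` D)
    (EFin \o (f \o affine2 x0 y0 p q r w)).
Proof.
move=> d0 mD /(integrable_mkcond _ mD) fi; set L := affine2 _ _ _ _ _ _.
have mLD : measurable (L @^-1` D : set (RR R)).
  by rewrite -[X in measurable X]setTI; apply: measurable_affine2.
apply/(integrable_mkcond _ mLD).
have -> : (EFin \o (f \o L)) \_ (L @^-1` D) = ((EFin \o f) \_ D) \o L.
  by apply/funext => z /=; rewrite !patchE.
have /integrableP[mf fy] := fi; apply/integrableP; split.
  by apply: measurableT_comp => //; exact: measurable_affine2.
have dd : (0 < `|p * w - q * r|)%R by rewrite normr_gt0.
move: fy; rewrite (@ge0_integral_affine2 x0 y0 p q r w)//; last exact: measurableT_comp.
rewrite -/L; set I := \int[_]_z _.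
have I0 : 0 <= I by apply: integral_ge0 => z _; exact: abse_ge0.
case: I I0 => [i||]// _; rewrite ?ltry//.
by rewrite mulry gtr0_sg// mul1e.
Qed.

Lemma Rintegral_affine2 x0 y0 p q r w (D : set (RR R)) (f : RR R -> R) :
  (p * w - q * r != 0)%R -> measurable D -> (leb2 R).-integrable D (EFin \o f) ->
  (\int[leb2 R]_(z in D) f z = `|p * w - q * r| *
   \int[leb2 R]_(z in affine2 x0 y0 p q r w @^-1` D) f (affine2 x0 y0 p q r w z))%R.
Proof.
move=> d0 mD fi; have fi' := integrable_affine2 x0 y0 d0 mD fi.
set L := affine2 _ _ _ _ _ _ in fi' *.
have mLD : measurable (L @^-1` D : set (RR R)).
  by rewrite -[X in measurable X]setTI; apply: measurable_affine2.
have key (g : RR R -> \bar R) : measurable_fun D g -> (forall z, 0 <= g z) ->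
    \int[leb2 R]_(z in D) g z = `|p * w - q * r|%:E * \int[leb2 R]_(z in L @^-1` D) g (L z).
  move=> mg g0; rewrite integral_mkcond (@ge0_integral_affine2 x0 y0 p q r w)//.
  - by rewrite [in RHS]integral_mkcond.
  - by apply/(measurable_restrictT g mD).
  - by move=> z; rewrite patchE; case: ifP.
have mf : measurable_fun D (EFin \o f) by case/integrableP : fi.
rewrite /Rintegral integralE [in RHS]integralE.
rewrite (key (fun z => (EFin \o f)^\+ z))//; last exact: measurable_funepos.
rewrite (key (fun z => (EFin \o f)^\- z))//; last exact: measurable_funeneg.
have fp := integrable_pos_fin_num mLD fi'.
have fn := integrable_neg_fin_num mLD fi'.
set P := \int[leb2 R]_(z in L @^-1` D) _^\+ (L z).
set N := \int[leb2 R]_(z in L @^-1` D) _^\- (L z).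
have PE : P = \int[leb2 R]_(z in L @^-1` D) (EFin \o (f \o L))^\+ z.
  by apply: eq_integral => z _; rewrite !funeposE.
have NE : N = \int[leb2 R]_(z in L @^-1` D) (EFin \o (f \o L))^\- z.
  by apply: eq_integral => z _; rewrite !funenegE.
rewrite PE NE -(fineK fp) -(fineK fn) -!EFinM -EFinB [LHS]/= -mulrBr.
by [].
Qed.

End AffineChange.

(** * Functions with continuous gradient *)

Section Gradient.
Variable R : realType.
Implicit Types (f : R * R -> R) (g : R * R -> R * R) (p v : R * R) (h : R -> R).

(** All directions are included, because the divergence theorem below differentiates along the edges
    of the triangle. [C1_has_grad] and [has_grad_C1] relate this to [C1], which mentions the two
    axes only. *)
Definition has_grad f g : Prop :=
  continuous g /\ forall p v, is_derive p v f (dot v (g p)).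

(** Used with [c] a partial derivative at a point for first-order expansions, and with [c = 0] for
    Lipschitz bounds. *)
Lemma mean_value_dist (h dh : R -> R) (a b c e : R) :
  (forall x : R, is_derive x (1 : R) h (dh x)) ->
  (forall x, Num.min a b <= x <= Num.max a b -> `|dh x - c| <= e) ->
  `|h b - h a - c * (b - a)| <= e * `|b - a|.
Proof.
move=> hd; wlog ab : a b / a <= b => [wl|].
  have /orP[ab|ba] := le_total a b; first exact: (wl _ _ ab).
  move=> H; have := wl b a ba; rewrite minC maxC => /(_ H) {H wl}.
  rewrite (distrC a b); set X := (X in `|X| <= _) => hX.
  by rewrite -normrN (_ : - (h b - h a - c * (b - a)) = X)// /X; ring.
rewrite min_l// max_r// => H.
have ch : {within `[a, b], continuous h}.
  by apply: continuous_subspaceT => x; apply/differentiable_continuous/derivable1_diffP/ex_derive.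
have [z + ->] := MVT_segment ab (fun x _ => hd x) ch.
rewrite in_itv/= => /H zH; rewrite -mulrBl normrM.
exact: ler_wpM2r.
Qed.

Lemma is_derive_slice1 f (p q : R) : derivable f (p, q) (1, 0) ->
  is_derive p (1 : R) (fun x => f (x, q)) ('D_(1, 0) f (p, q)).
Proof.
move=> df; have E : (fun t : R => t^-1 *: (((fun x => f (x, q)) \o shift p) (t *: 1) - f (p, q))) =
    (fun t : R => t^-1 *: ((f \o shift (p, q)) (t *: (1, 0)) - f (p, q))).
  apply/funext => t /=; congr (_ *: (f _ - _)).
  by congr pair; rewrite /= scaler0 add0r.
by apply: DeriveDef; [rewrite /derivable E|rewrite /derive E].
Qed.

Lemma is_derive_slice2 f (p q : R) : derivable f (p, q) (0, 1) ->
  is_derive q (1 : R) (fun x => f (p, x)) ('D_(0, 1) f (p, q)).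
Proof.
move=> df; have E : (fun t : R => t^-1 *: (((fun x => f (p, x)) \o shift q) (t *: 1) - f (p, q))) =
    (fun t : R => t^-1 *: ((f \o shift (p, q)) (t *: (0, 1)) - f (p, q))).
  apply/funext => t /=; congr (_ *: (f _ - _)).
  by congr pair; rewrite /= scaler0 add0r.
by apply: DeriveDef; [rewrite /derivable E|rewrite /derive E].
Qed.

(** The path from p to q through (p.1, q.2) has legs parallel to the axes. On each leg the partial
    derivative stays within [e] of its value at p, so the mean value inequality applies twice. *)
Lemma C1_first_order f p (e : R) : C1 f -> 0 < e ->
  exists2 d : R, 0 < d & forall q : R * R, `|q.1 - p.1| < d -> `|q.2 - p.2| < d ->
    `|f q - f p - dot (q.1 - p.1, q.2 - p.2) (grad f p)| <=
      e * (`|q.1 - p.1| + `|q.2 - p.2|).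
Proof.
move=> [df cg] e0.
have /cvgrPdist_le /(_ e e0) := cg p.
move=> /nbhs_ballP[d /= d0 H]; exists d => // q q1 q2.
have near1 x y : `|x - p.1| < d -> `|y - p.2| < d ->
    `|(grad f (x, y)).1 - (grad f p).1| <= e /\ `|(grad f (x, y)).2 - (grad f p).2| <= e.
  move=> hx hy; have /H : ball p d (x, y) by split; rewrite /ball/= distrC.
  rewrite prod_normE/= ge_max => /andP[h1 h2].
  by split; rewrite distrC.
have M1 := @mean_value_dist (fun x => f (x, q.2)) (fun x => (grad f (x, q.2)).1) p.1 q.1
  (grad f p).1 e (fun x => is_derive_slice1 (df (x, q.2)).1).
have M2 := @mean_value_dist (fun y => f (p.1, y)) (fun y => (grad f (p.1, y)).2) p.2 q.2
  (grad f p).2 e (fun y => is_derive_slice2 (df (p.1, y)).2).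
have btw (a b x : R) : Num.min a b <= x <= Num.max a b -> `|x - a| <= `|b - a|.
  rewrite ge_min le_max => /andP[/orP[] h1 /orP[] h2];
    case: (ger0P (x - a)) => ?; case: (ger0P (b - a)) => ?; lra.
have {}M1 := M1 (fun x hx => (near1 x q.2 (le_lt_trans (btw _ _ _ hx) q1) q2).1).
have pd : `|p.1 - p.1| < d by rewrite subrr normr0.
have {}M2 := M2 (fun y hy => (near1 p.1 y pd (le_lt_trans (btw _ _ _ hy) q2)).2).
have -> : f q - f p - dot (q.1 - p.1, q.2 - p.2) (grad f p) =
   (f (q.1, q.2) - f (p.1, q.2) - (grad f p).1 * (q.1 - p.1)) +
   (f (p.1, q.2) - f (p.1, p.2) - (grad f p).2 * (q.2 - p.2)).
  by rewrite -!surjective_pairing /dot/=; ring.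
by rewrite [leRHS]mulrDr (le_trans (ler_normD _ _))// lerD.
Qed.

Lemma C1_has_grad f : C1 f -> has_grad f (grad f).
Proof.
move=> Cf; split; first by case: Cf.
move=> p v.
suff H : (fun t : R => t^-1 *: ((f \o shift p) (t *: v) - f p)) @ 0^' --> dot v (grad f p).
  by apply: DeriveDef; [apply/cvg_ex; exists (dot v (grad f p))|exact: cvg_lim H].
apply/cvgrPdist_le => e e0.
pose m := `|v.1| + `|v.2| + 1.
have m0 : 0 < m by rewrite /m ltr_wpDl// addr_ge0.
have [d d0 Hd] := @C1_first_order f p (e / m) Cf (divr_gt0 e0 m0).
near=> t.
have t0 : t != 0 by near: t; exact: nbhs_dnbhs_neq.
have tdm : `|t| < d / m.
  near: t; apply: dnbhs0_lt; exact: divr_gt0.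
have tm : `|t| * m < d by rewrite -ltr_pdivlMr.
have ta : 0 <= `|t| by [].
have h1 : `|(t *: v + p).1 - p.1| < d.
  rewrite /= addrK normrM; apply: le_lt_trans tm; apply: ler_wpM2l => //.
  by rewrite /m -addrA lerDl addr_ge0.
have h2 : `|(t *: v + p).2 - p.2| < d.
  rewrite /= addrK normrM; apply: le_lt_trans tm; apply: ler_wpM2l => //.
  by rewrite /m addrAC lerDr addr_ge0.
have := Hd _ h1 h2; rewrite /= !addrK => H; rewrite distrC.
have -> : t^-1 *: (f (t *: v + p) - f p) - dot v (grad f p) =
   t^-1 * (f (t *: v + p) - f p - dot (t *: v.1, t *: v.2) (grad f p)).
  rewrite /dot/= /GRing.scale/=; field; exact: t0.
rewrite normrM normfV ler_pdivrMl ?normr_gt0//; apply: le_trans H _.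
rewrite !normrM -mulrDr mulrCA ler_wpM2l// mulrAC ler_pdivrMr//.
by apply: ler_wpM2l; [exact: ltW|rewrite /m; lra].
Unshelve. all: by end_near. Qed.

Lemma has_grad_C1 f g : has_grad f g -> C1 f /\ grad f = g.
Proof.
move=> [cg dg]; have E : grad f = g.
  apply/funext => p; rewrite /grad !derive_val /dot/=.
  by rewrite !mul1r !mul0r addr0 add0r -surjective_pairing.
by split => //; split; [move=> p; split; exact: ex_derive|rewrite E].
Qed.

Lemma C1_continuous f : C1 f -> continuous f.
Proof.
move=> Cf p; have [d d0 Hd] := @C1_first_order f p 1 Cf ltr01.
apply/cvgrPdist_le => e e0.
pose m := `|(grad f p).1| + `|(grad f p).2| + 2.
have m0 : 0 < m by rewrite /m ltr_wpDl// addr_ge0.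
pose d' := Num.min d (e / m).
have d'0 : 0 < d' by rewrite lt_min d0 divr_gt0.
have : nbhs p (ball p d') by exact: nbhsx_ballx.
apply: filterS => q [q1 q2]; move: q1 q2; rewrite /ball/= !(distrC p.1) !(distrC p.2) !lt_min => /andP[q1 q1'] /andP[q2 q2'].
have := Hd q q1 q2; set X := dot _ _ => H.
have HX : `|X| <= `|q.1 - p.1| * `|(grad f p).1| + `|q.2 - p.2| * `|(grad f p).2|.
  by rewrite /X /dot/= (le_trans (ler_normD _ _))// !normrM.
have -> : f p - f q = - (f q - f p - X) - X by ring.
rewrite (le_trans (ler_normB _ _))// normrN.
apply: (le_trans (lerD H HX)); rewrite mul1r.
move: q1' q2'; rewrite !ltr_pdivlMr// /m => q1' q2'.
have := normr_ge0 (q.1 - p.1); have := normr_ge0 (q.2 - p.2).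
have := normr_ge0 (grad f p).1; have := normr_ge0 (grad f p).2.
nra.
Qed.

End Gradient.

Section GradientRules.
Variable R : realType.
Implicit Types (f : R * R -> R) (g : R * R -> R * R) (p v : R * R) (h : R -> R).

Lemma dotDr v p q : dot v (p + q) = dot v p + dot v q :> R.
Proof. by rewrite /dot/=; ring. Qed.

Lemma dotZr v (k : R) p : dot v (k *: p) = k * dot v p.
Proof. by rewrite /dot/= /GRing.scale/=; ring. Qed.

Lemma dotDl v p q : dot (v + p) q = dot v q + dot p q :> R.
Proof. by rewrite /dot/=; ring. Qed.

Lemma dotZl v (k : R) p : dot (k *: v) p = k * dot v p.
Proof. by rewrite /dot/= /GRing.scale/=; ring. Qed.

Lemma dotC v p : dot v p = dot p v :> R.
Proof. by rewrite /dot mulrC [X in _ + X]mulrC. Qed.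

Lemma has_grad_C1W f g : has_grad f g -> C1 f.
Proof. by move=> /has_grad_C1[]. Qed.

Lemma has_grad_continuous f g : has_grad f g -> continuous f.
Proof. by move=> /has_grad_C1W /C1_continuous. Qed.

Lemma has_grad_cst (c : R) : has_grad (fun=> c) (fun=> 0).
Proof.
split; first by move=> p; exact: cvg_cst.
move=> p v; rewrite /dot/= !mulr0 addr0; exact: is_derive_cst.
Qed.

Lemma has_grad_affine (a b c : R) :
  has_grad (fun p => a + b * p.1 + c * p.2) (fun=> (b, c)).
Proof.
split; first by move=> p; exact: cvg_cst.
move=> p v; have E : \forall t \near 0^', dot v (b, c) =
    t^-1 *: (((fun p : R * R => a + b * p.1 + c * p.2) \o shift p) (t *: v) -
    (a + b * p.1 + c * p.2)).
  near=> t; have t0 : t != 0 by near: t; exact: nbhs_dnbhs_neq.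
  by rewrite /dot/= /GRing.scale/=; field; exact: t0.
have H : (fun t : R => t^-1 *: (((fun p : R * R => a + b * p.1 + c * p.2) \o shift p) (t *: v) -
    (a + b * p.1 + c * p.2))) @ 0^' --> dot v (b, c).
  apply/cvgrPdist_le => e e0; move: E; apply: filterS => t <-.
  by rewrite subrr normr0 ltW.
by apply: DeriveDef; [apply/cvg_ex; exists (dot v (b, c))|exact: cvg_lim H].
Unshelve. all: by end_near. Qed.

Lemma has_grad_add f f' g g' : has_grad f g -> has_grad f' g' ->
  has_grad (fun p => f p + f' p) (fun p => g p + g' p).
Proof.
move=> [cg dg] [cg' dg']; split; first by move=> p; exact: (cvgD (cg p) (cg' p)).
by move=> p v; rewrite dotDr; exact: (is_deriveD (dg p v) (dg' p v)).
Qed.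

Lemma has_grad_mul f f' g g' : has_grad f g -> has_grad f' g' ->
  has_grad (fun p => f p * f' p) (fun p => f p *: g' p + f' p *: g p).
Proof.
move=> hf hf'; have cf := has_grad_continuous hf; have cf' := has_grad_continuous hf'.
case: hf hf' => [cg dg] [cg' dg']; split.
  by move=> p; exact: (cvgD (cvgZ (cf p) (cg' p)) (cvgZ (cf' p) (cg p))).
by move=> p v; rewrite dotDr !dotZr; exact: (is_deriveM (dg p v) (dg' p v)).
Qed.

Lemma has_grad_scale (k : R) f g : has_grad f g ->
  has_grad (fun p => k * f p) (fun p => k *: g p).
Proof.
move=> hf; have := has_grad_mul (has_grad_cst k) hf.
rewrite (_ : (fun p => k *: g p) = (fun p => k *: g p + f p *: 0))//.
by apply/funext => p; rewrite scaler0 addr0.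
Qed.

(** The directional derivative at p is the derivative at 0 along the line t |-> t *: v + p, where
    the one-variable chain rule applies. *)
Lemma has_grad_comp h dh f g : (forall x : R, is_derive x (1 : R) h (dh x)) -> continuous dh ->
  has_grad f g -> has_grad (fun p => h (f p)) (fun p => dh (f p) *: g p).
Proof.
move=> hd cd hf; have cf := has_grad_continuous hf; case: hf => [cg dg]; split.
  move=> p; apply: cvgZ; last exact: cg.
  by apply: continuous_comp; [exact: cf|exact: cd].
move=> p v; rewrite dotZr.
have df := ex_derive (is_derive := dg p v).
have E : (fun t : R => t^-1 *: (((fun t : R => f (t *: v + p)) \o shift 0) (t *: 1) - f (0 *: v + p))) =
    (fun t : R => t^-1 *: ((f \o shift p) (t *: v) - f p)).
  by apply/funext => t /=; rewrite addr0 scale0r add0r [_%:A]mulr1.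
have E' : (fun t : R => t^-1 *: (((h \o (fun t : R => f (t *: v + p))) \o shift 0) (t *: 1) - h (f (0 *: v + p)))) =
    (fun t : R => t^-1 *: (((h \o f) \o shift p) (t *: v) - h (f p))).
  by apply/funext => t /=; rewrite addr0 scale0r add0r [_%:A]mulr1.
have D0 : is_derive (0 : R) (1 : R) (fun t : R => f (t *: v + p)) (dot v (g p)).
  by apply: DeriveDef; [rewrite /derivable E|rewrite /derive E; exact: derive_val].
have hd0 : is_derive (f (0 *: v + p)) (1 : R) h (dh (f p)) by rewrite scale0r add0r.
have := is_derive1_comp (f := h) hd0 D0 => -[e d].
by apply: DeriveDef; [move: e; rewrite /derivable E'|move: d; rewrite /derive E'].
Qed.

End GradientRules.

(** * Green formulas on a triangle *)

Section ReferenceTriangle.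
Variable R : realType.
Implicit Types (h dh : R * R -> R).

Definition ref_triangle : set (R * R) := [set z | [/\ 0 < z.1, 0 < z.2 & z.1 + z.2 < 1]].

Lemma continuous_fst2 : continuous (fun z : R * R => z.1).
Proof. by move=> z; exact: cvg_fst. Qed.

Lemma continuous_snd2 : continuous (fun z : R * R => z.2).
Proof. by move=> z; exact: cvg_snd. Qed.

Lemma continuous_pair2 (T : topologicalType) (f g : T -> R) :
  continuous f -> continuous g -> continuous (fun x => (f x, g x)).
Proof.
move=> cf cg x.
exact: (@cvg_pair _ _ _ (nbhs x) (nbhs (f x)) (nbhs (g x)) _ _ _ f g (cf x) (cg x)).
Qed.

Lemma measurable_ref_triangle : measurable (ref_triangle : set (RR R)).
Proof.
apply: open_measurable_plane.
have -> : ref_triangle = [set z | 0 < z.1] `&` ([set z | 0 < z.2] `&` [set z | z.1 + z.2 < 1]).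
  by apply/seteqP; split => z /= => [[]|[? []]].
apply: openI; [|apply: openI].
- apply: (@open_comp _ _ (fun z : R * R => z.1) [set x | 0 < x]); last exact: open_gt.
  by move=> z _; exact: continuous_fst2.
- apply: (@open_comp _ _ (fun z : R * R => z.2) [set x | 0 < x]); last exact: open_gt.
  by move=> z _; exact: continuous_snd2.
- apply: (@open_comp _ _ (fun z : R * R => z.1 + z.2) [set x | x < 1]); last exact: open_lt.
  by move=> z _; exact: (cvgD (continuous_fst2 (x := z)) (continuous_snd2 (x := z))).
Qed.

Lemma ref_triangle_square : ref_triangle `<=` `[0, 1] `*` `[0, 1].
Proof. by move=> z [z1 z2 z12]; split => /=; rewrite in_itv/=; lra. Qed.

Lemma ref_triangle_finite : (leb2 R (ref_triangle : set (RR R)) < +oo)%E.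
Proof.
pose Q : set (RR R) := `[0, 1]%classic `*` `[0, 1]%classic.
have mQ : measurable Q by apply: measurableX; exact: measurable_itv.
apply: (@le_lt_trans _ _ (leb2 R Q)).
  by apply: le_measure; rewrite ?inE//; [exact: measurable_ref_triangle|exact: ref_triangle_square].
have I1 : leb1 R `[0, 1]%classic = 1%E.
  by rewrite lebesgue_measure_itv/= lte_fin ltr01 oppr0 adde0.
rewrite /Q (@product_measure1E _ _ _ _ _ (leb1 R) (leb1 R) `[0, 1]%classic `[0, 1]%classic).
- by apply: (eq_ind_r (fun x => (x * x < +oo)%E) _ I1); rewrite mule1 ltry.
- exact: measurable_itv.
- exact: measurable_itv.
Qed.

Lemma continuous_bounded_square h : continuous h ->
  exists M, forall z, 0 <= z.1 <= 1 -> 0 <= z.2 <= 1 -> `|h z| <= M.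
Proof.
move=> ch; pose Q : set (R * R) := `[0, 1]%classic `*` `[0, 1]%classic.
have cQ : compact Q by apply: compact_setX; exact: segment_compact.
have cn : {within Q, continuous (fun z => `|h z|)}.
  by apply: continuous_subspaceT => z; apply: continuous_comp; [exact: ch|exact: norm_continuous].
have Q0 : Q !=set0.
  by exists (0, 0); split; rewrite /= in_itv/= lexx ler01.
have [c _ H] := compact_EVT_max Q0 cQ cn.
exists `|h c| => z z1 z2; apply: H; rewrite inE; split; rewrite /= in_itv//=.
Qed.

Lemma ref_integrable h : continuous h -> (leb2 R).-integrable (ref_triangle : set (RR R)) (EFin \o h).
Proof.
move=> ch; have [M HM] := continuous_bounded_square ch.
apply: (integrable_bounded measurable_ref_triangle ref_triangle_finite (M := M)).
  by apply: measurable_funTS; exact: continuous_measurable_plane.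
by move=> z [z1 z2 z12]; apply: HM; lra.
Qed.

(** Fubini with the inner integral over s, which the fundamental theorem evaluates on ]0, 1 - t[.
    The two end points run along the hypotenuse and the left leg. *)
Lemma ref_green h dh : continuous h -> continuous dh ->
  (forall s t : R, is_derive s (1 : R) (fun s => h (s, t)) (dh (s, t))) ->
  \int[leb2 R]_(z in ref_triangle) dh z =
    \int[leb1 R]_(t in `[0, 1]) (h (1 - t, t) - h (0, t)).
Proof.
move=> ch cdh hd.
have idh := ref_integrable cdh.
have idhT := (integrable_mkcond _ measurable_ref_triangle).1 idh.
have cid : continuous (fun s : R => s) by move=> s; exact: cvg_id.
have ccst (c : R) : continuous (fun s : R => c) by move=> s; exact: cvg_cst.
have cline (t : R) : continuous (fun s : R => (s, t)).
  exact: (continuous_pair2 cid (ccst t)).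
have cdiag : continuous (fun t : R => (1 - t, t)).
  apply: (@continuous_pair2 R (fun t => 1 - t) id); last exact: cid.
  by move=> t; exact: (cvgB (ccst 1 t) (cid t)).
have cleft : continuous (fun t : R => (0 : R, t)).
  exact: (continuous_pair2 (ccst 0) cid).
pose k t := h (1 - t, t) - h (0, t).
have ck : continuous k.
  have c1 : continuous (h \o (fun t : R => (1 - t, t))).
    by move=> t; apply: continuous_comp; [exact: cdiag|exact: ch].
  have c2 : continuous (h \o (fun t : R => (0 : R, t))).
    by move=> t; apply: continuous_comp; [exact: cleft|exact: ch].
  by move=> t; exact: (cvgB (c1 t) (c2 t)).
have ik (b1 b2 : bool) : (leb1 R).-integrable [set` Interval (BSide b1 0) (BSide b2 1)] (EFin \o k).
  have : (leb1 R).-integrable `[0, 1] (EFin \o k).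
    apply: continuous_compact_integrable; first by exact: segment_compact.
    by apply: continuous_subspaceT; exact: ck.
  apply: integrableS; [exact: measurable_itv|exact: measurable_itv|].
  by move=> x /=; rewrite !itv_boundlr/= => /andP[+ +]; rewrite !bnd_simp;
    case: b1; case: b2; rewrite ?bnd_simp; lra.
have G t : fubini_G (leb1 R) ((EFin \o dh) \_ ref_triangle) t =
    ((EFin \o k) \_ (`]0, 1[%classic : set (measurableTypeR R))) t.
  rewrite /fubini_G patchE; case: ifPn => [|]; rewrite ?notin_setE ?inE /= in_itv/= => t01.
    have t1 : 0 < 1 - t by lra.
    transitivity (\int[leb1 R]_(s in `]0%R, (1 - t)%R[) (dh (s, t))%:E)%E.
      rewrite [RHS]integral_mkcond; apply: eq_integral => s _; rewrite !patchE.
      congr (if _ then _ else _); apply/idP/idP; rewrite !inE/= in_itv/=.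
        by move=> []/=; lra.
      by move=> ?; split => /=; lra.
    have md (i : interval R) : measurable_fun [set` i] (fun s => (dh (s, t))%:E).
      apply: measurable_funTS; apply/measurable_EFinP; apply: continuous_measurable_fun => s.
      by apply: continuous_comp; [exact: cline|exact: cdh].
    rewrite integral_itv_obnd_cbnd; last exact: (md `]0, 1 - t[).
    rewrite integral_itv_bndo_bndc; last exact: (md `[0, 1 - t[).
    have chs : continuous (fun s => h (s, t)).
      by move=> s; apply: continuous_comp; [exact: cline|exact: ch].
    rewrite (@continuous_FTC2 _ _ (fun s => h (s, t)) _ _ t1).
    - by rewrite -EFinB.
    - apply: continuous_subspaceT => s; apply: continuous_comp; [exact: cline|exact: cdh].
    - split; first by move=> s _; exact: ex_derive.
        exact/cvg_at_right_filter/chs.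
      exact/cvg_at_left_filter/chs.
    - by move=> s _; rewrite derive1E derive_val.
  apply: integral0_eq => s _; rewrite patchE; case: ifPn => //.
  by rewrite inE => -[/= ? ? ?]; exfalso; apply: t01; lra.
rewrite /Rintegral integral_mkcond -integral21_prod_meas1//.
transitivity (\int[leb1 R]_(t in `]0, 1[) k t).
  rewrite /Rintegral; congr fine; rewrite [RHS]integral_mkcond.
  by apply: eq_integral => t _; exact: G.
rewrite Rintegral_itv_obnd_cbnd ?Rintegral_itv_bndo_bndc//; exact: ik.
Qed.

End ReferenceTriangle.

(** * Barycentric coordinates and the affine parametrization of a triangle *)

Section TriangleGeometry.
Variables (R : realType) (A B C : R * R).
Implicit Types (p v z : R * R) (f h : R * R -> R) (g : R * R -> R * R).

Definition tdet : R := (B.1 - A.1) * (C.2 - A.2) - (B.2 - A.2) * (C.1 - A.1).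

Hypothesis det0 : tdet != 0.

Definition gradB : R * R := ((C.2 - A.2) / tdet, - (C.1 - A.1) / tdet).
Definition gradC : R * R := (- (B.2 - A.2) / tdet, (B.1 - A.1) / tdet).
Definition gradA : R * R := - (gradB + gradC).

Definition lamB p : R := dot (p - A) gradB.
Definition lamC p : R := dot (p - A) gradC.
Definition lamA p : R := 1 - lamB p - lamC p.

Let T := triangle A B C.
Let L := affine2 A.1 A.2 (B.1 - A.1) (B.2 - A.2) (C.1 - A.1) (C.2 - A.2).

Lemma param_lam p : L (lamB p, lamC p) = p.
Proof.
rewrite [RHS]surjective_pairing /L /affine2 /lamB /lamC /gradB /gradC /dot /tdet/=.
by congr pair; field; exact: det0.
Qed.

Lemma lamB_param z : lamB (L z) = z.1.
Proof. by rewrite /lamB /gradB /L /affine2 /dot /tdet/=; field; exact: det0. Qed.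

Lemma lamC_param z : lamC (L z) = z.2.
Proof. by rewrite /lamC /gradC /L /affine2 /dot /tdet/=; field; exact: det0. Qed.

Lemma lamA_param z : lamA (L z) = 1 - z.1 - z.2.
Proof. by rewrite /lamA lamB_param lamC_param. Qed.

Lemma paramE z : L z = (1 - z.1 - z.2) *: A + z.1 *: B + z.2 *: C.
Proof. by rewrite /L /affine2 [RHS]surjective_pairing/= /GRing.scale/=; congr pair; ring. Qed.

Lemma triangle_lam p : T p <-> [/\ 0 < lamA p, 0 < lamB p & 0 < lamC p].
Proof.
split=> [[a [b [c [a0 b0 c0 abc ->]]]]|[pA pB pC]]; last first.
  exists (lamA p), (lamB p), (lamC p); split => //; first by rewrite /lamA; ring.
  by rewrite -[LHS]param_lam paramE.
have -> : a *: A + b *: B + c *: C = L (b, c).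
  by rewrite paramE/= (_ : 1 - b - c = a)//; lra.
by rewrite lamA_param lamB_param lamC_param/=; split; lra.
Qed.

Lemma triangle_param : L @^-1` T = @ref_triangle R.
Proof.
apply/seteqP; split => z; rewrite /preimage/=.
  by move=> /triangle_lam; rewrite lamA_param lamB_param lamC_param => -[? ? ?]; split; lra.
by move=> [? ? ?]; apply/triangle_lam; rewrite lamA_param lamB_param lamC_param; split; lra.
Qed.

Lemma has_grad_lamB : has_grad lamB (fun=> gradB).
Proof.
have := has_grad_affine (- dot A gradB) gradB.1 gradB.2; rewrite -surjective_pairing.
congr has_grad; apply/funext => p; rewrite /lamB /dot/=; ring.
Qed.

Lemma has_grad_lamC : has_grad lamC (fun=> gradC).
Proof.
have := has_grad_affine (- dot A gradC) gradC.1 gradC.2; rewrite -surjective_pairing.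
congr has_grad; apply/funext => p; rewrite /lamC /dot/=; ring.
Qed.

Lemma has_grad_lamA : has_grad lamA (fun=> gradA).
Proof.
have := has_grad_add (has_grad_cst 1) (has_grad_scale (-1) (has_grad_add has_grad_lamB has_grad_lamC)).
congr has_grad; apply/funext => p; first by rewrite /lamA; ring.
by rewrite add0r scaleN1r.
Qed.

Lemma open_triangle : open T.
Proof.
have -> : T = [set p | 0 < lamA p] `&` ([set p | 0 < lamB p] `&` [set p | 0 < lamC p]).
  apply/seteqP; split => p /=; first by move=> /triangle_lam[].
  by move=> [? []] ? ?; apply/triangle_lam.
have op (l : R * R -> R) : continuous l -> open [set p | 0 < l p].
  move=> cl; apply: (@open_comp _ _ l [set x | 0 < x]); last exact: open_gt.
  by move=> p _; exact: cl.
apply: openI; [|apply: openI]; apply: op.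
- exact: has_grad_continuous has_grad_lamA.
- exact: has_grad_continuous has_grad_lamB.
- exact: has_grad_continuous has_grad_lamC.
Qed.

Lemma measurable_triangle : measurable (T : set (RR R)).
Proof. exact: (open_measurable_plane open_triangle). Qed.

Lemma triangle_finite : (leb2 R (T : set (RR R)) < +oo)%E.
Proof.
have mT := measurable_triangle.
have := @integral_indic _ _ _ (leb2 R) setT measurableT T mT; rewrite setIT => <-.
rewrite (@ge0_integral_affine2 _ A.1 A.2 (B.1 - A.1) (B.2 - A.2) (C.1 - A.1) (C.2 - A.2))//; last first.
  by apply/measurable_EFinP; exact: measurable_indic.
have -> : (\int[leb2 R]_z (\1_T (affine2 A.1 A.2 (B.1 - A.1) (B.2 - A.2) (C.1 - A.1) (C.2 - A.2) z))%:E = leb2 R (@ref_triangle R : set (RR R)))%E.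
  have := @integral_indic _ _ _ (leb2 R) setT measurableT _ (@measurable_ref_triangle R).
  rewrite setIT => <-.
  by apply: eq_integral => z _; rewrite -triangle_param.
rewrite lte_mul_pinfty//; exact: ref_triangle_finite.
Qed.

Lemma continuous_param : continuous L.
Proof.
move=> z; apply: (@continuous_pair2 R (R * R)%type (fun z => A.1 + (B.1 - A.1) * z.1 + (C.1 - A.1) * z.2)
  (fun z => A.2 + (B.2 - A.2) * z.1 + (C.2 - A.2) * z.2)) => {}z.
  exact: (has_grad_continuous (has_grad_affine A.1 (B.1 - A.1) (C.1 - A.1))).
exact: (has_grad_continuous (has_grad_affine A.2 (B.2 - A.2) (C.2 - A.2))).
Qed.

Lemma triangle_bounded h : continuous h -> exists M, forall p, T p -> `|h p| <= M.
Proof.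
move=> ch; have ch' : continuous (h \o L).
  by move=> z; apply: continuous_comp; [exact: continuous_param|exact: ch].
have [M HM] := continuous_bounded_square ch'.
exists M => p Tp; have := HM (lamB p, lamC p); rewrite /= param_lam; apply;
  by move: Tp => /triangle_lam; rewrite /lamA => -[]; lra.
Qed.

Lemma triangle_L2 h : continuous h -> L2 (leb2 R) T h.
Proof.
move=> ch; have [M HM] := triangle_bounded ch.
apply: (L2_bounded measurable_triangle triangle_finite _ HM).
by apply: measurable_funTS; exact: continuous_measurable_plane.
Qed.

Lemma triangle_integrable h : continuous h -> (leb2 R).-integrable (T : set (RR R)) (EFin \o h).
Proof. by move=> /triangle_L2; apply: L2_integrable; [exact: measurable_triangle|exact: triangle_finite]. Qed.

Lemma triangle_Rintegral h : (leb2 R).-integrable (T : set (RR R)) (EFin \o h) ->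
  \int[leb2 R]_(p in T) h p = `|tdet| * \int[leb2 R]_(z in @ref_triangle R) h (L z).
Proof.
move=> ih; have := Rintegral_affine2 A.1 A.2 det0 measurable_triangle ih.
by rewrite -/L triangle_param.
Qed.

(** Without the length factor of [side_int] this is an average, invariant under affine maps, so
    Green's formula keeps [tdet] as its only metric factor. *)
Definition side_mean (P Q : R * R) h : R := \int[leb1 R]_(t in `[0, 1]) on_side P Q h t.

End TriangleGeometry.

Section SideIntegrals.
Variable R : realType.
Implicit Types (P Q A B C : R * R) (h : R * R -> R).

Lemma continuous_on_side P Q h : continuous h -> continuous (on_side P Q h).
Proof.
move=> ch t; apply: (@continuous_comp _ _ _ (fun t : R => (1 - t) *: P + t *: Q)); last exact: ch.
apply: cvgD; apply: cvgZr_tmp; last exact: cvg_id.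
by apply: cvgB; [exact: cvg_cst|exact: cvg_id].
Qed.

Lemma on_side_integrable P Q h : continuous h -> (leb1 R).-integrable `[0, 1] (EFin \o on_side P Q h).
Proof.
move=> ch; apply: continuous_compact_integrable; first by exact: segment_compact.
by apply: continuous_subspaceT; exact: continuous_on_side.
Qed.

Lemma side_meanC P Q h : continuous h -> side_mean P Q h = side_mean Q P h.
Proof.
move=> ch; rewrite /side_mean Rintegration_by_substitution_onem; last 2 first.
- by rewrite ler01 lexx.
- by apply: continuous_subspaceT; exact: continuous_on_side.
rewrite /unstable.onem subrr; apply: eq_Rintegral => t _.
by rewrite /on_side/= addrC; congr (h (_ + _)); rewrite /unstable.onem opprB addrC subrK.
Qed.

Lemma triangleC A B C : triangle A C B = triangle A B C.
Proof.
apply/seteqP; split => p [a [b [c [a0 b0 c0 abc ->]]]]; exists a, c, b; split => //;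
  by rewrite addrAC.
Qed.

(** In reference coordinates B - A is the first axis direction, the hypotenuse is BC and the left
    leg is CA, so this is [ref_green] pulled back. *)
Lemma triangle_green1 A B C h g : tdet A B C != 0 -> has_grad h g ->
  \int[leb2 R]_(p in triangle A B C) dot (B - A) (g p) =
    `|tdet A B C| * (side_mean B C h - side_mean C A h).
Proof.
move=> det0 hg; have ch := has_grad_continuous hg.
have cL := @continuous_param R A B C.
have cd : continuous (fun p => dot (B - A) (g p)).
  have cg1 : continuous (fun p => (g p).1).
    by move=> p; apply: continuous_comp; [exact: hg.1|exact: cvg_fst].
  have cg2 : continuous (fun p => (g p).2).
    by move=> p; apply: continuous_comp; [exact: hg.1|exact: cvg_snd].
  by move=> p; apply: cvgD; apply: cvgZl_tmp; [exact: cg1|exact: cg2].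
rewrite triangle_Rintegral//; last exact: triangle_integrable.
congr (_ * _); set L := affine2 _ _ _ _ _ _ in cL *.
have cc (k : R * R -> R) : continuous k -> continuous (k \o L).
  by move=> ck z; apply: continuous_comp; [exact: cL|exact: ck].
have hd (s t : R) : is_derive s (1 : R) (fun s => (h \o L) (s, t)) (dot (B - A) (g (L (s, t)))).
  have := hg.2 (L (s, t)) (B - A).
  have E : (fun x : R => x^-1 *: ((h \o shift (L (s, t))) (x *: (B - A)) - h (L (s, t)))) =
    (fun x : R => x^-1 *: (((fun s => (h \o L) (s, t)) \o shift s) (x *: 1) - (h \o L) (s, t))).
    apply/funext => x /=; congr (_ *: (h _ - _)).
    by rewrite /L /affine2/= [LHS]surjective_pairing/= /GRing.scale/=; congr pair; ring.
  move=> [e d]; apply: DeriveDef; first by move: e; rewrite /derivable E.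
  by move: d; rewrite /derive E.
rewrite (ref_green (cc _ ch) (cc _ cd) hd) (side_meanC C A ch) /side_mean -RintegralB//.
- apply: eq_Rintegral => t _; rewrite /= /L !paramE /on_side/=.
  congr (h _ - h _); first by rewrite (_ : 1 - (1 - t) - t = 0) ?scale0r ?add0r//; ring.
  by rewrite subr0 scale0r addr0.
- exact: on_side_integrable.
- exact: on_side_integrable.
Qed.

Lemma triangle_green2 A B C h g : tdet A B C != 0 -> has_grad h g ->
  \int[leb2 R]_(p in triangle A B C) dot (C - A) (g p) =
    `|tdet A B C| * (side_mean B C h - side_mean A B h).
Proof.
move=> det0 hg; have ch := has_grad_continuous hg.
have dE : tdet A C B = - tdet A B C by rewrite /tdet; ring.
rewrite -triangleC (triangle_green1 _ hg); last by rewrite dE oppr_eq0.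
by rewrite dE normrN (side_meanC B C ch) (side_meanC A B ch).
Qed.

End SideIntegrals.

(** * The divergence theorem on a triangle *)

Section TriangleDivergence.
Variables (R : realType) (A B C : R * R).
Implicit Types (p v w : R * R) (f h : R * R -> R) (g : R * R -> R * R).
Hypothesis det0 : tdet A B C != 0.

Let T := triangle A B C.

(** The gradients [gradB] and [gradC] are the basis dual to B - A and C - A. *)
Lemma dot_gradE v w : dot w v = dot w (gradB A B C) * dot (B - A) v + dot w (gradC A B C) * dot (C - A) v.
Proof. by rewrite /dot /gradB /gradC /tdet/=; field; exact: det0. Qed.

Lemma continuous_dot w g : continuous g -> continuous (fun p => dot w (g p)).
Proof.
move=> cg p.
have c1 : (g p).1 @[p --> p] --> (g p).1 by apply: (continuous_comp (cg p)); exact: cvg_fst.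
have c2 : (g p).2 @[p --> p] --> (g p).2 by apply: (continuous_comp (cg p)); exact: cvg_snd.
by apply: cvgD; apply: cvgZl_tmp; [exact: c1|exact: c2].
Qed.

(** The divergence theorem for the field h w: on the side opposite X, the outer normal times the
    length of the side is - |tdet| gradX. *)
Lemma triangle_divergence w h g : has_grad h g ->
  \int[leb2 R]_(p in T) dot w (g p) =
    - `|tdet A B C| * (dot w (gradA A B C) * side_mean B C h +
       dot w (gradB A B C) * side_mean C A h + dot w (gradC A B C) * side_mean A B h).
Proof.
move=> hg; under eq_Rintegral do rewrite dot_gradE.
have mT := measurable_triangle det0.
have i1 v : (leb2 R).-integrable (T : set (RR R)) (EFin \o (fun p => dot v (g p))).
  by apply: triangle_integrable => //; apply: continuous_dot; exact: hg.1.
have i2 k v : (leb2 R).-integrable (T : set (RR R)) (EFin \o (fun p => k * dot v (g p))).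
  by apply: integrable_scale.
rewrite RintegralD// !RintegralZl// (triangle_green1 det0 hg) (triangle_green2 det0 hg).
rewrite (_ : dot w (gradA A B C) = - (dot w (gradB A B C) + dot w (gradC A B C))); first by ring.
by rewrite /gradA /dot/=; ring.
Qed.

Lemma sideBC_notin (t : R) : ~ T ((1 - t) *: B + t *: C).
Proof.
have -> : (1 - t) *: B + t *: C = affine2 A.1 A.2 (B.1 - A.1) (B.2 - A.2) (C.1 - A.1) (C.2 - A.2) (1 - t, t).
  by rewrite paramE/= (_ : 1 - (1 - t) - t = 0) ?scale0r ?add0r//; ring.
by move=> /(triangle_lam det0)[]; rewrite lamA_param//=; lra.
Qed.

Lemma sideCA_notin (t : R) : ~ T ((1 - t) *: C + t *: A).
Proof.
have -> : (1 - t) *: C + t *: A = affine2 A.1 A.2 (B.1 - A.1) (B.2 - A.2) (C.1 - A.1) (C.2 - A.2) (0, 1 - t).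
  by rewrite paramE/= (_ : 1 - 0 - (1 - t) = t) ?scale0r ?addr0 1?addrC//; ring.
by move=> /(triangle_lam det0)[_]; rewrite lamB_param//=; lra.
Qed.

Lemma sideAB_notin (t : R) : ~ T ((1 - t) *: A + t *: B).
Proof.
have -> : (1 - t) *: A + t *: B = affine2 A.1 A.2 (B.1 - A.1) (B.2 - A.2) (C.1 - A.1) (C.2 - A.2) (t, 0).
  by rewrite paramE/= subr0 scale0r addr0.
by move=> /(triangle_lam det0)[_ _]; rewrite lamC_param//=; lra.
Qed.

Lemma integral_grad_compact w h g : has_grad h g -> (forall p, ~ T p -> h p = 0) ->
  \int[leb2 R]_(p in T) dot w (g p) = 0.
Proof.
move=> hg h0; have zero P Q : (forall t : R, ~ T ((1 - t) *: P + t *: Q)) -> side_mean P Q h = 0.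
  move=> PQ; rewrite /side_mean (@eq_Rintegral _ _ _ _ _ (fun=> 0)).
    by rewrite Rintegral_cst// mul0r.
  by move=> t _; rewrite /on_side h0.
rewrite (triangle_divergence w hg) (zero _ _ sideBC_notin) (zero _ _ sideCA_notin).
by rewrite (zero _ _ sideAB_notin) !mulr0 !addr0 mulr0.
Qed.

Lemma continuous_coord1 g : continuous g -> continuous (fun p => (g p).1).
Proof. by move=> cg p; apply: (continuous_comp (cg p)); exact: cvg_fst. Qed.

Lemma continuous_coord2 g : continuous g -> continuous (fun p => (g p).2).
Proof. by move=> cg p; apply: (continuous_comp (cg p)); exact: cvg_snd. Qed.

(** The product of h with a test function vanishes off the open triangle, in particular on its
    sides, so the integral of its gradient is 0 and the product rule gives the weak derivative. *)
Lemma H1_has_grad h g : has_grad h g -> H1 T h g.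
Proof.
move=> hg; have ch := has_grad_continuous hg.
have mT := measurable_triangle det0.
split.
- exact: triangle_L2.
- by apply: triangle_L2 => //; apply: continuous_coord1; exact: hg.1.
- by apply: triangle_L2 => //; apply: continuous_coord2; exact: hg.1.
move=> f [Cf [K [_ KT f0]]]; have hf := C1_has_grad Cf.
have cf := has_grad_continuous hf.
have key w : \int[leb2 R]_(p in T) (h p * dot w (grad f p)) =
    - \int[leb2 R]_(p in T) (dot w (g p) * f p).
  have H : \int[leb2 R]_(p in T) dot w (f p *: g p + h p *: grad f p) = 0.
    apply: (integral_grad_compact w (has_grad_mul hf hg)) => p nT.
    by rewrite f0 ?mul0r// => /KT.
  have i1 : (leb2 R).-integrable (T : set (RR R)) (EFin \o (fun p => f p * dot w (g p))).
    apply: triangle_integrable => // p; apply: cvgM; first exact: cf.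
    by apply: continuous_dot; exact: hg.1.
  have i2 : (leb2 R).-integrable (T : set (RR R)) (EFin \o (fun p => h p * dot w (grad f p))).
    apply: triangle_integrable => // p; apply: cvgM; first exact: ch.
    by apply: continuous_dot; exact: hf.1.
  move: H; under eq_Rintegral do rewrite dotDr !dotZr.
  rewrite RintegralD// => H.
  under [in RHS]eq_Rintegral do rewrite mulrC.
  by apply/eqP; rewrite -addr_eq0 addrC H.
have d1 v : dot (1, 0) v = v.1 :> R by rewrite /dot/= mul1r mul0r addr0.
have d2 v : dot (0, 1) v = v.2 :> R by rewrite /dot/= mul1r mul0r add0r.
split.
  transitivity (\int[leb2 R]_(p in T) (h p * dot (1, 0) (grad f p))).
    by apply: eq_Rintegral => p _; rewrite d1.
  by rewrite key; congr (- _); apply: eq_Rintegral => p _; rewrite d1.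
transitivity (\int[leb2 R]_(p in T) (h p * dot (0, 1) (grad f p))).
  by apply: eq_Rintegral => p _; rewrite d2.
by rewrite key; congr (- _); apply: eq_Rintegral => p _; rewrite d2.
Qed.

Lemma Rintegral01_FTC (F f : R -> R) : continuous f ->
  (forall t : R, is_derive t (1 : R) F (f t)) ->
  \int[leb1 R]_(t in `[0, 1]) f t = F 1 - F 0.
Proof.
move=> cf dF; rewrite /Rintegral (@continuous_FTC2 _ f F)//.
- exact: continuous_subspaceT.
- have cF : continuous F.
    by move=> t; apply/differentiable_continuous/derivable1_diffP/ex_derive.
  split; first by move=> s _; exact: ex_derive.
    exact/cvg_at_right_filter/cF.
  exact/cvg_at_left_filter/cF.
- by move=> s _; rewrite derive1E derive_val.
Qed.

(** On the reference triangle the constant 1 is the derivative of the first coordinate, so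
    [ref_green] reduces the area to an integral over [0, 1]. *)
Lemma area_triangle : area A B C = `|tdet A B C| / 2.
Proof.
have mT := measurable_triangle det0.
have := Rintegral_cst (leb2 R) mT 1; rewrite mul1r -/(area A B C) => <-.
rewrite triangle_Rintegral//; last first.
  by apply: triangle_integrable => // p; exact: cvg_cst.
congr (_ * _).
have c1 : continuous ((fun=> 1) : R * R -> R) by move=> p; exact: cvg_cst.
have d1 (s t : R) : is_derive s (1 : R) (fun s => (s, t).1) 1 by exact: is_derive_id.
rewrite (ref_green (@continuous_fst2 R) c1 d1) /=.
have ck : continuous (fun t : R => 1 - t - 0).
  by move=> t; apply: cvgB; [apply: cvgB; [exact: cvg_cst|exact: cvg_id]|exact: cvg_cst].
have dk (t : R) : is_derive t (1 : R) (id - (2^-1 \*: id ^+ 2)) (1 - t - 0).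
  by apply: is_derive_eq; rewrite /GRing.scale/=; field.
rewrite (Rintegral01_FTC ck dk) -[LHS]/((1 - 2^-1 * 1 ^+ 2) - (0 - 2^-1 * 0 ^+ 2)).
by field.
Qed.

End TriangleDivergence.

(** * Metric relations in an equilateral triangle *)

Section Equilateral.
Variables (R : realType) (A B C : R * R).
Hypothesis eqT : equilateral A B C.
(* Unqualified [edist] is the extended distance of MathComp-Analysis. *)
Let a := Defs.edist A B.

Lemma edist_sqr (P Q : R * R) : Defs.edist P Q ^+ 2 = (P.1 - Q.1) ^+ 2 + (P.2 - Q.2) ^+ 2.
Proof. by rewrite sqr_sqrtr// addr_ge0 ?sqr_ge0. Qed.

Lemma equilateral_side_gt0 : 0 < a.
Proof. by case: eqT. Qed.

Lemma equilateral_dots : [/\ dot (B - A) (B - A) = a ^+ 2, dot (C - A) (C - A) = a ^+ 2 &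
  dot (B - A) (C - A) = a ^+ 2 / 2].
Proof.
case: eqT => a0 hb hc.
have hA := edist_sqr A B; have hB := edist_sqr B C; have hC := edist_sqr C A.
rewrite hb -/a in hB; rewrite hc -/a in hC; rewrite -/a in hA.
by rewrite /dot/=; split; lra.
Qed.

(** The square is the Gram determinant of two edges. The sign of [tdet] depends on the orientation,
    which is left free. *)
Lemma equilateral_det_sqr : tdet A B C ^+ 2 = 3 / 4 * a ^+ 4.
Proof.
have [h1 h2 h3] := equilateral_dots.
have -> : tdet A B C ^+ 2 = dot (B - A) (B - A) * dot (C - A) (C - A) - dot (B - A) (C - A) ^+ 2.
  by rewrite /tdet /dot/=; ring.
by rewrite h1 h2 h3; field.
Qed.

Lemma equilateral_det0 : tdet A B C != 0.
Proof.
by rewrite -sqrf_eq0 equilateral_det_sqr mulf_neq0// expf_neq0// gt_eqF// equilateral_side_gt0.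
Qed.

(* The common squared length of the gradients of the barycentric coordinates,
   that is 1 / height^2. *)
Definition curv : R := 4 / (3 * a ^+ 2).

Lemma equilateral_grads :
  [/\ [/\ dot (gradA A B C) (gradA A B C) = curv, dot (gradB A B C) (gradB A B C) = curv &
       dot (gradC A B C) (gradC A B C) = curv],
      dot (gradA A B C) (gradB A B C) = - curv / 2, dot (gradA A B C) (gradC A B C) = - curv / 2 &
      dot (gradB A B C) (gradC A B C) = - curv / 2].
Proof.
have [h1 h2 h3] := equilateral_dots; have d0 := equilateral_det0.
have a0 : a != 0 by rewrite gt_eqF// equilateral_side_gt0.
have hB : dot (gradB A B C) (gradB A B C) = curv.
  have -> : dot (gradB A B C) (gradB A B C) = dot (C - A) (C - A) / tdet A B C ^+ 2.
    by rewrite /gradB /dot/=; field; exact: d0.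
  by rewrite h2 equilateral_det_sqr /curv; field.
have hC : dot (gradC A B C) (gradC A B C) = curv.
  have -> : dot (gradC A B C) (gradC A B C) = dot (B - A) (B - A) / tdet A B C ^+ 2.
    by rewrite /gradC /dot/=; field; exact: d0.
  by rewrite h1 equilateral_det_sqr /curv; field.
have hBC : dot (gradB A B C) (gradC A B C) = - curv / 2.
  have -> : dot (gradB A B C) (gradC A B C) = - dot (B - A) (C - A) / tdet A B C ^+ 2.
    by rewrite /gradC /gradB /dot/=; field; exact: d0.
  by rewrite h3 equilateral_det_sqr /curv; field.
have gA v : dot (gradA A B C) v = - dot (gradB A B C) v - dot (gradC A B C) v.
  by rewrite /gradA /dot/=; ring.
have hCB := hBC; rewrite dotC in hCB.
have hAB : dot (gradA A B C) (gradB A B C) = - curv / 2 by rewrite gA hB hCB; field.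
have hAC : dot (gradA A B C) (gradC A B C) = - curv / 2 by rewrite gA hC hBC; field.
by split=> //; split => //; rewrite gA ![dot _ (gradA A B C)]dotC hAB hAC; field.
Qed.

End Equilateral.

(** * The explicit solution *)

Section WeakLimit.
Variables (R : realType) (A B C : R * R).
Hypothesis eqT : equilateral A B C.
Let T := triangle A B C.
Let a := Defs.edist A B.
Let det0 := equilateral_det0 eqT.
Let mT := measurable_triangle det0.

Lemma bd_intE (h : R * R -> R) :
  bd_int A B C h = a * (side_mean A B h + side_mean B C h + side_mean C A h).
Proof.
case: eqT => _ hb hc; rewrite /bd_int /side_int hb hc -/a /side_mean.
by rewrite !mulrDr.
Qed.

Lemma cvg_to0_le (u v : nat -> R) : (forall n, 0 <= u n <= v n) ->
  v @ \oo --> (0 : R) -> u @ \oo --> (0 : R).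
Proof.
move=> uv v0; apply: (@squeeze_cvgr _ _ _ _ (fun=> 0) v u _ _ (cvg_cst _) v0).
exact: nearW.
Qed.

(** With v fixed, every term is an L^2 pairing with a fixed function, so the identity passes to the
    limit along the C^1 approximations that define the trace. *)
Lemma weak_limit (v : R * R -> R) (gv : R * R -> R * R) (c : R) : has_grad v gv ->
  (forall f, C1 f -> \int[leb2 R]_(p in T) dot (gv p) (grad f p) + bd_int A B C f =
    c * \int[leb2 R]_(p in T) (v p * f p)) ->
  forall phi Phi tau, H1 T phi Phi -> is_trace A B C phi Phi tau ->
    \int[leb2 R]_(p in T) dot (gv p) (Phi p) + bd_int A B C tau =
    c * \int[leb2 R]_(p in T) (v p * phi p).
Proof.
move=> hv id phi Phi tau [Lphi LP1 LP2 _] [[LA LB LC] [f [Cf f1 f2 f3]]].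
have finT := triangle_finite det0.
have cv := has_grad_continuous hv.
have Lv : L2 (leb2 R) T v by exact: triangle_L2.
have Lv1 : L2 (leb2 R) T (fun p => (gv p).1).
  by apply: triangle_L2 => //; apply: continuous_coord1; exact: hv.1.
have Lv2 : L2 (leb2 R) T (fun p => (gv p).2).
  by apply: triangle_L2 => //; apply: continuous_coord2; exact: hv.1.
have Lf n : L2 (leb2 R) T (f n) by apply: triangle_L2 => //; exact: C1_continuous.
have Lf1 n : L2 (leb2 R) T (fun p => (grad (f n) p).1).
  by apply: triangle_L2 => //; apply: continuous_coord1; exact: (Cf n).2.
have Lf2 n : L2 (leb2 R) T (fun p => (grad (f n) p).2).
  by apply: triangle_L2 => //; apply: continuous_coord2; exact: (Cf n).2.
have L0 n := L2_sub mT (Lf n) Lphi.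
have L1 n := L2_sub mT (Lf1 n) LP1.
have L2' n := L2_sub mT (Lf2 n) LP2.
have dotE n : \int[leb2 R]_(p in T) dot (grad (f n) p - Phi p) (grad (f n) p - Phi p) =
    \int[leb2 R]_(p in T) (((grad (f n) p).1 - (Phi p).1) ^+ 2) +
    \int[leb2 R]_(p in T) (((grad (f n) p).2 - (Phi p).2) ^+ 2).
  by rewrite -(RintegralD mT (L1 n).2 (L2' n).2); apply: eq_Rintegral.
have sq0 (h : R * R -> R) : 0 <= \int[leb2 R]_(p in T) (h p ^+ 2).
  by apply: Rintegral_ge0 => p _; exact: sqr_ge0.
have e1 : (\int[leb2 R]_(p in T) (((grad (f n) p).1 - (Phi p).1) ^+ 2)) @[n --> \oo] --> (0 : R).
  by apply: cvg_to0_le f2 => n; rewrite dotE sq0/= lerDl sq0.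
have e2 : (\int[leb2 R]_(p in T) (((grad (f n) p).2 - (Phi p).2) ^+ 2)) @[n --> \oo] --> (0 : R).
  by apply: cvg_to0_le f2 => n; rewrite dotE sq0/= lerDr sq0.
have lim0 := cvg_Rintegral_mul0 mT Lv L0 f1.
have lim1 := cvg_Rintegral_mul0 mT Lv1 L1 e1.
have lim2 := cvg_Rintegral_mul0 mT Lv2 L2' e2.
have a0 : 0 < a := equilateral_side_gt0 eqT.
have mI : measurable (`[0, 1]%classic : set (measurableTypeR R)) by exact: measurable_itv.
have finI : (leb1 R `[0%R, 1%R]%classic < +oo)%E.
  by rewrite lebesgue_measure_itv/= lte_fin ltr01 oppr0 adde0 ltry.
have Lside P Q n : L2 (leb1 R) `[0, 1] (on_side P Q (f n)).
  have cs := @continuous_on_side R P Q _ (C1_continuous (Cf n)).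
  split; first by apply: measurable_funTS; exact: continuous_measurable_fun.
  apply: continuous_compact_integrable; first by exact: segment_compact.
  apply: continuous_subspaceT => t.
  by apply: (@continuous_comp _ _ _ (on_side P Q (f n)) (fun x => x ^+ 2)); [exact: cs|exact: exprn_continuous].
(* The squared error on one side is at most that on the whole boundary; pairing the error with the
   constant 1 gives convergence of the means. *)
have sideE P Q : L2 (leb1 R) `[0, 1] (on_side P Q tau) ->
   (forall n, side_mean P Q (fun p => (f n p - tau p) ^+ 2) <=
     side_mean A B (fun p => (f n p - tau p) ^+ 2) + side_mean B C (fun p => (f n p - tau p) ^+ 2) +
     side_mean C A (fun p => (f n p - tau p) ^+ 2)) ->
   (side_mean P Q (f n) - side_mean P Q tau) @[n --> \oo] --> (0 : R).
  move=> Lt le.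
  have Le n := L2_sub mI (Lside P Q n) Lt.
  have c0 : (side_mean P Q (fun p => (f n p - tau p) ^+ 2)) @[n --> \oo] --> (0 : R).
    have f3' : (a^-1 * bd_int A B C (fun p => (f n p - tau p) ^+ 2)) @[n --> \oo] --> (a^-1 * 0 : R).
      exact: (cvgM (cvg_cst _) f3).
    rewrite mulr0 in f3'; apply: cvg_to0_le f3' => n.
    rewrite bd_intE mulKf ?gt_eqF// le andbT.
    by apply: Rintegral_ge0 => t _; exact: sqr_ge0.
  have L1' : L2 (leb1 R) `[0, 1] (fun=> 1 : R).
    by apply: (L2_bounded mI finI (M := 1)) => // t _; rewrite normr1.
  suff -> : (fun n => side_mean P Q (f n) - side_mean P Q tau) =
      (fun n => \int[leb1 R]_(t in `[0, 1]) (1 * (on_side P Q (f n) t - on_side P Q tau t))).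
    exact: (cvg_Rintegral_mul0 mI L1' Le c0).
  apply/funext => n; rewrite /side_mean -RintegralB//.
  - by apply: eq_Rintegral => t _; rewrite mul1r.
  - exact: L2_integrable.
  - exact: L2_integrable.
have sm0 P Q n : 0 <= side_mean P Q (fun p => (f n p - tau p) ^+ 2).
  by apply: Rintegral_ge0 => t _; exact: sqr_ge0.
have lAB := sideE A B LA _; have {}lAB := lAB ltac:(by move=> n; rewrite -addrA lerDl addr_ge0).
have lBC := sideE B C LB _; have {}lBC := lBC ltac:(by move=> n; rewrite addrAC lerDr addr_ge0).
have lCA := sideE C A LC _; have {}lCA := lCA ltac:(by move=> n; rewrite lerDr addr_ge0).
(* The defect of the identity for [phi]. It does not depend on n, yet [idn] writes it as a
   combination of errors that tend to 0. *)
pose X := c * \int[leb2 R]_(p in T) (v p * phi p) - \int[leb2 R]_(p in T) dot (gv p) (Phi p) - bd_int A B C tau.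
have idn n : (\int[leb2 R]_(p in T) ((gv p).1 * ((grad (f n) p).1 - (Phi p).1)) +
   \int[leb2 R]_(p in T) ((gv p).2 * ((grad (f n) p).2 - (Phi p).2))) +
   a * ((side_mean A B (f n) - side_mean A B tau) + (side_mean B C (f n) - side_mean B C tau) +
     (side_mean C A (f n) - side_mean C A tau)) - c * \int[leb2 R]_(p in T) (v p * (f n p - phi p)) =
   X.
  rewrite /X; have := id _ (Cf n); rewrite !bd_intE.
  rewrite -[X in X + _]/(\int[leb2 R]_(p in T) ((gv p).1 * (grad (f n) p).1 + (gv p).2 * (grad (f n) p).2)).
  rewrite -[X in _ - X - _]/(\int[leb2 R]_(p in T) ((gv p).1 * (Phi p).1 + (gv p).2 * (Phi p).2)).
  rewrite (RintegralD mT (L2_mul mT Lv1 (Lf1 n)) (L2_mul mT Lv2 (Lf2 n))).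
  rewrite (RintegralD mT (L2_mul mT Lv1 LP1) (L2_mul mT Lv2 LP2)).
  have mulB (w h k : R * R -> R) : L2 (leb2 R) T w -> L2 (leb2 R) T h -> L2 (leb2 R) T k ->
      \int[leb2 R]_(p in T) (w p * (h p - k p)) =
      \int[leb2 R]_(p in T) (w p * h p) - \int[leb2 R]_(p in T) (w p * k p).
    move=> lw lh lk; rewrite -(RintegralB mT (L2_mul mT lw lh) (L2_mul mT lw lk)).
    by apply: eq_Rintegral => p _; rewrite mulrBr.
  rewrite (mulB _ _ _ Lv1 (Lf1 n) LP1) (mulB _ _ _ Lv2 (Lf2 n) LP2) (mulB _ _ _ Lv (Lf n) Lphi).
  move: (side_mean A B tau) (side_mean B C tau) (side_mean C A tau).
  move: (side_mean A B (f n)) (side_mean B C (f n)) (side_mean C A (f n)).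
  move: (\int[leb2 R]_(p in T) ((gv p).1 * (grad (f n) p).1)) (\int[leb2 R]_(p in T) ((gv p).2 * (grad (f n) p).2)).
  move: (\int[leb2 R]_(p in T) ((gv p).1 * (Phi p).1)) (\int[leb2 R]_(p in T) ((gv p).2 * (Phi p).2)).
  move: (\int[leb2 R]_(p in T) (v p * f n p)) (\int[leb2 R]_(p in T) (v p * phi p)).
  move=> {}e1 {}e2 e3 e4 e5 e6 s1 s2 s3 s4 s5 s6 H.
  by clear -H; lra.
have lim : ((fun=> X) : nat -> R) @ \oo --> (0 : R).
  have := cvgB (cvgD (cvgD lim1 lim2) (cvgM (cvg_cst a) (cvgD (cvgD lAB lBC) lCA)))
    (cvgM (cvg_cst c) lim0).
  rewrite !(addr0, mulr0, subr0) => /(_ _ _ _ _ _ _ _ _ _) (* Filter instances *) H; apply: (cvg_trans _ H).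
  by apply: near_eq_cvg; apply: nearW => n; exact: idn.
have X0 : X = 0 by apply: (cvg_unique (@Rhausdorff R) _ lim); exact: cvg_cst.
by move/eqP : X0; rewrite /X -addrA -opprD subr_eq0 => /eqP.
Qed.

End WeakLimit.

(** * Sums of plane waves in the barycentric coordinates *)

Section ExplicitSolution.
Variables (R : realType) (A B C : R * R).
Hypothesis eqT : equilateral A B C.
Let T := triangle A B C.
Let a := Defs.edist A B.
Let det0 := equilateral_det0 eqT.
Let mT := measurable_triangle det0.
Let gA := gradA A B C.
Let gB := gradB A B C.
Let gC := gradC A B C.
Let lA := lamA A B C.
Let lB := lamB A B C.
Let lC := lamC A B C.
Variables (theta K : R).

(** Composed with a barycentric coordinate, whose gradient has squared length [curv], this solves
    the Helmholtz equation with c = 4 theta^2 curv. The phase is centred at x = 1/2 to make the wave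
    even there. *)
Definition wave (x : R) : R := K * cos (theta * (2 * x - 1)).
Definition dwave (x : R) : R := - (2 * theta * K) * sin (theta * (2 * x - 1)).
Definition ddwave (x : R) : R := - (4 * theta ^+ 2) * wave x.

Lemma is_derive_phase (x : R) : is_derive x (1 : R) (fun x => theta * (2 * x - 1)) (2 * theta).
Proof.
have -> : (fun x => theta * (2 * x - 1)) = theta \*: (2 \*: (id : R -> R) - cst 1) by [].
by apply: is_derive_eq; rewrite /GRing.scale/=; ring.
Qed.

Lemma is_derive_wave (x : R) : is_derive x (1 : R) wave (dwave x).
Proof.
have dp := is_derive_phase x.
have dc := is_derive1_comp (f := cos) (g := fun x => theta * (2 * x - 1)) (is_derive_cos _) dp.
apply: (is_derive_eq (is_deriveZ K dc)).
by rewrite /dwave /GRing.scale/=; ring.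
Qed.

Lemma is_derive_dwave (x : R) : is_derive x (1 : R) dwave (ddwave x).
Proof.
have dp := is_derive_phase x.
have dc := is_derive1_comp (f := sin) (g := fun x => theta * (2 * x - 1)) (is_derive_sin _) dp.
apply: (is_derive_eq (is_deriveZ (- (2 * theta * K)) dc)).
by rewrite /ddwave /wave /GRing.scale/=; ring.
Qed.

Lemma derive_continuous (f df : R -> R) : (forall x : R, is_derive x (1 : R) f (df x)) -> continuous f.
Proof. by move=> H x; apply/differentiable_continuous/derivable1_diffP/ex_derive. Qed.

Let cwave : continuous wave := derive_continuous is_derive_wave.
Let cdwave : continuous dwave := derive_continuous is_derive_dwave.
Let cddwave : continuous ddwave.
Proof. by move=> x; apply: cvgM; [exact: cvg_cst|exact: cwave]. Qed.

Definition wave_sum p : R := wave (lA p) + wave (lB p) + wave (lC p).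
Definition wave_grad p : R * R := dwave (lA p) *: gA + dwave (lB p) *: gB + dwave (lC p) *: gC.

Lemma has_grad_wave_sum : has_grad wave_sum wave_grad.
Proof.
apply: has_grad_add; first apply: has_grad_add.
- exact: (has_grad_comp is_derive_wave cdwave (has_grad_lamA A B C)).
- exact: (has_grad_comp is_derive_wave cdwave (has_grad_lamB A B C)).
- exact: (has_grad_comp is_derive_wave cdwave (has_grad_lamC A B C)).
Qed.

Lemma dwave_odd (x : R) : dwave (1 - x) = - dwave x.
Proof.
rewrite /dwave (_ : theta * (2 * (1 - x) - 1) = - (theta * (2 * x - 1))); last by ring.
by rewrite sinN; ring.
Qed.

Lemma lam_on_side_BC (t : R) : [/\ lA ((1 - t) *: B + t *: C) = 0,
  lB ((1 - t) *: B + t *: C) = 1 - t & lC ((1 - t) *: B + t *: C) = t].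
Proof.
have -> : (1 - t) *: B + t *: C = affine2 A.1 A.2 (B.1 - A.1) (B.2 - A.2) (C.1 - A.1) (C.2 - A.2) (1 - t, t).
  by rewrite paramE/= (_ : 1 - (1 - t) - t = 0) ?scale0r ?add0r//; ring.
by rewrite /lA /lB /lC lamA_param// lamB_param// lamC_param//=; split=> //; ring.
Qed.

Lemma lam_on_side_CA (t : R) : [/\ lA ((1 - t) *: C + t *: A) = t,
  lB ((1 - t) *: C + t *: A) = 0 & lC ((1 - t) *: C + t *: A) = 1 - t].
Proof.
have -> : (1 - t) *: C + t *: A = affine2 A.1 A.2 (B.1 - A.1) (B.2 - A.2) (C.1 - A.1) (C.2 - A.2) (0, 1 - t).
  by rewrite paramE/= (_ : 1 - 0 - (1 - t) = t) ?scale0r ?addr0 1?addrC//; ring.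
by rewrite /lA /lB /lC lamA_param// lamB_param// lamC_param//=; split=> //; ring.
Qed.

Lemma lam_on_side_AB (t : R) : [/\ lA ((1 - t) *: A + t *: B) = 1 - t,
  lB ((1 - t) *: A + t *: B) = t & lC ((1 - t) *: A + t *: B) = 0].
Proof.
have -> : (1 - t) *: A + t *: B = affine2 A.1 A.2 (B.1 - A.1) (B.2 - A.2) (C.1 - A.1) (C.2 - A.2) (t, 0).
  by rewrite paramE/= subr0 scale0r addr0.
by rewrite /lA /lB /lC lamA_param// lamB_param// lamC_param//=; split=> //; ring.
Qed.

(* On each side the fluxes of the waves of the two coordinates that are not
   constant cancel, since their values add up to 1 and [dwave] is odd about 1/2. *)
Lemma wave_green f : C1 f ->
  \int[leb2 R]_(p in T) dot (wave_grad p) (grad f p) -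
    4 * theta ^+ 2 * curv A B * \int[leb2 R]_(p in T) (wave_sum p * f p) =
  - (`|tdet A B C| * curv A B * (2 * theta * K * sin theta)) *
    (side_mean A B f + side_mean B C f + side_mean C A f).
Proof.
move=> Cf; have hf := C1_has_grad Cf.
have cf := C1_continuous Cf.
have hX (l : R * R -> R) (gl : R * R) : has_grad l (fun=> gl) ->
    has_grad (fun p => dwave (l p) * f p)
      (fun p => dwave (l p) *: grad f p + f p *: (ddwave (l p) *: gl)).
  move=> hl; apply: (has_grad_mul _ hf).
  exact: (has_grad_comp is_derive_dwave cddwave hl).
have hA := hX _ _ (has_grad_lamA A B C); have hB := hX _ _ (has_grad_lamB A B C).
have hC := hX _ _ (has_grad_lamC A B C).
have divA := triangle_divergence det0 gA hA.
have divB := triangle_divergence det0 gB hB.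
have divC := triangle_divergence det0 gC hC.
have iX w (h : R * R -> R) g : has_grad h g -> (leb2 R).-integrable (T : set (RR R)) (EFin \o (fun p => dot w (g p))).
  by move=> hg; apply: triangle_integrable => //; apply: continuous_dot; exact: hg.1.
have iA := iX gA _ _ hA; have iB := iX gB _ _ hB; have iC := iX gC _ _ hC.
have i1 : (leb2 R).-integrable (T : set (RR R)) (EFin \o (fun p => wave_sum p * f p)).
  apply: triangle_integrable => // p; apply: cvgM; last exact: cf.
  exact: (has_grad_continuous has_grad_wave_sum).
have i2 : (leb2 R).-integrable (T : set (RR R)) (EFin \o (fun p => dot (wave_grad p) (grad f p))).
  have L1 := triangle_L2 det0 (continuous_coord1 has_grad_wave_sum.1).
  have L2 := triangle_L2 det0 (continuous_coord2 has_grad_wave_sum.1).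
  have L3 := triangle_L2 det0 (continuous_coord1 hf.1).
  have L4 := triangle_L2 det0 (continuous_coord2 hf.1).
  exact: (integrable_add mT (L2_mul mT L1 L3) (L2_mul mT L2 L4)).
have [[hAA hBB hCC] hAB hAC hBC] := equilateral_grads eqT.
have hBA := hAB; rewrite dotC in hBA; have hCA := hAC; rewrite dotC in hCA.
have hCB := hBC; rewrite dotC in hCB.
(* The right side is the sum of the divergences of the fields [dwave lX * f * gX]; the terms with
   [ddwave] and |gX|^2 = curv give the zero-order integral. *)
have -> : \int[leb2 R]_(p in T) dot (wave_grad p) (grad f p) -
    4 * theta ^+ 2 * curv A B * \int[leb2 R]_(p in T) (wave_sum p * f p) =
    \int[leb2 R]_(p in T) dot gA (dwave (lA p) *: grad f p + f p *: (ddwave (lA p) *: gA)) +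
    \int[leb2 R]_(p in T) dot gB (dwave (lB p) *: grad f p + f p *: (ddwave (lB p) *: gB)) +
    \int[leb2 R]_(p in T) dot gC (dwave (lC p) *: grad f p + f p *: (ddwave (lC p) *: gC)).
  rewrite -(RintegralD mT iA iB) -(RintegralD mT (integrable_add mT iA iB) iC).
  rewrite -(RintegralZl _ mT i1) -(RintegralB mT i2 (integrable_scale mT _ i1)).
  apply: eq_Rintegral => p _.
  rewrite !dotDr !dotZr /gA /gB /gC hAA hBB hCC /wave_grad !dotDl !dotZl /ddwave /wave_sum.
  ring.
rewrite divA divB divC /gA /gB /gC hAA hBB hCC hAB hAC hBC hBA hCA hCB.
(* Here [l1] is the coordinate that vanishes on the side PQ, while [l2] and [l3] add up to 1
   there. *)
have smE (P Q : R * R) (l1 l2 l3 : R * R -> R) (x1 x2 : R -> R) :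
    continuous l1 -> continuous l2 -> continuous l3 ->
    (forall t : R, [/\ l1 ((1 - t) *: P + t *: Q) = 0, l2 ((1 - t) *: P + t *: Q) = x2 t &
      l3 ((1 - t) *: P + t *: Q) = 1 - x2 t]) ->
    side_mean P Q (fun p => dwave (l1 p) * f p) = dwave 0 * side_mean P Q f /\
    side_mean P Q (fun p => dwave (l2 p) * f p) = - side_mean P Q (fun p => dwave (l3 p) * f p).
  move=> c1 c2 c3 lt.
  have ci (l : R * R -> R) : continuous l -> (leb1 R).-integrable `[0, 1] (EFin \o on_side P Q (fun p => dwave (l p) * f p)).
    move=> cl; apply: on_side_integrable => p; apply: cvgM; last exact: cf.
    by apply: (@continuous_comp _ _ _ l dwave); [exact: cl|exact: cdwave].
  split.
    rewrite /side_mean -RintegralZl//; last exact: on_side_integrable.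
    by apply: eq_Rintegral => t _; rewrite /on_side; have [-> _ _] := lt t.
  apply/eqP; rewrite -addr_eq0; apply/eqP.
  rewrite /side_mean -(RintegralD _ (ci _ c2) (ci _ c3))//.
  rewrite (@eq_Rintegral _ _ _ _ _ (fun=> 0)) ?Rintegral_cst ?mul0r//.
  move=> t _; rewrite /on_side; have [_ -> ->] := lt t.
  by rewrite dwave_odd; ring.
have cA : continuous lA := has_grad_continuous (has_grad_lamA A B C).
have cB : continuous lB := has_grad_continuous (has_grad_lamB A B C).
have cC : continuous lC := has_grad_continuous (has_grad_lamC A B C).
have [eBC1 eBC2] := smE B C lA lC lB (fun t => t) (fun t => t) cA cC cB
  (fun t => let: And3 h1 h2 h3 := lam_on_side_BC t in And3 h1 h3 h2).
have [eCA1 eCA2] := smE C A lB lA lC (fun t => t) (fun t => t) cB cA cC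
  (fun t => let: And3 h1 h2 h3 := lam_on_side_CA t in And3 h2 h1 h3).
have [eAB1 eAB2] := smE A B lC lB lA (fun t => t) (fun t => t) cC cB cA
  (fun t => let: And3 h1 h2 h3 := lam_on_side_AB t in And3 h3 h2 h1).
have d0 : dwave 0 = 2 * theta * K * sin theta.
  by rewrite /dwave mulr0 sub0r mulrN1 sinN; ring.
rewrite -/lA -/lB -/lC eBC1 eCA1 eAB1 eBC2 eCA2 eAB2 d0; by field.
Qed.

(** This choice of K makes the constant outer normal derivative equal to -1: the right side of
    [wave_green] becomes - [bd_int]. *)
Hypothesis normalized : `|tdet A B C| * curv A B * (2 * theta * K * sin theta) = a.

Lemma wave_weak : forall phi Phi tau, H1 T phi Phi -> is_trace A B C phi Phi tau ->
    \int[leb2 R]_(p in T) dot (wave_grad p) (Phi p) + bd_int A B C tau =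
    4 * theta ^+ 2 * curv A B * \int[leb2 R]_(p in T) (wave_sum p * phi p).
Proof.
apply: (weak_limit eqT has_grad_wave_sum) => f Cf.
have := wave_green Cf; rewrite normalized bd_intE// => /eqP.
by rewrite subr_eq mulNr addrC -subr_eq opprK => /eqP.
Qed.

Lemma wave_trace : is_trace A B C wave_sum wave_grad wave_sum.
Proof.
have hg := has_grad_wave_sum; have [Cv gv] := has_grad_C1 hg.
have cv := C1_continuous Cv.
have Ls P Q : L2 (leb1 R) `[0, 1] (on_side P Q wave_sum).
  have cs := @continuous_on_side R P Q _ cv.
  split; first by apply: measurable_funTS; exact: continuous_measurable_fun.
  apply: continuous_compact_integrable; first by exact: segment_compact.
  apply: continuous_subspaceT => t.
  by apply: (@continuous_comp _ _ _ (on_side P Q wave_sum) (fun x => x ^+ 2)); [exact: cs|exact: exprn_continuous].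
split; first by split.
exists (fun=> wave_sum); split => //.
- rewrite (_ : (fun=> _) = cst 0); first exact: cvg_cst.
  apply/funext => n; rewrite (@eq_Rintegral _ _ _ _ _ (fun=> 0)) ?Rintegral_cst ?mul0r//.
  by move=> p _; rewrite subrr expr0n.
- rewrite (_ : (fun=> _) = cst 0); first exact: cvg_cst.
  apply/funext => n; rewrite (@eq_Rintegral _ _ _ _ _ (fun=> 0)) ?Rintegral_cst ?mul0r//.
  by move=> p _; rewrite gv subrr /dot/= mulr0 addr0.
- rewrite (_ : (fun=> _) = cst 0); first exact: cvg_cst.
  apply/funext => n; rewrite bd_intE// /side_mean.
  have z P Q : \int[leb1 R]_(t in `[0, 1]) on_side P Q (fun p => (wave_sum p - wave_sum p) ^+ 2) t = 0.
    rewrite (@eq_Rintegral _ _ _ _ _ (fun=> 0)) ?Rintegral_cst ?mul0r//.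
    by move=> t _; rewrite /on_side subrr expr0n.
  by rewrite !z !addr0 mulr0.
Qed.

(* The two weak equations, each tested with the other solution, differ only in
   their boundary terms. *)
Lemma solution_bd_int c u g : c = 4 * theta ^+ 2 * curv A B ->
  neumann_solution A B C c u g -> bd_int A B C g = bd_int A B C wave_sum.
Proof.
move=> cE [G [Hu tr sol]].
have H1w := H1_has_grad det0 has_grad_wave_sum.
have e1 := sol _ _ _ H1w wave_trace.
have e2 := wave_weak Hu tr; rewrite -cE in e2.
have d : \int[leb2 R]_(p in T) dot (G p) (wave_grad p) = \int[leb2 R]_(p in T) dot (wave_grad p) (G p).
  by apply: eq_Rintegral => p _; rewrite dotC.
have m : \int[leb2 R]_(p in T) (u p * wave_sum p) = \int[leb2 R]_(p in T) (wave_sum p * u p).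
  by apply: eq_Rintegral => p _; rewrite mulrC.
by rewrite -/T d m -e2 in e1; move: e1 => /addrI.
Qed.

Lemma wave_bd_int : theta != 0 ->
  bd_int A B C wave_sum = 3 * a * K * (cos theta + 2 * sin theta / theta).
Proof.
move=> t0; rewrite bd_intE//.
have wE (x : R) : wave (1 - x) = wave x.
  rewrite /wave (_ : theta * (2 * (1 - x) - 1) = - (theta * (2 * x - 1))) ?cosN//; ring.
have w0 : wave 0 = K * cos theta by rewrite /wave mulr0 sub0r mulrN1 cosN.
have I : \int[leb1 R]_(t in `[0, 1]) (K * cos theta + 2 * wave t) = K * (cos theta + 2 * sin theta / theta).
  have ck : continuous (fun t => K * cos theta + 2 * wave t).
    by move=> t; apply: cvgD; [exact: cvg_cst|apply: cvgM; [exact: cvg_cst|exact: cwave]].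
  (* Since [ddwave] is - 4 theta^2 times [wave], an antiderivative of [wave] is - [dwave] / (4
     theta^2). *)
  have dk (t : R) : is_derive t (1 : R)
      ((K * cos theta) \*: id - (2 * theta ^+ 2)^-1 \*: dwave) (K * cos theta + 2 * wave t).
    have dd := is_derive_dwave t.
    apply: is_derive_eq; rewrite /ddwave /GRing.scale/=; field; exact: t0.
  rewrite (Rintegral01_FTC ck dk).
  rewrite -[LHS]/((K * cos theta) * 1 - (2 * theta ^+ 2)^-1 * dwave 1 -
    ((K * cos theta) * 0 - (2 * theta ^+ 2)^-1 * dwave 0)).
  rewrite /dwave (_ : theta * (2 * 1 - 1) = theta); last by ring.
  rewrite (_ : theta * (2 * 0 - 1) = - theta); last by ring.
  by rewrite sinN; field; exact: t0.
have sAB : side_mean A B wave_sum = K * (cos theta + 2 * sin theta / theta).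
  rewrite -I; apply: eq_Rintegral => t _; rewrite /on_side /wave_sum.
  by have [-> -> ->] := lam_on_side_AB t; rewrite wE w0; ring.
have sBC : side_mean B C wave_sum = K * (cos theta + 2 * sin theta / theta).
  rewrite -I; apply: eq_Rintegral => t _; rewrite /on_side /wave_sum.
  by have [-> -> ->] := lam_on_side_BC t; rewrite wE w0; ring.
have sCA : side_mean C A wave_sum = K * (cos theta + 2 * sin theta / theta).
  rewrite -I; apply: eq_Rintegral => t _; rewrite /on_side /wave_sum.
  by have [-> -> ->] := lam_on_side_CA t; rewrite wE w0; ring.
by rewrite sAB sBC sCA -/a; ring.
Qed.

End ExplicitSolution.

(** * Fields tangential to the boundary *)

Section Cutoff.
Variable R : realType.
Implicit Types x h : R.

(** The truncated square is C^1 with Lipschitz derivative. Splines built from it are smooth enough,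
    as [test_fun] asks for C^1 only. *)
Definition pos2 x : R := Num.max x 0 ^+ 2.

Lemma pos2_first_order x h : `|pos2 (x + h) - pos2 x - 2 * Num.max x 0 * h| <= h ^+ 2.
Proof.
rewrite /pos2 ler_norml; case: (leP x 0) => x0; case: (leP (x + h) 0) => xh0; apply/andP; split; nra.
Qed.

Lemma is_derive_pos2 x : is_derive x (1 : R) pos2 (2 * Num.max x 0).
Proof.
suff H : (fun h : R => h^-1 *: ((pos2 \o shift x) (h *: 1) - pos2 x)) @ 0^' --> (2 * Num.max x 0 : R).
  by apply: DeriveDef; [apply/cvg_ex; exists (2 * Num.max x 0)|exact: cvg_lim H].
apply/cvgrPdist_le => e e0; near=> h.
have h0 : h != 0 by near: h; exact: nbhs_dnbhs_neq.
have he : `|h| < e by near: h; apply: dnbhs0_lt.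
have H := pos2_first_order x h; rewrite distrC /= [_%:A]mulr1 [h + x]addrC.
have -> : h^-1 *: (pos2 (x + h) - pos2 x) - 2 * Num.max x 0 =
    h^-1 * (pos2 (x + h) - pos2 x - 2 * Num.max x 0 * h).
  by rewrite /GRing.scale/=; field; exact: h0.
rewrite normrM normfV ler_pdivrMl ?normr_gt0//; apply: le_trans H _.
by rewrite -real_normK ?num_real// expr2 ler_wpM2l// ltW.
Unshelve. all: by end_near. Qed.

(* A quadratic spline: 0 on ]-oo, 1] and 1 on [2, +oo[. *)
Definition cutoff x : R := 2 * pos2 (x - 1) - 4 * pos2 (x - 3 / 2) + 2 * pos2 (x - 2).
Definition dcutoff x : R :=
  4 * Num.max (x - 1) 0 - 8 * Num.max (x - 3 / 2) 0 + 4 * Num.max (x - 2) 0.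

Lemma is_derive_cutoff x : is_derive x (1 : R) cutoff (dcutoff x).
Proof.
have sh (c y : R) : is_derive y (1 : R) (fun y => pos2 (y - c)) (2 * Num.max (y - c) 0).
  have ds : is_derive y (1 : R) (fun y => y - c) 1.
    apply: (is_derive_eq (is_deriveB (is_derive_id y (1 : R)) (is_derive_cst c y (1 : R)))).
    by rewrite subr0.
  have := is_derive1_comp (f := pos2) (g := fun y => y - c) (is_derive_pos2 _) ds.
  by rewrite mulr1.
apply: (is_derive_eq (is_deriveD (is_deriveB (is_deriveZ 2 (sh 1 x)) (is_deriveZ 4 (sh (3 / 2) x)))
  (is_deriveZ 2 (sh 2 x)))).
by rewrite /dcutoff /GRing.scale/=; ring.
Qed.

Lemma continuous_dcutoff : continuous dcutoff.
Proof.
have cm (c : R) : continuous (fun y : R => Num.max (y - c) 0).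
  move=> y; have c1 : {for y, continuous (fun y : R => y - c)}.
    by apply: cvgB; [exact: cvg_id|exact: cvg_cst].
  have c2 : {for y, continuous (fun y : R => 0 : R)} by exact: cvg_cst.
  exact: (@continuous_max R R _ _ y c1 c2).
move=> x; apply: cvgD; [apply: cvgB|]; (apply: cvgM; [exact: cvg_cst|exact: cm]).
Qed.

Lemma cutoff_le1 x : x <= 1 -> cutoff x = 0.
Proof. by move=> x1; rewrite /cutoff /pos2 !max_r; lra. Qed.

Lemma cutoff_ge2 x : 2 <= x -> cutoff x = 1 /\ dcutoff x = 0.
Proof. by move=> x2; rewrite /cutoff /dcutoff /pos2 !max_l; [split; lra|lra..]. Qed.

Lemma cutoff_bound x : `|cutoff x| <= 1.
Proof.
have [x1|x1] := leP x 1; first by rewrite cutoff_le1// normr0.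
have [x2|x2] := leP 2 x; first by rewrite (cutoff_ge2 x2).1 normr1.
rewrite /cutoff /pos2 (max_r (_ : x - 2 <= 0)); last by lra.
rewrite (max_l (_ : 0 <= x - 1)); last by lra.
by rewrite ler_norml; case: (leP (x - 3 / 2) 0) => ?; apply/andP; split; nra.
Qed.

(** The derivative lives on [1, 2] and is at most 2 there. After rescaling, k |dcutoff (k l)| <= 4 /
    l uniformly in k, which is what a normal component of order l absorbs. *)
Lemma dcutoff_bound x : 0 < x -> `|dcutoff x| * x <= 4.
Proof.
move=> x0; have [x1|x1] := leP x 1.
  by rewrite /dcutoff !max_r ?mulr0 ?subrr ?addr0 ?normr0 ?mul0r; lra.
have [x2|x2] := leP 2 x; first by rewrite (cutoff_ge2 x2).2 normr0 mul0r.
have : `|dcutoff x| <= 2.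
  rewrite /dcutoff (max_r (_ : x - 2 <= 0)); last by lra.
  rewrite (max_l (_ : 0 <= x - 1)); last by lra.
  by rewrite ler_norml; case: (leP (x - 3 / 2) 0) => ?; apply/andP; split; lra.
have := normr_ge0 (dcutoff x); nra.
Qed.

End Cutoff.

(** * Integration by parts against tangential fields *)

Section TangentialFields.
Variables (R : realType) (A B C : R * R).
Hypothesis det0 : tdet A B C != 0.
Let T := triangle A B C.
Let mT := measurable_triangle det0.
Let gA := gradA A B C.
Let gB := gradB A B C.
Let gC := gradC A B C.
Let lA := lamA A B C.
Let lB := lamB A B C.
Let lC := lamC A B C.
Implicit Types (p : R * R) (k : R).

Definition etaX (l : R * R -> R) k p : R := cutoff (k * l p).
Definition detaX (l : R * R -> R) k p : R := dcutoff (k * l p) * k.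

Lemma has_grad_etaX (l : R * R -> R) (gl : R * R) k : has_grad l (fun=> gl) ->
  has_grad (etaX l k) (fun p => detaX l k p *: gl).
Proof.
move=> hl; have := has_grad_comp (@is_derive_cutoff R) (@continuous_dcutoff R) (has_grad_scale k hl).
by congr has_grad; apply/funext => p; rewrite scalerA.
Qed.

Definition chi k p : R := etaX lA k p * etaX lB k p * etaX lC k p.
Definition gchi k p : R * R :=
  (etaX lA k p * etaX lB k p) *: (detaX lC k p *: gC) +
  etaX lC k p *: (etaX lA k p *: (detaX lB k p *: gB) + etaX lB k p *: (detaX lA k p *: gA)).

Lemma has_grad_chi k : has_grad (chi k) (gchi k).
Proof.
apply: has_grad_mul; first apply: has_grad_mul.
- exact: has_grad_etaX (has_grad_lamA A B C).
- exact: has_grad_etaX (has_grad_lamB A B C).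
- exact: has_grad_etaX (has_grad_lamC A B C).
Qed.

Lemma chi_test k f gf : 0 < k -> has_grad f gf -> test_fun T (fun p => chi k p * f p).
Proof.
move=> k0 hf; split; first exact: has_grad_C1W (has_grad_mul (has_grad_chi k) hf).
have k10 : 0 < k^-1 by rewrite invr_gt0.
pose K : set (R * R) := [set p | k^-1 <= lA p] `&` ([set p | k^-1 <= lB p] `&` [set p | k^-1 <= lC p]).
have KT : K `<=` T.
  by move=> p [/= pA [pB pC]]; apply/(triangle_lam det0); split; apply: lt_le_trans k10 _.
exists K; split => //.
  pose Q : set (R * R) := `[0, 1]%classic `*` `[0, 1]%classic.
  pose L := affine2 A.1 A.2 (B.1 - A.1) (B.2 - A.2) (C.1 - A.1) (C.2 - A.2).
  (* [K] is a slightly shrunken closed triangle; compactness is inherited from the affine image of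
     the unit square. *)
  apply: (@subclosed_compact _ K (L @` Q)).
  - have cl (l : R * R -> R) : continuous l -> closed [set p | k^-1 <= l p].
      move=> cl; apply: (@closed_comp _ _ l [set x | k^-1 <= x]); last exact: closed_ge.
      by move=> p _; exact: cl.
    apply: closedI; [|apply: closedI]; apply: cl.
    + exact: has_grad_continuous (has_grad_lamA A B C).
    + exact: has_grad_continuous (has_grad_lamB A B C).
    + exact: has_grad_continuous (has_grad_lamC A B C).
  - apply: continuous_compact; first by apply: continuous_subspaceT; exact: continuous_param.
    by apply: compact_setX; exact: segment_compact.
  - move=> p Kp; exists (lB p, lC p); last exact: param_lam.
    have := KT p Kp => /(triangle_lam det0)[h1 h2 h3].
    by move: h1; rewrite /lamA -/lB -/lC => h1; split; rewrite /= in_itv/=; rewrite -/lB -/lC in h2 h3; lra.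
move=> p nK; have z (l : R * R -> R) : ~ (k^-1 <= l p) -> etaX l k p = 0.
  move=> /negP; rewrite -ltNge => lp; rewrite /etaX cutoff_le1//.
  by rewrite mulrC -ler_pdivlMr// mul1r ltW.
rewrite /chi; have [hA|/z->] := pselect (k^-1 <= lA p); last by rewrite !mul0r.
have [hB|/z->] := pselect (k^-1 <= lB p); last by rewrite mulr0 !mul0r.
have [hC|/z->] := pselect (k^-1 <= lC p); last by rewrite mulr0 mul0r.
by exfalso; apply: nK.
Qed.

(* The gradient of the cut-off is of order k where [k * lX] is of order 1;
   the bounds on [dot gX F] compensate it, so dominated convergence applies.
   This avoids both traces and density of smooth functions in H^1. *)
Lemma tangential_field w G (F1 F2 : R * R -> R) (g1 g2 : R * R -> R * R) (M : R) :
  H1 T w G -> has_grad F1 g1 -> has_grad F2 g2 ->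
  (forall p, T p -> [/\ `|dot gA (F1 p, F2 p)| <= M * lA p, `|dot gB (F1 p, F2 p)| <= M * lB p &
     `|dot gC (F1 p, F2 p)| <= M * lC p]) ->
  \int[leb2 R]_(p in T) (w p * ((g1 p).1 + (g2 p).2)) =
    - \int[leb2 R]_(p in T) dot (G p) (F1 p, F2 p).
Proof.
move=> [Lw LG1 LG2 weak] h1 h2 tang.
have finT := triangle_finite det0.
have cF1 := has_grad_continuous h1; have cF2 := has_grad_continuous h2.
have cdiv : continuous (fun p => (g1 p).1 + (g2 p).2).
  by move=> p; apply: cvgD; [exact: (continuous_coord1 h1.1)|exact: (continuous_coord2 h2.1)].
pose k n : R := n.+1%:R.
have k0 n : 0 < k n by [].
pose dchi n p : R := dot (gchi (k n) p) (F1 p, F2 p).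
have cchi n : continuous (chi (k n)) := has_grad_continuous (has_grad_chi (k n)).
have cdchi n : continuous (dchi n).
  move=> p; apply: cvgD; (apply: cvgM; [|by [exact: cF1|exact: cF2]]).
    exact: (continuous_coord1 (has_grad_chi (k n)).1).
  exact: (continuous_coord2 (has_grad_chi (k n)).1).
have LX (h : R * R -> R) : continuous h -> L2 (leb2 R) T h by exact: triangle_L2.
(* The weak derivative in each direction is tested with the cut-off times the corresponding
   component of the field. *)
have idn n : \int[leb2 R]_(p in T) (w p * (chi (k n) p * ((g1 p).1 + (g2 p).2) + dchi n p)) =
    - \int[leb2 R]_(p in T) (chi (k n) p * dot (G p) (F1 p, F2 p)).
  have [e1 _] := weak _ (chi_test (k0 n) h1); have [_ e2] := weak _ (chi_test (k0 n) h2).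
  have [C1' G1] := has_grad_C1 (has_grad_mul (has_grad_chi (k n)) h1).
  have [C2' G2] := has_grad_C1 (has_grad_mul (has_grad_chi (k n)) h2).
  rewrite G1 in e1; rewrite G2 in e2.
  have c1 := LX _ (continuous_coord1 (has_grad_mul (has_grad_chi (k n)) h1).1).
  have c2 := LX _ (continuous_coord2 (has_grad_mul (has_grad_chi (k n)) h2).1).
  have d1 := LX _ (has_grad_continuous (has_grad_mul (has_grad_chi (k n)) h1)).
  have d2 := LX _ (has_grad_continuous (has_grad_mul (has_grad_chi (k n)) h2)).
  have E1 := RintegralD mT (L2_mul mT Lw c1) (L2_mul mT Lw c2).
  have E2 := RintegralD mT (L2_mul mT LG1 d1) (L2_mul mT LG2 d2).
  rewrite e1 e2 -opprD -E2 in E1.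
  transitivity (\int[leb2 R]_(p in T) (w p * (chi (k n) p *: g1 p + F1 p *: gchi (k n) p).1 +
     w p * (chi (k n) p *: g2 p + F2 p *: gchi (k n) p).2)).
    by apply: eq_Rintegral => p _; rewrite /dchi /dot/= /GRing.scale/=; ring.
  rewrite E1; congr (- _); apply: eq_Rintegral => p _; rewrite /dot/=; ring.
have [Mdiv HMdiv] := triangle_bounded det0 cdiv.
have wint := L2_integrable mT finT Lw.
have Gint : (leb2 R).-integrable (T : set (RR R)) (EFin \o (fun p => dot (G p) (F1 p, F2 p))).
  exact: (integrable_add mT (L2_mul mT LG1 (LX _ cF1)) (L2_mul mT LG2 (LX _ cF2))).
have chi1 n p : `|chi (k n) p| <= 1.
  rewrite /chi !normrM; have h l := cutoff_bound (k n * l p).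
  by rewrite !mulr_ile1// ?mulr_ge0//; exact: h.
have near_lam (l : R * R -> R) p : 0 < l p -> \forall n \near \oo, 2 <= k n * l p.
  move=> lp; exists (Num.truncn (2 / l p)) => //= n /= Nn.
  rewrite -ler_pdivrMr//; apply: (@le_trans _ _ ((Num.truncn (2 / l p)).+1%:R)).
    by rewrite ltW// truncnS_gt// ltW// divr_gt0.
  by rewrite ler_nat.
(* At a fixed interior point all three scaled coordinates eventually exceed 2, so the integrands are
   eventually constant pointwise. *)
have eventually p : T p -> \forall n \near \oo, chi (k n) p = 1 /\ dchi n p = 0.
  move=> /(triangle_lam det0)[pA pB pC].
  near=> n.
  have [a1 a2] : cutoff (k n * lA p) = 1 /\ dcutoff (k n * lA p) = 0.
    by apply: cutoff_ge2; near: n; exact: near_lam.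
  have [b1 b2] : cutoff (k n * lB p) = 1 /\ dcutoff (k n * lB p) = 0.
    by apply: cutoff_ge2; near: n; exact: near_lam.
  have [c1 c2] : cutoff (k n * lC p) = 1 /\ dcutoff (k n * lC p) = 0.
    by apply: cutoff_ge2; near: n; exact: near_lam.
  rewrite /dchi /gchi !(dotDl, dotZl) /chi /etaX /detaX a1 a2 b1 b2 c1 c2.
  by rewrite !(mul0r, mulr0, addr0, mulr1).
(* Each of the three factors of the cut-off contributes 4 |M| by [dcutoff_bound], independently of
   n. *)
have dchi_bound n p : T p -> `|dchi n p| <= 12 * `|M|.
  move=> Tp; have [tA tB tC] := tang p Tp.
  have [pA pB pC] := (triangle_lam det0 p).1 Tp.
  have key (l : R * R -> R) (gl : R * R) : 0 < l p -> `|dot gl (F1 p, F2 p)| <= M * l p ->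
      `|detaX l (k n) p * dot gl (F1 p, F2 p)| <= 4 * `|M|.
    move=> lp tl; rewrite /detaX normrM.
    have db := dcutoff_bound (mulr_gt0 (k0 n) lp).
    have tl' : `|dot gl (F1 p, F2 p)| <= `|M| * l p.
      by apply: (le_trans tl); rewrite ler_wpM2r ?ler_norm// ltW.
    apply: (le_trans (ler_wpM2l (normr_ge0 _) tl')).
    rewrite normrM (gtr0_norm (k0 n)) mulrC.
    have -> : `|M| * l p * (`|dcutoff (k n * l p)| * k n) = `|dcutoff (k n * l p)| * (k n * l p) * `|M|.
      by ring.
    by rewrite ler_wpM2r.
  have eb l : `|etaX l (k n) p| <= 1 by exact: cutoff_bound.
  have kA := key _ _ pA tA; have kB := key _ _ pB tB; have kC := key _ _ pC tC.
  have -> : dchi n p = etaX lA (k n) p * etaX lB (k n) p * (detaX lC (k n) p * dot gC (F1 p, F2 p)) +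
     (etaX lC (k n) p * etaX lA (k n) p * (detaX lB (k n) p * dot gB (F1 p, F2 p)) +
      etaX lC (k n) p * etaX lB (k n) p * (detaX lA (k n) p * dot gA (F1 p, F2 p))).
    by rewrite /dchi /gchi !(dotDl, dotZl); ring.
  have pr (x y z : R) : `|x| <= 1 -> `|y| <= 1 -> `|z| <= 4 * `|M| -> `|x * y * z| <= 4 * `|M|.
    move=> x1 y1 zM; rewrite !normrM; apply: le_trans zM; rewrite ler_piMl//.
    exact: mulr_ile1.
  rewrite (_ : 12 * `|M| = 4 * `|M| + (4 * `|M| + 4 * `|M|)); last by ring.
  rewrite (le_trans (ler_normD _ _))// lerD//; first exact: pr.
  by rewrite (le_trans (ler_normD _ _))// lerD//; exact: pr.
have lim1 : \int[leb2 R]_(p in T) (w p * (chi (k n) p * ((g1 p).1 + (g2 p).2) + dchi n p)) @[n --> \oo] -->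
    \int[leb2 R]_(p in T) (w p * ((g1 p).1 + (g2 p).2)).
  apply: (cvg_Rintegral_dominated mT (g := fun p => (`|Mdiv| + 12 * `|M|) * `|w p|)).
  - move=> n; apply: measurable_funM; first exact: Lw.1.
    apply: measurable_funTS; apply: continuous_measurable_plane => p.
    apply: cvgD; last exact: cdchi.
    by apply: cvgM; [exact: cchi|exact: cdiv].
  - by apply: measurable_funM; [exact: Lw.1|exact: (LX _ cdiv).1].
  - move=> p Tp; apply: cvg_near_cst; have := eventually p Tp.
    by apply: filterS => n [-> ->]; rewrite mul1r addr0.
  - by apply: integrable_scale => //; exact: integrable_norm.
  - move=> n p Tp; rewrite normrM mulrC ler_wpM2r//.
    rewrite (le_trans (ler_normD _ _))// lerD ?dchi_bound// normrM.
    rewrite -[leRHS]mul1r ler_pM//.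
    by rewrite (le_trans (HMdiv p Tp))// ler_norm.
have lim2 : (- (\int[leb2 R]_(p in T) (chi (k n) p * dot (G p) (F1 p, F2 p)))) @[n --> \oo] -->
    - (\int[leb2 R]_(p in T) dot (G p) (F1 p, F2 p)).
  apply: cvgN; apply: (cvg_Rintegral_dominated mT (g := fun p => `|dot (G p) (F1 p, F2 p)|)).
  - move=> n; apply: measurable_funM; first exact: (LX _ (cchi n)).1.
    exact: (integrable_measurable Gint).
  - exact: (integrable_measurable Gint).
  - move=> p Tp; apply: cvg_near_cst; have := eventually p Tp.
    by apply: filterS => n [-> _]; rewrite mul1r.
  - exact: integrable_norm.
  - by move=> n p Tp; rewrite normrM ler_piMl.
apply: (cvg_unique (@Rhausdorff R) lim1).
by apply: (cvg_trans _ lim2); apply: near_eq_cvg; apply: nearW => n; rewrite idn.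
Unshelve. all: by end_near. Qed.

End TangentialFields.

(** * Functions with zero gradient *)

Section PlaneMoments.
Variable R : realType.
Let I : set (measurableTypeR R) := `[0, 1]%classic.
Let mI : measurable I. Proof. exact: measurable_itv. Qed.

(** One variable at a time: each [H k], the k-th moment of the slices in y, has zero moments in x
    and so vanishes almost everywhere. Hence almost every slice has zero moments and vanishes almost
    everywhere, and Tonelli concludes. *)
Lemma plane_moments0 (V : RR R -> R) :
  (leb2 R).-integrable setT (EFin \o V) ->
  (forall z, ~ (I `*` I) z -> V z = 0) ->
  (forall j k, \int[leb2 R]_z (V z * (z.1 ^+ j * z.2 ^+ k)) = 0) ->
  \int[leb2 R]_z `|V z| = 0.
Proof.
move=> iV V0 mom.
pose f j k z := V z * (z.1 ^+ j * z.2 ^+ k).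
have mon j k : measurable_fun [set: RR R] (fun z : RR R => z.1 ^+ j * z.2 ^+ k).
  apply: measurable_funM; apply: measurable_funX; [exact: measurable_fst|exact: measurable_snd].
have i_f j k : (leb2 R).-integrable setT (EFin \o f j k).
  apply: (integrable_dominated measurableT (g := fun z => `|V z|)).
  - by apply: measurable_funM; [exact: integrable_measurable iV|exact: mon].
  - exact: integrable_norm.
  - move=> z _; rewrite /f; have [[z1 z2]|nz] := pselect ((I `*` I) z); last by rewrite V0// mul0r.
    rewrite normrM ler_piMr// normrM; move: z1 z2; rewrite /I/= !in_itv/= => /andP[? ?] /andP[? ?].
    by rewrite mulr_ile1// ger0_norm ?exprn_ge0 ?exprn_ile1.
pose H k x := \int[leb1 R]_y (V (x, y) * y ^+ k).
have iF j k := integrable_fubini_F (i_f j k).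
have aeV := ae_integrable1 iV.
have Iy x k : (leb1 R).-integrable setT (fun y => (V (x, y))%:E) ->
    (leb1 R).-integrable setT (EFin \o (fun y => V (x, y) * y ^+ k)).
  move=> iVx; apply: (integrable_dominated measurableT (g := fun y => `|V (x, y)|)).
  - apply: measurable_funM; first exact: (integrable_measurable (f := fun y => V (x, y)) iVx).
    by apply: measurable_funX.
  - exact: (integrable_norm (f := fun y => V (x, y)) iVx).
  - move=> y _; have [[z1 z2]|nz] := pselect ((I `*` I) (x, y)); last by rewrite V0// mul0r.
    rewrite normrM ler_piMr//; move: z2; rewrite /I/= in_itv/= => /andP[? ?].
    by rewrite ger0_norm ?exprn_ge0 ?exprn_ile1.
have HE k x : (leb1 R).-integrable setT (fun y => (V (x, y))%:E) ->
    fubini_F (leb1 R) (EFin \o f 0%N k) x = (H k x)%:E.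
  move=> iVx; rewrite /H /Rintegral fineK; last by apply: integrable_fin_num => //; exact: Iy.
  by apply: eq_integral => y _; rewrite /f /= expr0 mul1r.
have HF k : fine \o fubini_F (leb1 R) (EFin \o f 0%N k) = H k.
  apply/funext => x; rewrite /H /Rintegral /=; congr fine.
  by apply: eq_integral => y _; rewrite /f /= expr0 mul1r.
have mH k : measurable_fun setT (H k).
  rewrite -HF; apply: measurableT_comp; first exact: fine_measurable.
  exact: measurable_int (iF 0%N k).
have iH k : (leb1 R).-integrable setT (EFin \o H k).
  apply: (le_integrable measurableT _ _ (iF 0%N k)); first exact/measurable_EFinP.
  by move=> x _ /=; rewrite -HF /=; case: (fubini_F _ _ x) => [r||]//=; rewrite normr0 leey.
have Hoff k x : ~ I x -> H k x = 0.
  move=> nx; rewrite /H (@eq_Rintegral _ _ _ _ _ (fun=> 0)) ?Rintegral_cst ?mul0r// => y _.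
  by rewrite V0 ?mul0r// => -[].
have Hmom k j : \int[leb1 R]_(x in I) (H k x * x ^+ j) = 0.
  rewrite -(mom j k) /Rintegral -(integral12_prod_meas1 (i_f j k)).
  congr fine; rewrite integral_mkcond; apply: ae_eq_integral => //.
  - apply/(measurable_restrictT _ mI); apply: measurable_funTS; apply/measurable_EFinP.
    by apply: measurable_funM => //; exact: measurable_funX.
  - exact: measurable_int (iF j k).
  - apply: filterS aeV => x iVx _; rewrite patchE; case: ifPn => [_|].
      rewrite EFinM muleC -HE// /fubini_F -integralZl//; last first.
        by have := Iy x k iVx; apply: eq_integrable => // y _; rewrite /f /= expr0 mul1r.
      by apply: eq_integral => y _; rewrite /f /= expr0 -EFinM; congr _%:E; ring.
    rewrite notin_setE => nIx; apply/esym/integral0_eq => y _.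
    by rewrite /= /f V0 ?mul0r// => -[].
(* Countably many k share one null set, so that for almost every x all moments of the slice vanish
   together. *)
have H0 : {ae leb1 R, forall x, forall k, I x -> H k x = 0}.
  apply: ae_foralln => k; apply: moments0_ae0 => //.
  exact: integrableS (iH k).
have V0ae : ae_eq (leb1 R) setT (fun x => \int[leb1 R]_y `|(V (x, y))%:E|)%E (cst 0%E).
  apply: filterS2 aeV H0 => x iVx H0x _ /=.
  have [Ix|nIx] := pselect (I x); last first.
    by apply: integral0_eq => y _; rewrite /= V0 ?normr0// => -[].
  apply: (ae_eq_integral_abs _ measurableT (f := fun y => (V (x, y))%:E) _).2.
    exact: measurable_int iVx.
  have : {ae leb1 R, forall y, I y -> V (x, y) = 0}.
    apply: moments0_ae0; first exact: integrableS iVx.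
    move=> k; rewrite -[RHS](H0x k Ix) /H Rintegral_mkcond; apply: eq_Rintegral => y _.
    rewrite patchE; case: ifPn => //; rewrite notin_setE => nIy.
    have nI : ~ (I `*` I) (x, y) by case.
    by rewrite V0 ?mul0r.
  apply: filterS => y h _ /=; have [/h->//|nIy] := pselect (I y).
  by rewrite V0// => -[].
rewrite /Rintegral (_ : (\int[leb2 R]_z (`|V z|)%:E = 0)%E)//.
rewrite (fubini_tonelli1 (fun z => (`|V z|)%:E))//; last first.
  apply/measurable_EFinP; apply: measurableT_comp => //; exact: integrable_measurable iV.
rewrite (ae_eq_integral (cst 0%E)) ?integral0//.
apply: measurable_fun_fubini_tonelli_F => //.
by apply/measurable_EFinP; apply: measurableT_comp => //; exact: integrable_measurable iV.
Qed.

End PlaneMoments.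

(** * Moment relations for a function with zero gradient *)

Section ZeroGradient.
Variables (R : realType) (A B C : R * R).
Hypothesis det0 : tdet A B C != 0.
Let T := triangle A B C.
Let mT := measurable_triangle det0.
Let finT := triangle_finite det0.
Let gA := gradA A B C.
Let gB := gradB A B C.
Let gC := gradC A B C.
Let lA := lamA A B C.
Let lB := lamB A B C.
Let lC := lamC A B C.
Implicit Types (p : R * R) (w : R * R -> R) (G : R * R -> R * R).

Lemma has_grad_pow (l : R * R -> R) (gl : R * R) n : has_grad l (fun=> gl) ->
  has_grad (fun p => l p ^+ n) (fun p => (n%:R * l p ^+ n.-1) *: gl).
Proof.
move=> hl; apply: (has_grad_comp (h := fun x => x ^+ n) (dh := fun x => n%:R * x ^+ n.-1) _ _ hl).
  move=> x; apply: DeriveDef; first exact: exprn_derivable.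
  by rewrite exp_derive /GRing.scale/= mulr1.
by move=> x; apply: cvgM; [exact: cvg_cst|exact: exprn_continuous].
Qed.

Definition monomial i j k p : R := lA p ^+ i * lB p ^+ j * lC p ^+ k.

Lemma continuous_monomial i j k : continuous (monomial i j k).
Proof.
move=> p; apply: cvgM; first apply: cvgM.
- exact: (has_grad_continuous (has_grad_pow i (has_grad_lamA A B C))).
- exact: (has_grad_continuous (has_grad_pow j (has_grad_lamB A B C))).
- exact: (has_grad_continuous (has_grad_pow k (has_grad_lamC A B C))).
Qed.

Definition moment w i j k : R := \int[leb2 R]_(p in T) (w p * monomial i j k p).

Definition grad_monomial i j k p : R * R :=
  (lA p ^+ i * lB p ^+ j) *: ((k%:R * lC p ^+ k.-1) *: gC) +
  lC p ^+ k *: (lA p ^+ i *: ((j%:R * lB p ^+ j.-1) *: gB) + lB p ^+ j *: ((i%:R * lA p ^+ i.-1) *: gA)).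

Lemma has_grad_monomial i j k : has_grad (monomial i j k) (grad_monomial i j k).
Proof.
apply: has_grad_mul; first apply: has_grad_mul.
- exact: has_grad_pow (has_grad_lamA A B C).
- exact: has_grad_pow (has_grad_lamB A B C).
- exact: has_grad_pow (has_grad_lamC A B C).
Qed.

Lemma lam_bounds p : T p -> [/\ 0 < lA p < 1, 0 < lB p < 1 & 0 < lC p < 1].
Proof.
have E : lA p = 1 - lB p - lC p by [].
by move=> /(triangle_lam det0)[]; rewrite -/lA -/lB -/lC => h1 h2 h3; split; lra.
Qed.

Lemma edge_dots : [/\ [/\ dot gA (B - A) = -1, dot gB (B - A) = 1 & dot gC (B - A) = 0],
  dot gA (C - A) = -1, dot gB (C - A) = 0 & dot gC (C - A) = 1].
Proof.
by split; [split| | |]; rewrite /gA /gB /gC /gradA /gradB /gradC /tdet /dot/=; field; exact: det0.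
Qed.

(** A factor [lX] provides the linear vanishing at the side opposite X that [tangential_field]
    requires. *)
Lemma monomial_le1 i j k p : T p -> [/\ `|monomial i.+1 j k p| <= lA p,
  `|monomial i j.+1 k p| <= lB p & `|monomial i j k.+1 p| <= lC p].
Proof.
move=> /lam_bounds[/andP[a0 a1] /andP[b0 b1] /andP[c0 c1]].
have ai n : 0 <= lA p ^+ n <= 1 by rewrite exprn_ge0 ?exprn_ile1// ltW.
have bi n : 0 <= lB p ^+ n <= 1 by rewrite exprn_ge0 ?exprn_ile1// ltW.
have ci n : 0 <= lC p ^+ n <= 1 by rewrite exprn_ge0 ?exprn_ile1// ltW.
have m3 (x y z t : R) : 0 <= t -> 0 <= x <= 1 -> 0 <= y <= 1 -> 0 <= z <= 1 -> `|t * (x * y * z)| <= t.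
  move=> t0 /andP[x0 x1] /andP[y0 y1] /andP[z0 z1].
  by rewrite ger0_norm ?mulr_ge0// ler_piMr// !mulr_ile1// ?mulr_ge0.
split; rewrite /monomial exprS.
- rewrite (_ : _ * _ * _ = lA p * (lA p ^+ i * lB p ^+ j * lC p ^+ k)); last by ring.
  by apply: m3 => //; exact: ltW.
- rewrite (_ : _ * _ * _ = lB p * (lA p ^+ i * lB p ^+ j * lC p ^+ k)); last by ring.
  by apply: m3 => //; exact: ltW.
- rewrite (_ : _ * _ * _ = lC p * (lA p ^+ i * lB p ^+ j * lC p ^+ k)); last by ring.
  by apply: m3 => //; exact: ltW.
Qed.

Variables (w : R * R -> R) (G : R * R -> R * R).
Hypothesis wG : H1 T w G.
Hypothesis G0 : \int[leb2 R]_(p in T) dot (G p) (G p) <= 0.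

Lemma null_gradient F1 F2 : continuous F1 -> continuous F2 ->
  \int[leb2 R]_(p in T) dot (G p) (F1 p, F2 p) = 0.
Proof.
move=> c1 c2; have [_ L1 L2 _] := wG.
have E := RintegralD mT L1.2 L2.2.
have sq0 (h : R * R -> R) : 0 <= \int[leb2 R]_(p in T) (h p ^+ 2).
  by apply: Rintegral_ge0 => p _; exact: sqr_ge0.
have E0 : \int[leb2 R]_(p in T) ((G p).1 ^+ 2) + \int[leb2 R]_(p in T) ((G p).2 ^+ 2) <= 0.
  by rewrite -E; apply: le_trans G0; rewrite /dot.
have [e1 e2] : \int[leb2 R]_(p in T) ((G p).1 ^+ 2) = 0 /\ \int[leb2 R]_(p in T) ((G p).2 ^+ 2) = 0.
  have := sq0 (fun p => (G p).1); have := sq0 (fun p => (G p).2); move: E0.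
  move: (\int[leb2 R]_(p in T) ((G p).1 ^+ 2)) (\int[leb2 R]_(p in T) ((G p).2 ^+ 2)) => x y.
  by split; lra.
have key (F g : R * R -> R) : continuous F -> Defs.L2 (leb2 R) T g ->
    \int[leb2 R]_(p in T) (g p ^+ 2) = 0 -> \int[leb2 R]_(p in T) (g p * F p) = 0.
  move=> cF Lg g0.
  (* Applied to a constant sequence, [cvg_Rintegral_mul0] says that a function of zero L^2 norm has
     zero pairings. *)
  have z : (fun=> \int[leb2 R]_(p in T) (g p ^+ 2)) @ \oo --> (0 : R) by rewrite g0; exact: cvg_cst.
  have := cvg_Rintegral_mul0 mT (triangle_L2 det0 cF) (fun _ : nat => Lg) z.
  move=> /(cvg_unique (@Rhausdorff R)) /(_ (cvg_cst _)) H.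
  by rewrite [RHS]H; apply: eq_Rintegral => p _; rewrite mulrC.
rewrite /dot/= (RintegralD mT (L2_mul mT L1 (triangle_L2 det0 c1)) (L2_mul mT L2 (triangle_L2 det0 c2))).
by rewrite (key F1 _ c1 L1 e1) (key F2 _ c2 L2 e2) addr0.
Qed.

Lemma null_edge i j k (e : R * R) :
  (forall p, T p -> [/\ `|dot gA e * monomial i j k p| <= lA p,
     `|dot gB e * monomial i j k p| <= lB p & `|dot gC e * monomial i j k p| <= lC p]) ->
  \int[leb2 R]_(p in T) (w p * dot (grad_monomial i j k p) e) = 0.
Proof.
move=> He; have hm := has_grad_monomial i j k.
have h1 := has_grad_scale e.1 hm; have h2 := has_grad_scale e.2 hm.
have dE v p : dot v (e.1 * monomial i j k p, e.2 * monomial i j k p) = dot v e * monomial i j k p.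
  by rewrite /dot/=; ring.
have := tangential_field det0 (M := 1) wG h1 h2.
rewrite null_gradient ?oppr0; [|exact: has_grad_continuous h1|exact: has_grad_continuous h2].
move=> H; rewrite -[RHS]H.
  by apply: eq_Rintegral => p _; rewrite /dot/= /GRing.scale/=; ring.
by move=> p Tp; rewrite !dE !mul1r; exact: He.
Qed.

Let iw i j k : (leb2 R).-integrable (T : set (RR R)) (EFin \o (fun p => w p * monomial i j k p)).
Proof. by have [Lw _ _ _] := wG; apply: L2_mul => //; apply: triangle_L2 => //; exact: continuous_monomial. Qed.

(* The divergence of [monomial i.+1 j.+1 k] times the edge vector B - A is a
   combination of two monomials. *)
Lemma moment_edgeB i j k : j.+1%:R * moment w i.+1 j k = i.+1%:R * moment w i j.+1 k.
Proof.
have [[eA eB eC] _ _ _] := edge_dots.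
have H : \int[leb2 R]_(p in T) (j.+1%:R * (w p * monomial i.+1 j k p) - i.+1%:R * (w p * monomial i j.+1 k p)) = 0.
  rewrite -[RHS](@null_edge i.+1 j.+1 k (B - A)).
    apply: eq_Rintegral => p _; rewrite /grad_monomial !(dotDl, dotZl) eA eB eC /monomial !exprS/=; ring.
  (* The extra factors lA and lB take care of the sides BC and CA; the third side AB is parallel to
     the field. *)
  move=> p Tp; rewrite eA eB eC; have [h1 _ _] := monomial_le1 i j.+1 k Tp; have [_ h2 _] := monomial_le1 i.+1 j k Tp.
  have [_ _ /andP[c0 _]] := lam_bounds Tp.
  by rewrite mulN1r normrN mul1r mul0r normr0; split => //; exact: ltW.
move: H; rewrite (RintegralB mT (integrable_scale mT _ (iw _ _ _)) (integrable_scale mT _ (iw _ _ _))).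
by rewrite !(RintegralZl _ mT (iw _ _ _)) => /eqP; rewrite subr_eq0 => /eqP.
Qed.

Lemma moment_edgeC i j k : k.+1%:R * moment w i.+1 j k = i.+1%:R * moment w i j k.+1.
Proof.
have [_ eA eB eC] := edge_dots.
have H : \int[leb2 R]_(p in T) (k.+1%:R * (w p * monomial i.+1 j k p) - i.+1%:R * (w p * monomial i j k.+1 p)) = 0.
  rewrite -[RHS](@null_edge i.+1 j k.+1 (C - A)).
    apply: eq_Rintegral => p _; rewrite /grad_monomial !(dotDl, dotZl) eA eB eC /monomial !exprS/=; ring.
  move=> p Tp; rewrite eA eB eC.
  have [h1 _ _] := monomial_le1 i j k.+1 Tp; have [_ _ h2] := monomial_le1 i.+1 j k Tp.
  have [_ /andP[c0 _] _] := lam_bounds Tp.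
  by rewrite mulN1r normrN mul1r mul0r normr0; split => //; exact: ltW.
move: H; rewrite (RintegralB mT (integrable_scale mT _ (iw _ _ _)) (integrable_scale mT _ (iw _ _ _))).
by rewrite !(RintegralZl _ mT (iw _ _ _)) => /eqP; rewrite subr_eq0 => /eqP.
Qed.

(** Multiplication by lA + lB + lC = 1. *)
Lemma moment_split i j k : moment w i j k = moment w i.+1 j k + moment w i j.+1 k + moment w i j k.+1.
Proof.
rewrite /moment -(RintegralD mT (iw _ _ _) (iw _ _ _)).
rewrite -(RintegralD mT (integrable_add mT (iw _ _ _) (iw _ _ _)) (iw _ _ _)).
apply: eq_Rintegral => p _; have E : lA p + lB p + lC p = 1 by rewrite /lA /lamA -/lB -/lC; ring.
by rewrite -[LHS]mulr1 -E /monomial !exprS; ring.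
Qed.

Hypothesis w0 : \int[leb2 R]_(p in T) w p = 0.

(** The three moments obtained by raising one exponent are proportional to i + 1, j + 1, k + 1 by
    the edge relations, and they add up to the moment of lower degree, which is 0. As the weights
    are positive, all three vanish. *)
Lemma moments_vanish n i j k : (i + j + k = n)%N -> moment w i j k = 0.
Proof.
elim: n i j k => [|n IH] i j k.
  move=> /eqP; rewrite !addn_eq0 => /andP[/andP[/eqP-> /eqP->] /eqP->].
  by rewrite -[RHS]w0; apply: eq_Rintegral => p _; rewrite /monomial !expr0 !mulr1.
have key i' j' k' : (i' + j' + k' = n)%N -> [/\ moment w i'.+1 j' k' = 0,
    moment w i' j'.+1 k' = 0 & moment w i' j' k'.+1 = 0].
  move=> /IH; rewrite moment_split => S0.
  have eB := moment_edgeB i' j' k'; have eC := moment_edgeC i' j' k'.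
  have i0 : (0 : R) < i'.+1%:R by [].
  have j0 : (0 : R) < j'.+1%:R by [].
  have k0 : (0 : R) < k'.+1%:R by [].
  move: S0 eB eC i0 j0 k0.
  move: (moment w i'.+1 j' k') (moment w i' j'.+1 k') (moment w i' j' k'.+1) => x y z.
  move: (i'.+1%:R : R) (j'.+1%:R : R) (k'.+1%:R : R) => a b c.
  move=> S0 eB eC a0 b0 c0.
  have x0 : x = 0.
    have : (a + b + c) * x = 0 by rewrite !mulrDl eB eC -!mulrDr S0 mulr0.
    by move=> /eqP; rewrite mulf_eq0 => /orP[|/eqP//]; rewrite gt_eqF// !addr_gt0.
  rewrite x0 !mulr0 in eB eC; split => //; apply/eqP.
    by move/esym/eqP : eB; rewrite mulf_eq0 gt_eqF.
  by move/esym/eqP : eC; rewrite mulf_eq0 gt_eqF.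
case: i => [|i] H.
  case: j H => [|j] H.
    case: k H => [|k] H; first by [].
    by case: (key 0%N 0%N k _); first by lia.
  by case: (key 0%N j k _); first by lia.
by case: (key i j k _); first by lia.
Qed.

(** On the reference triangle lB and lC are the Cartesian coordinates, so the moments with i = 0 are
    the plane moments of w extended by 0 to the unit square. *)
Lemma zero_gradient_ae0 : {ae leb2 R, forall p, T p -> w p = 0}.
Proof.
have [Lw _ _ _] := wG.
have iw' := L2_integrable mT finT Lw.
pose L := affine2 A.1 A.2 (B.1 - A.1) (B.2 - A.2) (C.1 - A.1) (C.2 - A.2).
have mref := @measurable_ref_triangle R.
have iL : (leb2 R).-integrable (@ref_triangle R : set (RR R)) (EFin \o (w \o L)).
  have := integrable_affine2 A.1 A.2 det0 mT iw'.
  by rewrite triangle_param.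
pose V := (w \o L) \_ (@ref_triangle R).
have iV : (leb2 R).-integrable setT (EFin \o V).
  by rewrite -restrict_EFin; apply/(integrable_mkcond _ mref).
have V0 : \int[leb2 R]_z `|V z| = 0.
  apply: plane_moments0 => //.
    move=> z nz; rewrite /V patchE; case: ifPn => //; rewrite inE => rz.
    by exfalso; apply: nz; exact: ref_triangle_square.
  move=> j k.
  have := @moments_vanish (j + k) 0 j k erefl; rewrite /moment (triangle_Rintegral det0 (iw 0 j k)).
  move=> /eqP; rewrite mulf_eq0 normr_eq0 (negbTE det0)/= => /eqP H; rewrite -[RHS]H.
  rewrite [RHS]Rintegral_mkcond; apply: eq_Rintegral => z _; rewrite /V !patchE.
  case: ifPn => _; last by rewrite mul0r.
  by rewrite /monomial expr0 mul1r /lB /lC lamB_param// lamC_param.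
have nw : (leb2 R).-integrable (T : set (RR R)) (EFin \o (fun p => `|w p|)) by exact: integrable_norm.
have wz : \int[leb2 R]_(p in T) `|w p| = 0.
  rewrite triangle_Rintegral// [X in _ * X](_ : _ = 0) ?mulr0//.
  rewrite -[RHS]V0 Rintegral_mkcond; apply: eq_Rintegral => z _; rewrite /V !patchE.
  by case: ifPn => //; rewrite normr0.
have := (ae_eq_integral_abs (leb2 R) mT (measurable_int _ iw')).1.
have -> : (\int[leb2 R]_(x in triangle A B C) `|(EFin \o w) x| = 0)%E.
  have fin := integrable_fin_num mT nw.
  by rewrite -[LHS](fineK fin) -[X in X%:E]/(\int[leb2 R]_(p in T) `|w p|) wz.
move=> /(_ erefl); apply: filterS => p h Tp; have := h Tp => /=; exact: EFin_inj.
Qed.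

End ZeroGradient.

(** * Bounds on the second eigenvalue *)

Section Eigenvalues.
Variables (R : realType) (A B C : R * R).
Hypothesis eqT : equilateral A B C.
Let T := triangle A B C.
Let a := Defs.edist A B.
Let det0 := equilateral_det0 eqT.
Let mT := measurable_triangle det0.
Let finT := triangle_finite det0.
Let gA := gradA A B C.
Let gB := gradB A B C.
Let gC := gradC A B C.
Let lA := lamA A B C.
Let lB := lamB A B C.
Let lC := lamC A B C.
Implicit Types (p : R * R).

Lemma H1_sub_cst w G (c : R) : H1 T w G -> H1 T (fun p => w p - c) G.
Proof.
move=> [Lw L1 L2' weak]; have [Lc _ _ weakc] := H1_has_grad det0 (has_grad_cst c).
split=> // [|f tf]; first exact: L2_sub.
have [e1 e2] := weak f tf; have [c1 c2] := weakc f tf.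
have hf := C1_has_grad tf.1.
have z (i : R * R -> R) : - (\int[leb2 R]_(p in T) (0 * f p)) = 0.
  rewrite (@eq_Rintegral _ _ _ _ _ (fun=> 0)) ?Rintegral_cst ?mul0r ?oppr0// => p _.
  by rewrite mul0r.
have sub (k : R * R -> R) : continuous k ->
   \int[leb2 R]_(p in T) ((w p - c) * k p) = \int[leb2 R]_(p in T) (w p * k p) - \int[leb2 R]_(p in T) (c * k p).
  move=> ck; have Lk := triangle_L2 det0 ck.
  rewrite -(RintegralB mT (L2_mul mT Lw Lk) (L2_mul mT Lc Lk)).
  by apply: eq_Rintegral => p _; rewrite mulrBl.
rewrite (sub _ (continuous_coord1 hf.1)) (sub _ (continuous_coord2 hf.1)) e1 e2.
by rewrite c1 c2 /= (z f) !subr0.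
Qed.

(** Testing the equation with w itself gives int |G|^2 = l int w^2 <= 0; subtracting the mean of w
    then leaves a function with zero gradient and zero mean. *)
Lemma nonpos_eigen_cst (l : R) w : l <= 0 -> neumann_eigen T l w ->
  exists c : R, {ae leb2 R, forall p, T p -> w p = c}.
Proof.
move=> l0 [G wG eq]; have [Lw _ _ _] := wG.
have iw := L2_integrable mT finT Lw.
have G0 : \int[leb2 R]_(p in T) dot (G p) (G p) <= 0.
  rewrite (eq _ _ wG) mulr_le0_ge0//; apply: Rintegral_ge0 => p _.
  by rewrite -expr2 sqr_ge0.
pose c := \int[leb2 R]_(p in T) w p / area A B C.
exists c.
have areaE : \int[leb2 R]_(p in T) c = \int[leb2 R]_(p in T) w p.
  rewrite Rintegral_cst//; rewrite -/(area A B C) /c divfK// area_triangle//.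
  by rewrite mulf_neq0// normr_eq0.
have w0 : \int[leb2 R]_(p in T) (w p - c) = 0.
  rewrite RintegralB// ?areaE ?subrr//.
  by apply: triangle_integrable => // p; exact: cvg_cst.
have := zero_gradient_ae0 det0 (H1_sub_cst c wG) G0 w0.
apply: filterS; first exact: (ae_filter_ringOfSetsType (leb2 R)).
by move=> p h Tp; apply/eqP; rewrite -subr_eq0 h.
Qed.

(** Otherwise both eigenfunctions are almost everywhere constants c0 and c1. The combination with
    coefficients c1 and - c0 vanishes, so independence forces c0 = 0, and then the first function
    alone is dependent. *)
Lemma second_eigenvalue_gt0 mu : neumann_eigenvalue T 2 mu -> 0 < mu.
Proof.
move=> [[w [lam [indep eig]]] _]; rewrite ltNge; apply/negP => mu0.
have cst i : exists c : R, {ae leb2 R, forall p, T p -> w i p = c}.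
  have [ei li] := eig i; apply: nonpos_eigen_cst ei; exact: le_trans li mu0.
have [c0 h0] := cst ord0; have [c1 h1] := cst ord_max.
have o1 : lift ord0 ord0 = ord_max :> 'I_2 by apply/val_inj.
have s2 (x : 'I_2 -> R) p : \sum_(i < 2) x i * w i p = x ord0 * w ord0 p + x ord_max * w ord_max p.
  by rewrite big_ord_recl big_ord_recl big_ord0 addr0 o1.
pose x (i : 'I_2) := if i == ord0 then c1 else - c0.
have hx : {ae leb2 R, forall p, T p -> \sum_(i < 2) x i * w i p = 0}.
  apply: filterS2 h0 h1; first exact: (ae_filter_ringOfSetsType (leb2 R)).
  move=> p e0 e1 Tp; rewrite s2 /x/= e0// e1//; ring.
have x0 := indep x hx ord_max; rewrite /x/= in x0.
pose y (i : 'I_2) : R := if i == ord0 then 1 else 0.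
have hy : {ae leb2 R, forall p, T p -> \sum_(i < 2) y i * w i p = 0}.
  apply: filterS h0; first exact: (ae_filter_ringOfSetsType (leb2 R)).
  move=> p e0 Tp; rewrite s2 /y/= e0// mul0r addr0 mul1r.
  by apply/eqP; rewrite -oppr_eq0 x0.
by have := indep y hy ord0; rewrite /y/= => /eqP; rewrite oner_eq0.
Qed.

(** Around a point where h is nonzero there is a box of positive measure inside the exceptional null
    set. *)
Lemma continuous_ae0 (h : R * R -> R) : continuous h ->
  {ae leb2 R, forall p, T p -> h p = 0} -> forall p, T p -> h p = 0.
Proof.
move=> ch [N [mN N0 sub]] p Tp; apply: contrapT => hp.
have oU : open (T `&` h @^-1` [set x | x != 0]).
  apply: openI; first exact: open_triangle.
  apply: open_comp; first by move=> q _; exact: ch.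
  exact: open_neq.
have /nbhs_ballP[e /= e0 He] : nbhs p (T `&` h @^-1` [set x | x != 0]).
  by apply: open_nbhs_nbhs; split => //; split => //; apply/eqP.
have mB (x : R) : measurable (ball x e : set (measurableTypeR R)).
  by apply: open_measurable; apply: ball_open.
have le0 : (leb2 R (ball p.1 e `*` ball p.2 e : set (RR R)) <= leb2 R N)%E.
  apply: le_measure; rewrite ?inE//; first by apply: measurableX; exact: mB.
  by move=> q [q1 q2]; apply: sub => /= H; have [/H + /eqP] := He q (conj q1 q2).
move: le0; rewrite N0 (product_measure1E _ _ (mB p.1) (mB p.2)).
apply/negP; rewrite -ltNge.
have pos (x : R) : (0 < leb1 R (ball x e))%E by rewrite lebesgue_measure_ball ?ltW// lte_fin mulrn_wgt0.
by apply: mule_gt0; exact: pos.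
Qed.

Let omega : R := 2 * pi / 3.
Let fc (x : R) : R := cos (omega * x).
Let dfc (x : R) : R := - omega * sin (omega * x).
Let ddfc (x : R) : R := - omega ^+ 2 * fc x.

Let is_derive_lin (x : R) : is_derive x (1 : R) (fun x => omega * x) omega.
Proof.
by apply: (is_derive_eq (is_deriveZ omega (is_derive_id x (1 : R)))); rewrite /GRing.scale/= mulr1.
Qed.

Let is_derive_fc (x : R) : is_derive x (1 : R) fc (dfc x).
Proof.
apply: (is_derive_eq (is_derive1_comp (f := cos) (g := fun x => omega * x) (is_derive_cos _) (is_derive_lin x))).
by rewrite /dfc; ring.
Qed.

Let is_derive_dfc (x : R) : is_derive x (1 : R) dfc (ddfc x).
Proof.
have ds := is_derive1_comp (f := sin) (g := fun x => omega * x) (is_derive_sin _) (is_derive_lin x).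
apply: (is_derive_eq (is_deriveZ (- omega) ds)).
by rewrite /ddfc /fc /GRing.scale/=; ring.
Qed.

Let cfc : continuous fc := derive_continuous is_derive_fc.
Let cdfc : continuous dfc := derive_continuous is_derive_dfc.
Let cddfc : continuous ddfc.
Proof. by move=> x; apply: cvgM; [exact: cvg_cst|exact: cfc]. Qed.

(** Each [xX] has its gradient parallel to the side opposite X, so its wave has no normal derivative
    there. The shifts 0, 1, -1 bring the other two waves into phase on that side, where their fluxes
    cancel. *)
Let xB p : R := lC p - lA p.
Let xC p : R := lA p - lB p + 1.
Let xA p : R := lB p - lC p - 1.

Let hxB : has_grad xB (fun=> gC - gA).
Proof.
have := has_grad_add (has_grad_lamC A B C) (has_grad_scale (-1) (has_grad_lamA A B C)).
by congr has_grad; apply/funext => p; rewrite ?scaleN1r// /xB mulN1r.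
Qed.

Let hxC : has_grad xC (fun=> gA - gB).
Proof.
have := has_grad_add (has_grad_add (has_grad_lamA A B C) (has_grad_scale (-1) (has_grad_lamB A B C))) (has_grad_cst 1).
by congr has_grad; apply/funext => p; rewrite ?scaleN1r ?addr0// /xC mulN1r.
Qed.

Let hxA : has_grad xA (fun=> gB - gC).
Proof.
have := has_grad_add (has_grad_add (has_grad_lamB A B C) (has_grad_scale (-1) (has_grad_lamC A B C))) (has_grad_cst (-1)).
by congr has_grad; apply/funext => p; rewrite ?scaleN1r ?addr0// /xA mulN1r.
Qed.

(* On each side two of the three phases differ by 3 times the coordinate that
   vanishes there, up to the period 3 of [fc]. *)
Definition lame p : R := fc (xB p) + fc (xC p) + fc (xA p).
Definition lame_grad p : R * R :=
  dfc (xB p) *: (gC - gA) + dfc (xC p) *: (gA - gB) + dfc (xA p) *: (gB - gC).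

Lemma has_grad_lame : has_grad lame lame_grad.
Proof.
apply: has_grad_add; first apply: has_grad_add.
- exact: (has_grad_comp is_derive_fc cdfc hxB).
- exact: (has_grad_comp is_derive_fc cdfc hxC).
- exact: (has_grad_comp is_derive_fc cdfc hxA).
Qed.

(** The factor [3 * curv] is the squared length of the three phase gradients. *)
Definition lame_eigenvalue : R := 3 * curv A B * omega ^+ 2.

Lemma dfc_dist (x y : R) : `|dfc x - dfc y| <= omega ^+ 2 * `|x - y|.
Proof.
have := @mean_value_dist _ dfc ddfc y x 0 (omega ^+ 2) is_derive_dfc.
rewrite mul0r subr0; apply => z _; rewrite subr0 /ddfc normrM normrN (ger0_norm (sqr_ge0 omega)).
by rewrite ler_piMr ?sqr_ge0// /fc cos_max.
Qed.

Lemma dfc_periodic (x : R) : dfc (x - 3) = dfc x.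
Proof.
rewrite /dfc; congr (_ * _).
rewrite -(sinD2pi (omega * (x - 3))); congr sin.
by rewrite /omega -mulr_natr; field.
Qed.

(** This is [tangential_field] for the field [lame_grad], whose divergence is - [lame_eigenvalue]
    times [lame]. Its normal components are differences of [dfc], so the Lipschitz bound [dfc_dist]
    yields the linear vanishing. *)
Lemma lame_neumann_eigen : neumann_eigen T lame_eigenvalue lame.
Proof.
exists lame_grad; first exact: H1_has_grad has_grad_lame.
move=> phi Phi wPhi.
have [[hAA hBB hCC] hAB hAC hBC] := equilateral_grads eqT.
have hBA := hAB; rewrite dotC in hBA; have hCA := hAC; rewrite dotC in hCA.
have hCB := hBC; rewrite dotC in hCB.
have dS (v q r : R * R) (x : R) : dot v (x *: (q - r)) = x * (dot v q - dot v r).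
  by rewrite /dot/= /GRing.scale/=; ring.
have cv0 : 0 < curv A B by rewrite /curv divr_gt0// mulr_gt0// exprn_gt0// (equilateral_side_gt0 eqT).
have hh (x : R * R -> R) gx : has_grad x (fun=> gx) -> has_grad (fun p => dfc (x p)) (fun p => ddfc (x p) *: gx).
  by move=> hx; exact: (has_grad_comp is_derive_dfc cddfc hx).
have comp (e1 e2 e3 : R) := has_grad_add (has_grad_add (has_grad_scale e1 (hh _ _ hxB))
  (has_grad_scale e2 (hh _ _ hxC))) (has_grad_scale e3 (hh _ _ hxA)).
pose dF (e1 e2 e3 : R) p : R * R := e1 *: (ddfc (xB p) *: (gC - gA)) +
  e2 *: (ddfc (xC p) *: (gA - gB)) + e3 *: (ddfc (xA p) *: (gB - gC)).
have F1 : has_grad _ (dF (gC - gA).1 (gA - gB).1 (gB - gC).1) := comp _ _ _.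
have F2 : has_grad _ (dF (gC - gA).2 (gA - gB).2 (gB - gC).2) := comp _ _ _.
have dotBB (x y : R * R) : dot (x - y) (x - y) = dot x x + dot y y - 2 * dot x y.
  by rewrite /dot/=; ring.
have dCA : dot (gC - gA) (gC - gA) = 3 * curv A B by rewrite dotBB /gA /gC hCC hAA hCA; field.
have dAB : dot (gA - gB) (gA - gB) = 3 * curv A B by rewrite dotBB /gA /gB hAA hBB hAB; field.
have dBC : dot (gB - gC) (gB - gC) = 3 * curv A B by rewrite dotBB /gB /gC hBB hCC hBC; field.
have divE (u v w : R * R) (x y z : R) :
    (u.1 *: (x *: u) + v.1 *: (y *: v) + w.1 *: (z *: w)).1 +
    (u.2 *: (x *: u) + v.2 *: (y *: v) + w.2 *: (z *: w)).2 =
    x * dot u u + y * dot v v + z * dot w w.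
  by rewrite /dot/= /GRing.scale/=; ring.
have div p : (dF (gC - gA).1 (gA - gB).1 (gB - gC).1 p).1 + (dF (gC - gA).2 (gA - gB).2 (gB - gC).2 p).2 =
    - (lame_eigenvalue * lame p).
  transitivity (ddfc (xB p) * dot (gC - gA) (gC - gA) + ddfc (xC p) * dot (gA - gB) (gA - gB) +
    ddfc (xA p) * dot (gB - gC) (gB - gC)).
    exact: divE.
  by rewrite dCA dAB dBC /ddfc /lame_eigenvalue /lame; ring.
have FE p : ((gC - gA).1 * dfc (xB p) + (gA - gB).1 * dfc (xC p) + (gB - gC).1 * dfc (xA p),
   (gC - gA).2 * dfc (xB p) + (gA - gB).2 * dfc (xC p) + (gB - gC).2 * dfc (xA p)) = lame_grad p.
  rewrite [RHS]surjective_pairing /lame_grad/= /GRing.scale/=.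
  by congr pair; ring.
have := tangential_field det0 (M := 9 / 2 * curv A B * omega ^+ 2) wPhi F1 F2.
under [X in _ -> _ = - X]eq_Rintegral do rewrite FE.
have tang p : T p -> [/\ `|dot gA (lame_grad p)| <= 9 / 2 * curv A B * omega ^+ 2 * lA p,
    `|dot gB (lame_grad p)| <= 9 / 2 * curv A B * omega ^+ 2 * lB p &
    `|dot gC (lame_grad p)| <= 9 / 2 * curv A B * omega ^+ 2 * lC p].
  move=> /(triangle_lam det0)[]; rewrite -/lA -/lB -/lC => pA pB pC.
  have sum1 : lA p = 1 - lB p - lC p by [].
  (* The constant 9/2 is 3/2, from the products of the gradients, times 3, the rate at which the two
     phases separate. *)
  have bnd (d x y l : R) : 0 < l -> d = 3 / 2 * curv A B * (dfc x - dfc y) -> x - y = 3 * l ->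
      `|d| <= 9 / 2 * curv A B * omega ^+ 2 * l.
    move=> l0 -> xy; have k0 : 0 <= 3 / 2 * curv A B by rewrite mulr_ge0// ltW.
    have l3 : 0 <= 3 * l by rewrite mulr_ge0// ltW.
    have H := dfc_dist x y; rewrite xy (ger0_norm l3) in H.
    rewrite normrM (ger0_norm k0).
    apply: (le_trans (ler_wpM2l k0 H)).
    by rewrite le_eqVlt; apply/orP; left; apply/eqP; field.
  split.
  - apply: (bnd _ (xC p) (xB p)) => //; last by rewrite /xC /xB sum1; ring.
    rewrite /lame_grad !dotDr !dS /gA /gB /gC hAA hAB hAC; by field.
  - apply: (bnd _ (xA p) (xC p - 3)) => //; last by rewrite /xC /xA sum1; ring.
    rewrite dfc_periodic /lame_grad !dotDr !dS /gA /gB /gC hBA hBB hBC; by field.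
  - apply: (bnd _ (xB p) (xA p)) => //; last by rewrite /xB /xA sum1; ring.
    rewrite /lame_grad !dotDr !dS /gA /gB /gC hCA hCB hCC; by field.
move=> /(_ _) H.
have {}H := H (fun p Tp => ltac:(rewrite FE; exact: tang)).
have L1 := triangle_L2 det0 (has_grad_continuous has_grad_lame).
have [Lphi _ _ _] := wPhi.
transitivity (- - \int[leb2 R]_(p in T) dot (Phi p) (lame_grad p)).
  by rewrite opprK; apply: eq_Rintegral => p _; rewrite dotC.
rewrite -H -mulN1r -(RintegralZl _ mT (L2_mul mT L1 Lphi)).
have ip : (leb2 R).-integrable (T : set (RR R)) (EFin \o (fun p => phi p * - (lame_eigenvalue * lame p))).
  apply: eq_integrable (integrable_scale mT (- lame_eigenvalue) (L2_mul mT L1 Lphi)) => // p _ /=.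
  by congr _%:E; ring.
under eq_Rintegral do rewrite div.
rewrite -(RintegralZl _ mT ip); apply: eq_Rintegral => p _.
by rewrite mulN1r mulrN opprK; ring.
Qed.

Lemma lame_eigenvalueE : lame_eigenvalue = 16 * pi ^+ 2 / (9 * a ^+ 2).
Proof.
have a0 : a != 0 by rewrite gt_eqF// (equilateral_side_gt0 eqT).
by rewrite /lame_eigenvalue /curv /omega -/a; field.
Qed.

Lemma cst_neumann_eigen : neumann_eigen T 0 (fun=> 1).
Proof.
exists (fun=> 0); first exact: (H1_has_grad det0 (has_grad_cst 1)).
move=> phi Phi _; rewrite mul0r (@eq_Rintegral _ _ _ _ _ (fun=> 0)) ?Rintegral_cst ?mul0r// => p _.
by rewrite /dot/= !mul0r addr0.
Qed.

(** If the bound failed, the constant 1 and [lame] would be two independent eigenfunctions with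
    eigenvalues below mu. *)
Lemma second_eigenvalue_le mu : neumann_eigenvalue T 2 mu -> mu <= lame_eigenvalue.
Proof.
move=> emu; have mu0 := second_eigenvalue_gt0 emu; case: emu => _ notlt.
rewrite leNgt; apply/negP => ltmu; apply: notlt.
exists (fun i => if i == ord0 then fun=> 1 else lame), (fun i => if i == ord0 then 0 else lame_eigenvalue).
have o1 : lift ord0 ord0 = ord_max :> 'I_2 by apply/val_inj.
split; last first.
  move=> i; case: ifP => _; first by split => //; exact: cst_neumann_eigen.
  by split => //; exact: lame_neumann_eigen.
move=> x hx.
have cl := has_grad_continuous has_grad_lame.
have hz : forall p, T p -> x ord0 + x ord_max * lame p = 0.
  apply: continuous_ae0.
    by move=> p; apply: cvgD; [exact: cvg_cst|apply: cvgM; [exact: cvg_cst|exact: cl]].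
  apply: filterS hx; first exact: (ae_filter_ringOfSetsType (leb2 R)).
  by move=> p h Tp; rewrite -(h Tp) big_ord_recl big_ord_recl big_ord0 addr0 o1/= mulr1.
pose pt (b c : R) := affine2 A.1 A.2 (B.1 - A.1) (B.2 - A.2) (C.1 - A.1) (C.2 - A.2) (b, c).
have Tpt b c : 0 < b -> 0 < c -> b + c < 1 -> T (pt b c).
  move=> b0 c0 bc; apply/(triangle_lam det0).
  by rewrite lamA_param// lamB_param// lamC_param//=; split; lra.
have lpt b c : lame (pt b c) = fc (c - (1 - b - c)) + fc (1 - b - c - b + 1) + fc (b - c - 1).
  by rewrite /lame /xA /xB /xC /lA /lB /lC lamA_param// lamB_param// lamC_param.
(* Two points showing that [lame] is not constant: it is 1 at barycentric coordinates (1/4, 1/2,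
   1/4) and 1 - 2 sin (pi / 6) < 1 at the centroid. *)
have e1 := hz _ (Tpt 2^-1 4^-1 _ _ _); have {}e1 := e1 ltac:(lra) ltac:(lra) ltac:(lra).
have e2 := hz _ (Tpt 3^-1 3^-1 _ _ _); have {}e2 := e2 ltac:(lra) ltac:(lra) ltac:(lra).
have l1 : lame (pt 2^-1 4^-1) = 1.
  rewrite lpt /fc /omega.
  rewrite (_ : 2 * pi / 3 * (4^-1 - (1 - 2^-1 - 4^-1)) = 0); last by field.
  rewrite (_ : 2 * pi / 3 * (1 - 2^-1 - 4^-1 - 2^-1 + 1) = pi / 2); last by field.
  rewrite (_ : 2 * pi / 3 * (2^-1 - 4^-1 - 1) = - (pi / 2)); last by field.
  by rewrite cosN cos0 cos_pihalf !addr0.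
have l2 : lame (pt 3^-1 3^-1) < 1.
  rewrite lpt /fc /omega.
  rewrite (_ : 2 * pi / 3 * (3^-1 - (1 - 3^-1 - 3^-1)) = 0); last by field.
  rewrite (_ : 2 * pi / 3 * (1 - 3^-1 - 3^-1 - 3^-1 + 1) = pi / 6 + pi / 2); last by field.
  rewrite (_ : 2 * pi / 3 * (3^-1 - 3^-1 - 1) = - (pi / 6 + pi / 2)); last by field.
  rewrite cosN cos0 cosDpihalf.
  have : 0 < sin (pi / 6 : R) by apply: sin_gt0_pi; have := pi_gt0 R; lra.
  lra.
have x1 : x ord_max = 0.
  have : x ord_max * (1 - lame (pt 3^-1 3^-1)) = 0 by move: e1 e2; rewrite l1; lra.
  by move=> /eqP; rewrite mulf_eq0 => /orP[/eqP//|]; rewrite subr_eq0 gt_eqF.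
have x0 : x ord0 = 0 by move: e1; rewrite x1 mul0r addr0.
move=> i; have [->//|i0] := eqVneq i ord0.
by rewrite (_ : i = ord_max)//; apply/val_inj; case: i i0 => -[|[|]].
Qed.

End Eigenvalues.

(** * The value of the boundary integral *)

Section TrigonometricBounds.
Variable R : realType.
Implicit Types x t : R.

Lemma sin_le_id x : 0 <= x -> sin x <= x.
Proof.
move=> x0; have := @mean_value_dist R sin cos 0 x 0 1 (fun y => is_derive_sin y) _.
rewrite sin0 mul0r !subr0 mul1r (ger0_norm x0) => H.
by apply: (le_trans (ler_norm _)); apply: H => y _; rewrite subr0 cos_max.
Qed.

(** From cos x = 1 - 2 sin^2 (x / 2) and |sin (x / 2)| <= x / 2. *)
Lemma cos_ge_taylor2 x : 0 <= x -> 1 - x ^+ 2 / 2 <= cos x.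
Proof.
move=> x0; have h0 : 0 <= x / 2 by rewrite divr_ge0.
rewrite [in leRHS](_ : x = (x / 2) *+ 2); last by rewrite -mulr_natr divfK.
rewrite cos_mulr2n cos2sin2.
have s1 := sin_le_id h0.
have s2 : - (x / 2) <= sin (x / 2).
  have := @mean_value_dist R sin cos 0 (x / 2) 0 1 (fun y => is_derive_sin y) _.
  rewrite sin0 mul0r !subr0 mul1r (ger0_norm h0) => H.
  have {}H := H (fun y _ => ltac:(by rewrite subr0 cos_max)).
  by move: H; rewrite ler_norml => /andP[].
nra.
Qed.

Lemma sin_ge_taylor3 x : 0 <= x -> x - x ^+ 3 / 6 <= sin x.
Proof.
move=> x0; pose f := sin - id + 6^-1 \*: (id ^+ 3) : R -> R.
have df (y : R) : is_derive y (1 : R) f (cos y - 1 + y ^+ 2 / 2).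
  by apply: is_derive_eq; rewrite /GRing.scale/=; field.
have cf : {within `[0, x], continuous f}.
  by apply: continuous_subspaceT; exact: derive_continuous df.
have [z + E] := MVT_segment x0 (fun y _ => df y) cf.
rewrite in_itv/= => /andP[z0 _].
have fE y : f y = sin y - y + y ^+ 3 / 6 by rewrite /f /= -[LHS]/(sin y - y + 6^-1 * y ^+ 3) mulrC.
have := cos_ge_taylor2 z0; move: E; rewrite !fE sin0 subr0 expr0n/= mul0r addr0 subr0.
move=> E cz; rewrite -subr_ge0; have -> : sin x - (x - x ^+ 3 / 6) = sin x - x + x ^+ 3 / 6 by ring.
by rewrite E mulr_ge0//; lra.
Qed.

(** The triple angle formula at pi / 6 reads 3 s - 4 s^3 = 1, which factors as (s + 1) (2 s - 1)^2 =
    0. *)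
Lemma sin_pi6 : sin (pi / 6) = 2^-1 :> R.
Proof.
set x := pi / 6; set s := sin x.
have s0 : 0 < s by apply: sin_gt0_pi; have := pi_gt0 R; rewrite /x; lra.
have h : 3 * s - 4 * s ^+ 3 = 1.
  have e : sin (x + x + x) = 1 by rewrite -[RHS](sin_pihalf R); congr sin; rewrite /x; field.
  have c2 := cos2sin2 x; rewrite -/s in c2.
  rewrite -[RHS]e !sinD !cosD -/s.
  have -> : (s * cos x + cos x * s) * cos x + (cos x * cos x - s * s) * s = 3 * s * cos x ^+ 2 - s ^+ 3 by ring.
  by rewrite c2; ring.
have : (s + 1) * (2 * s - 1) ^+ 2 = 0.
  by have -> : (s + 1) * (2 * s - 1) ^+ 2 = 1 - (3 * s - 4 * s ^+ 3); [ring|rewrite h subrr].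
move=> /eqP; rewrite mulf_eq0 sqrf_eq0 => /orP[/eqP|/eqP]; lra.
Qed.

(** At x = pi / 6 the cubic lower bound of sin gives x - x^3 / 6 <= 1/2. This fails for 27/50 <= x <
    2/3, where the upper end comes from pi < 4. *)
Lemma pi_lt : pi < 81 / 25 :> R.
Proof.
have p0 := pi_gt0 R; have p2 := pihalf_lt2 R.
have x0 : (0 : R) <= pi / 6 by lra.
have := sin_ge_taylor3 x0; rewrite sin_pi6.
have : (pi : R) = 6 * (pi / 6) by field.
set x := pi / 6 in x0 * => pE H; rewrite pE in p0 p2 *.
have x23 : x < 2 / 3 by lra.
rewrite ltNge; apply/negP => xb.
have x54 : 27 / 50 <= x by lra.
have : x * (1 - x ^+ 2 / 6) <= 2^-1 by apply: le_trans H; rewrite le_eqVlt; apply/orP; left; apply/eqP; field.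
have x2 : x ^+ 2 <= 4 / 9 by nra.
nra.
Qed.

(* 1 / sqrt 3 < 11 / 19; at t = pi / sqrt 3 the left-hand side is about 0.1. *)
Lemma two_theta_cos_sin_gt0 t : 0 < t -> t ^+ 2 <= pi ^+ 2 / 3 -> 0 < 2 * t * cos t + sin t.
Proof.
move=> t0 tp; have p0 := pi_gt0 R; have pl := pi_lt.
have tb : t <= 11 / 19 * pi.
  by rewrite leNgt; apply/negP => tb; nra.
have s0 : 0 < sin t by apply: sin_gt0_pi; lra.
have [h|h] := leP t (pi / 2).
  rewrite ltr_wpDl// mulr_ge0//; first by lra.
  by apply: cos_ge0_pihalf; lra.
(* Past pi / 2 the claim reads 2 t sin u < cos u. With sin u <= u and cos u >= 1 - u^2 / 2 it
   follows from 2 t u + u^2 / 2 < 1, which the bounds 47/25 for t and 32/125 for u give with a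
   margin below 1/200. *)
pose u := t - pi / 2.
have tE : t = u + pi / 2 by rewrite /u; ring.
have u0 : 0 <= u by rewrite /u; lra.
have ub : u <= 3 / 38 * pi by rewrite /u; lra.
have su := sin_le_id u0; have cu := cos_ge_taylor2 u0.
rewrite {2 3}tE cosDpihalf sinDpihalf.
have u25 : u <= 32 / 125 by lra.
have t187 : t <= 47 / 25 by lra.
have : 2 * t * sin u <= 2 * t * u by rewrite ler_wpM2l//; lra.
have : t * u <= 47 / 25 * (32 / 125) by rewrite ler_pM//; lra.
have : u ^+ 2 <= (32 / 125) ^+ 2 by rewrite ler_sqr ?nnegrE//; lra.
lra.
Qed.

End TrigonometricBounds.

Section FluxValue.
Variables (R : realType) (A B C : R * R).
Hypothesis eqT : equilateral A B C.
Let T := triangle A B C.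
Let a := Defs.edist A B.
Let det0 := equilateral_det0 eqT.

(** The theta with c = 4 theta^2 curv; across the triangle the phase of each wave runs from - theta
    to theta. *)
Definition half_phase (c : R) : R := Num.sqrt (c / (4 * curv A B)).

Definition flux (c : R) : R :=
  6 * a ^+ 2 / `|tdet A B C| * (half_phase c * cos (half_phase c) / sin (half_phase c) + 2).

Let a0 : 0 < a := equilateral_side_gt0 eqT.

Let curv_gt0 : 0 < curv A B.
Proof. by rewrite /curv divr_gt0// mulr_gt0// exprn_gt0. Qed.

Let adet_gt0 : 0 < `|tdet A B C|.
Proof. by rewrite normr_gt0. Qed.

Lemma half_phase_gt0 c : 0 < c -> 0 < half_phase c.
Proof. by move=> c0; rewrite /half_phase sqrtr_gt0 divr_gt0// mulr_gt0. Qed.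

Lemma half_phase_sqr c : 0 < c -> half_phase c ^+ 2 = c / (4 * curv A B).
Proof.
move=> c0; rewrite /half_phase sqr_sqrtr//.
by apply: divr_ge0; [exact: ltW|rewrite mulr_ge0// ltW].
Qed.

(** Equality corresponds to c = [lame_eigenvalue]: 16 pi^2 / (9 a^2) divided by 4 curv is pi^2 /
    3. *)
Lemma half_phase_bound mu c : neumann_eigenvalue T 2 mu -> 0 < c <= mu ->
  half_phase c ^+ 2 <= pi ^+ 2 / 3.
Proof.
move=> /(second_eigenvalue_le eqT) mul /andP[c0 cmu].
have k0 : 0 < 4 * curv A B by exact: mulr_gt0.
rewrite half_phase_sqr// ler_pdivrMr//.
apply: (le_trans cmu); apply: (le_trans mul).
rewrite (lame_eigenvalueE eqT) /curv -/a le_eqVlt; apply/orP; left; apply/eqP.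
by field; rewrite gt_eqF.
Qed.

Lemma sin_half_phase_gt0 mu c : neumann_eigenvalue T 2 mu -> 0 < c <= mu -> 0 < sin (half_phase c).
Proof.
move=> emu cmu; have tb := half_phase_bound emu cmu.
have t0 := half_phase_gt0 (proj1 (andP cmu)).
apply: sin_gt0_pi; rewrite t0/= ltNge; apply/negP => tp.
have p0 := pi_gt0 R; nra.
Qed.

Lemma solution_flux mu c u g : neumann_eigenvalue T 2 mu -> 0 < c <= mu ->
  neumann_solution A B C c u g -> c * bd_int A B C g = flux c.
Proof.
move=> emu cmu sol; have c0 := proj1 (andP cmu).
have t0 := half_phase_gt0 c0; have s0 := sin_half_phase_gt0 emu cmu.
have cE : c = 4 * half_phase c ^+ 2 * curv A B.
  by rewrite half_phase_sqr//; field; rewrite gt_eqF.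
set t := half_phase c in t0 s0 cE *.
(* The amplitude demanded by [normalized]; it exists because sin t is positive up to and including c
   = mu. *)
pose K := a / (`|tdet A B C| * curv A B * (2 * t * sin t)).
have nz : [&& t != 0, sin t != 0, curv A B != 0 & `|tdet A B C| != 0].
  by rewrite !gt_eqF.
have [tn sn cn dn] := and4P nz.
have norm : `|tdet A B C| * curv A B * (2 * t * K * sin t) = Defs.edist A B.
  by rewrite /K -/a; field; rewrite tn sn cn dn.
rewrite (solution_bd_int eqT norm cE sol) (wave_bd_int eqT K tn) /flux -/t {1}cE /K -/a.
by field; rewrite tn sn cn dn.
Qed.

Lemma flux_gt mu : neumann_eigenvalue T 2 mu ->
  2^-1 * (perimeter A B C ^+ 2 / area A B C) < flux mu.
Proof.
move=> emu; have mu0 := second_eigenvalue_gt0 eqT emu.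
have mumu : 0 < mu <= mu by rewrite mu0 lexx.
have tb := half_phase_bound emu mumu; have t0 := half_phase_gt0 mu0.
have s0 := sin_half_phase_gt0 emu mumu.
have := two_theta_cos_sin_gt0 t0 tb; rewrite /flux.
set t := half_phase mu in t0 s0 tb * => pos.
have -> : perimeter A B C = 3 * a.
  by case: eqT => _ hb hc; rewrite /perimeter hb hc -/a; ring.
rewrite (area_triangle det0) -subr_gt0.
(* The perimeter term equals 9 a^2 / |tdet|, so the difference is a positive multiple of 2 t cos t +
   sin t. *)
have -> : 6 * a ^+ 2 / `|tdet A B C| * (t * cos t / sin t + 2) -
    2^-1 * ((3 * a) ^+ 2 / (`|tdet A B C| / 2)) =
    3 * a ^+ 2 / (`|tdet A B C| * sin t) * (2 * t * cos t + sin t).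
  by field; rewrite !gt_eqF.
by rewrite mulr_gt0// divr_gt0// mulr_gt0// exprn_gt0.
Qed.

Lemma flux_continuous mu : neumann_eigenvalue T 2 mu -> {for mu, continuous flux}.
Proof.
move=> emu; have mu0 := second_eigenvalue_gt0 eqT emu.
have mumu : 0 < mu <= mu by rewrite mu0 lexx.
have s0 := sin_half_phase_gt0 emu mumu.
have ct : {for mu, continuous half_phase}.
  have cq : {for mu, continuous (fun c : R => c / (4 * curv A B))}.
    by apply: cvgM; [exact: cvg_id|exact: cvg_cst].
  exact: (continuous_comp cq (@sqrt_continuous R _)).
have cc : {for mu, continuous (fun c => cos (half_phase c))}.
  by apply: continuous_comp; [exact: ct|exact: continuous_cos].
have cs : {for mu, continuous (fun c => sin (half_phase c))}.
  by apply: continuous_comp; [exact: ct|exact: continuous_sin].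
apply: cvgM; first exact: cvg_cst.
apply: cvgD; last exact: cvg_cst.
apply: cvgM; first by apply: cvgM; [exact: ct|exact: cc].
by apply: cvgV; [rewrite gt_eqF|exact: cs].
Qed.

End FluxValue.

Theorem proposition6p4 (R : realType) (A B C : R * R)
    (hT : equilateral A B C)
    (mu2 : R) (hmu2 : neumann_eigenvalue (triangle A B C) 2 mu2)
    (u g : R -> R * R -> R)
    (hu : forall c : R, 0 < c <= mu2 -> neumann_solution A B C c (u c) (g c)) :
  ((fun c : R => c * bd_int A B C (g c)) @ mu2^'-
     --> mu2 * bd_int A B C (g mu2)) /\
  mu2 * bd_int A B C (g mu2) >
    2^-1 * (perimeter A B C ^+ 2 / area A B C).
Proof.
have mu0 := second_eigenvalue_gt0 hT hmu2.
have mumu : 0 < mu2 <= mu2 by rewrite mu0 lexx.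
rewrite (solution_flux hT hmu2 mumu (hu _ mumu)); split; last exact: flux_gt.
apply: (cvg_trans _ (cvg_at_left_filter (flux_continuous hT hmu2))).
(* The boundary integral equals [flux] for c in ]0, mu2], hence for all c close to mu2 on the
   left. *)
apply: near_eq_cvg; near=> c; symmetry.
have c0 : 0 < c by near: c; exact: nbhs_left_gt.
have cmu : c < mu2 by near: c; exact: nbhs_left_lt.
have cc : 0 < c <= mu2 by rewrite c0 ltW.
exact: (solution_flux hT hmu2 cc (hu _ cc)).
Unshelve. all: by end_near. Qed.
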